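(* Let $p$ be an odd prime number, $k$ a positive integer, and $X$ be any simple factor of $J_{p^k}$. Then $X$ is a nondegenerate abelian variety.
   Context: For $m\ge 3$, $J_m/\mathbb{Q}$ is the Jacobian of the smooth projective curve over $\mathbb{Q}$ with affine equation $y^2=x^m+1$. A simple factor of $J_{p^k}$ is a simple abelian variety appearing in the decomposition of $J_{p^k}$ up to isogeny; these factors are geometrically simple and have complex multiplication. A CM abelian variety $A$ is called nondegenerate if the rank of its Hodge group is equal to $\dim A$ (equivalently, its Mumford--Tate group has dimension $\dim A+1$). Here, for $V=H^1(A(\mathbb{C}),\mathbb{Q})$ with Hodge structure given by $h:\mathbb{S}=\operatorname{Res}_{\mathbb{C}/\mathbb{R}}\mathbb{G}_m\to\operatorname{GL}_{V,\mathbb{R}}$, the Mumford--Tate group (resp. Hodge group) is the smallest algebraic $\mathbb{Q}$-subgroup of $\operatorname{GL}_V$ whose base change to $\mathbb{R}$ contains the image of $h$ (resp. of the restriction of $h$ to the norm-one subtorus of $\mathbb{S}$). *)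

(* Defs.v *)
(* The complex numbers are R[i], for R : realType. *)
From HB Require Import structures.
From mathcomp Require Import all_boot all_order all_algebra.
From mathcomp Require Import all_classical all_reals all_analysis.
From mathcomp.real_closed Require Import complex.
(* Not imported: the notations of mpoly clash with those of MathComp-Analysis. *)
From mathcomp.multinomials Require mpoly.

Set Implicit Arguments.
Unset Strict Implicit.
Unset Printing Implicit Defensive.

Import Order.TTheory GRing.Theory Num.Theory.
Import numFieldNormedType.Exports.

Local Open Scope classical_set_scope.
Local Open Scope ring_scope.
Local Open Scope complex_scope.

(* All finite combinations of elements of S with coefficients in f(K); used with
   K = int, rat or the reals, for which f is the embedding into the scalars C. *)
Definition span_over (K : Type) (C : pzRingType) (f : K -> C) (V : lmodType C)
    (S : set V) : set V :=
  [set v | exists (q : nat) (c : 'I_q -> K) (s : 'I_q -> V),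
     (forall i, S (s i)) /\ v = \sum_i f (c i) *: s i].

Section ComplexTori.
Variable R : realType.
Local Notation C := R[i].

(* A complex torus C^n / L is represented by the subset L of C^n, the elements
   of C^n being row vectors. *)

(* The rows of B are a Z-basis of L and an R-basis of C^n. *)
Definition lattice_basis n (B : 'M[C]_(n.*2, n)) (L : set 'rV[C]_n) : Prop :=
  L = span_over (fun a : int => a%:~R : C) (range (fun i => row i B)) /\
  forall c : 'rV[R]_(n.*2), map_mx (real_complex R) c *m B = 0 -> c = 0.

Definition is_lattice n (L : set 'rV[C]_n) : Prop :=
  exists B : 'M[C]_(n.*2, n), lattice_basis B L.

Definition conj_tr m n (A : 'M[C]_(m, n)) : 'M[C]_(n, m) :=
  (map_mx (@conjc R) A)^T.

(* Positive definite Hermitian form whose imaginary part is integral on L. *)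
Definition riemann_form n (L : set 'rV[C]_n) (H : 'M[C]_n) : Prop :=
  [/\ conj_tr H = H,
      forall v : 'rV[C]_n, v != 0 -> 0 < (v *m H *m conj_tr v) 0 0
    & forall u v, L u -> L v ->
        exists a : int, complex.Im ((u *m H *m conj_tr v) 0 0) = a%:~R].

(* A complex abelian variety is a polarizable complex torus. *)
Definition abelian_variety n (L : set 'rV[C]_n) : Prop :=
  is_lattice L /\ exists H : 'M[C]_n, riemann_form L H.

Definition prod_torus n1 n2 (L1 : set 'rV[C]_n1) (L2 : set 'rV[C]_n2) :
    set 'rV[C]_(n1 + n2) :=
  [set w | exists u v, [/\ L1 u, L2 v & w = row_mx u v]].

(* M is invertible, hence in particular n1 = n2; between full lattices this is
   an isogeny (surjective with finite kernel). *)
Definition isogenous n1 n2 (L1 : set 'rV[C]_n1) (L2 : set 'rV[C]_n2) : Prop :=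
  exists M : 'M[C]_(n1, n2),
    [/\ row_free M, row_full M & forall v, L1 v -> L2 (v *m M)].

(* The image in C^n / L of the row space W is a subtorus: the intersection of L
   and W spans W over the reals. *)
Definition subtorus n (L : set 'rV[C]_n) (W : 'M[C]_n) : Prop :=
  forall w : 'rV[C]_n, (w <= W)%MS ->
    span_over (real_complex R) [set l | L l /\ (l <= W)%MS] w.

(* Subtori of an abelian variety are its abelian subvarieties. *)
Definition simple_abelian_variety n (L : set 'rV[C]_n) : Prop :=
  [/\ abelian_variety L, (0 < n)%N
    & forall W : 'M[C]_n, subtorus L W -> \rank W = 0 \/ \rank W = n].

Definition simple_factor n g (L : set 'rV[C]_n) (J : set 'rV[C]_g) : Prop :=
  simple_abelian_variety L /\
  exists (n' : nat) (L' : set 'rV[C]_n'),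
    abelian_variety L' /\ isogenous (prod_torus L L') J.

(* M is in End(C^n / L) tensored with Q. *)
Definition rational_endo n (L : set 'rV[C]_n) (M : 'M[C]_n) : Prop :=
  exists N : nat, (0 < N)%N /\ forall v, L v -> L ((v *m M) *+ N).

(* The rational endomorphism algebra contains a commutative semisimple (i.e.
   reduced) Q-algebra E of dimension 2n; e is a Q-basis of E. *)
Definition has_CM n (L : set 'rV[C]_n) : Prop :=
  exists e : 'I_(n.*2) -> 'M[C]_n,
    let E := span_over (fun a : rat => ratr a : C) (range e) in
    [/\ forall c : 'I_(n.*2) -> rat,
          \sum_i (ratr (c i) : C) *: e i = 0 -> forall i, c i = 0,
        forall M, E M -> rational_endo L M,
        E 1%:M,
        forall M N, E M -> E N -> E (M *m N) /\ M *m N = N *m M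
      & forall M, E M -> M *m M = 0 -> M = 0].

(* An algebraic subgroup of GL_N over Q is given by its complex points, i.e. a
   subgroup of GL_N(C) cut out by polynomials in the entries with rational
   coefficients (group schemes over Q are reduced, so nothing is lost). *)
Definition algebraic_Q_subgroup N (G : set 'M[C]_N) : Prop :=
  [/\ exists S : set (mpoly.mpoly (N * N) rat),
        G = [set M | M \in unitmx /\
               forall P, S P ->
                 mpoly.meval (fun i => mxvec M 0 i)
                   (mpoly.map_mpoly (fun a : rat => ratr a : C) P) = 0],
      G 1%:M,
      forall M M', G M -> G M' -> G (M *m M')
    & forall M, G M -> G (invmx M)].

(* V = H^1(C^n / L, Q) is the dual of the Q-span of L; the dual basis of B
   identifies V with column vectors, a functional f being the column of the
   values f(b_j).  For z in S(R) = C^*, h(z) is f |-> f(z * _), which is z on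
   V^{1,0} (the C-linear functionals) and z^* on V^{0,1}; since
   z b_j = \sum_k A_jk b_k, its matrix is A.  Here z runs over the norm-one
   subtorus, whose real points are Zariski dense in it. *)
Definition hodge_circle n (B : 'M[C]_(n.*2, n)) : set 'M[R]_(n.*2) :=
  [set A | exists z : C, `|z| = 1 /\ map_mx (real_complex R) A *m B = z *: B].

(* The smallest algebraic Q-subgroup of GL_V containing the image of h on the
   norm-one subtorus. *)
Definition hodge_group n (B : 'M[C]_(n.*2, n)) : set 'M[C]_(n.*2) :=
  [set M | forall G : set 'M[C]_(n.*2),
     algebraic_Q_subgroup G ->
     (forall A, hodge_circle B A -> G (map_mx (real_complex R) A)) -> G M].

(* phi is an injective homomorphism of algebraic groups from (G_m)^r to GL_N
   over C, with image in G; its entries are Laurent polynomials. *)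
Definition torus_embedding r N (G : set 'M[C]_N)
    (phi : ('I_r -> C) -> 'M[C]_N) : Prop :=
  let Gm := [set t : 'I_r -> C | forall i, t i != 0] in
  [/\ forall t, Gm t -> G (phi t),
      forall s t, Gm s -> Gm t ->
        phi (fun i => s i * t i) = phi s *m phi t,
      forall s t, Gm s -> Gm t -> phi s = phi t -> s = t
    & exists (k : nat) (P : 'I_N -> 'I_N -> mpoly.mpoly r C),
        forall t, Gm t -> forall i j,
          (\prod_(l < r) t l) ^+ k * phi t i j = mpoly.meval t (P i j)].

(* The (absolute) rank of an algebraic group: the largest dimension of a torus
   contained in it. *)
Definition alg_rank N (G : set 'M[C]_N) (r : nat) : Prop :=
  (exists phi : ('I_r -> C) -> 'M[C]_N, torus_embedding G phi) /\
  forall s (phi : ('I_s -> C) -> 'M[C]_N), torus_embedding G phi -> (s <= r)%N.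

Definition nondegenerate_av n (L : set 'rV[C]_n) : Prop :=
  [/\ abelian_variety L, has_CM L
    & forall B : 'M[C]_(n.*2, n), lattice_basis B L ->
        alg_rank (hodge_group B) n].

Definition C1 (f : R -> C) : Prop :=
  forall g : R -> R,
    g = (fun t => complex.Re (f t)) \/ g = (fun t => complex.Im (f t)) ->
    (forall t, derivable g t 1) /\ continuous (derive1 g).

Definition cderive (f : R -> C) (t : R) : C :=
  derive1 (fun s => complex.Re (f s)) t +i* derive1 (fun s => complex.Im (f s)) t.

Definition cintegral01 (f : R -> C) : C :=
  (\int[lebesgue_measure]_(t in `[0, 1]) complex.Re (f t)) +i*
  (\int[lebesgue_measure]_(t in `[0, 1]) complex.Im (f t)).

Definition genus (m : nat) : nat := m.-1./2.

(* (x, y) restricted to [0, 1] is a C^1 loop on y^2 = x^m + 1, away from the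
   points with y = 0. *)
Definition curve_loop (m : nat) (x y : R -> C) : Prop :=
  [/\ C1 x, C1 y, x 0 = x 1 /\ y 0 = y 1
    & forall t : R, 0 <= t <= 1 -> y t ^+ 2 = x t ^+ m + 1 /\ y t != 0].

(* The integrals along a loop of x^i dx / y, 0 <= i < genus m, the standard
   basis of the holomorphic differentials of the smooth projective curve. *)
Definition period (m : nat) (x y : R -> C) : 'rV[C]_(genus m) :=
  \row_(i < genus m) cintegral01 (fun t => x t ^+ i * cderive x t / y t).

(* The period lattice H_1(curve, Z) in H^0(curve, Omega)^* = C^(genus m), so
   that the Jacobian of y^2 = x^m + 1 over C is the quotient.  Removing finitely
   many points (those at infinity or with y = 0) from the smooth projective
   curve does not change the image of H_1, and every homology class is
   represented by C^1 loops. *)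
Definition jacobian_lattice (m : nat) : set 'rV[C]_(genus m) :=
  span_over (fun a : int => a%:~R : C)
    [set v | exists x y, curve_loop m x y /\ v = period m x y].

End ComplexTori.

Arguments jacobian_lattice : clear implicits.

(* Main.v *)
(** Write m = p^k. Continuing the primitives of the x^i dx/y analytically along
    loops, with incomplete integrals in x near 0 and in x^(-1/2) near infinity as
    branches, shows that every period is kappa_i P(zeta_m^(i+1)), where P is a
    rational polynomial independent of i. A simple factor C^n / L therefore
    receives from these polynomials vectors t_i of L tensored with Q, on which
    the i-dependence is through the zeta_q^(b i) with 0 < b < q/2 prime to q, for
    some q > 1 dividing m.

    Everything then rests on the regularity of the matrix of signs of a b mod q,
    0 < a, b < q/2, i.e. on the nonvanishing of the half sums of chi(a),
    0 < a < q/2, for odd characters chi. Expanding a square wave in a Fourier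
    series turns this into L(1, chi) <> 0, which follows for prime power q by
    comparison of all the L(s, chi^j) near s = 1.

    By regularity and simplicity, L tensored with Q is Q(zeta_q) with the CM type
    {b : 0 < b < q/2}, which gives complex multiplication. By regularity again,
    the Galois conjugates of the circle of the Hodge group generate a torus of
    dimension n. The rank is not larger, since the Hodge group is contained in a
    unitary group with at most 2^n points of order dividing 2. *)
Require Import Defs.
From mathcomp Require Import all_boot all_order all_algebra all_fingroup all_solvable all_field.
From mathcomp Require Import all_classical all_reals all_analysis.
From mathcomp.real_closed Require Import complex.
From mathcomp Require Import ring lra zify.
From mathcomp.multinomials Require Import (canonicals, coercions) mpoly.

Set Implicit Arguments.
Unset Strict Implicit.
Unset Printing Implicit Defensive.

Import Order.TTheory GRing.Theory Num.Theory.
Import numFieldNormedType.Exports.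
Local Open Scope classical_set_scope.
Local Open Scope ring_scope.
Local Open Scope complex_scope.

(** * Derivatives of complex functions of a real variable *)

Section ComplexDerivative.
Variable R : realType.
Local Notation C := R[i].
Local Notation Re := complex.Re.
Local Notation Im := complex.Im.

(** The topology of the curve enters through a single inclusion. The periods lie among evaluations
    of rational polynomials modulo 1 + X + ... + X^(m-1), a Q-space of dimension m - 1 = 2g; as the
    simple factor and its complement together have a lattice of rank 2g, counting dimensions turns
    the inclusion into an equality, and no cycle is ever exhibited. The CM type reflects the range i
    + 1 < m/2 of the differentials x^i dx/y. Degeneracy would be a linear relation between the
    Galois translates of the CM type. Characters diagonalize these translates, with the half sums as
    eigenvalues at odd characters. For a prime power, the half sum of an imprimitive character
    reduces to the one at its conductor; with several primes it may acquire a vanishing Euler factor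
    1 - chi(l). Automorphisms of the complex numbers are replaced by the passage of rational
    polynomial relations from one primitive root of unity to another, and L-series by explicit
    bounds on their partial sums. *)

Lemma eq_ReIm (z w : C) : Re z = Re w -> Im z = Im w -> z = w.
Proof. by case: z w => [a b] [c d] /= -> ->. Qed.

Lemma cReD (z w : C) : Re (z + w) = Re z + Re w. Proof. by case: z w => [a b] []. Qed.
Lemma cImD (z w : C) : Im (z + w) = Im z + Im w. Proof. by case: z w => [a b] []. Qed.
Lemma cReN (z : C) : Re (- z) = - Re z. Proof. by case: z. Qed.
Lemma cImN (z : C) : Im (- z) = - Im z. Proof. by case: z. Qed.
Lemma cReM (z w : C) : Re (z * w) = Re z * Re w - Im z * Im w.
Proof. by case: z w => [a b] []. Qed.
Lemma cImM (z w : C) : Im (z * w) = Re z * Im w + Im z * Re w.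
Proof. by case: z w => [a b] [] c d /=; ring. Qed.
Lemma cReV (z : C) : Re z^-1 = Re z / (Re z ^+ 2 + Im z ^+ 2).
Proof. by case: z. Qed.
Lemma cImV (z : C) : Im z^-1 = - (Im z / (Re z ^+ 2 + Im z ^+ 2)).
Proof. by case: z => a b; rewrite /= -mulNr. Qed.
Lemma sum_sqr_gt0 (z : C) : z != 0 -> 0 < Re z ^+ 2 + Im z ^+ 2.
Proof.
case: z => a b; rewrite eq_complex /= negb_and => /orP[h|h].
  by rewrite ltr_pwDl ?sqr_ge0 // lt_def sqr_ge0 sqrf_eq0 h.
by rewrite ltr_wpDl ?sqr_ge0 // lt_def sqr_ge0 sqrf_eq0 h.
Qed.

Lemma is_rderD (f g : R -> R) (t d e : R) :
  is_derive t (1 : R) f d -> is_derive t (1 : R) g e ->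
  is_derive t (1 : R) (fun s => f s + g s) (d + e).
Proof. exact: is_deriveD. Qed.

Lemma is_rderN (f : R -> R) (t d : R) :
  is_derive t (1 : R) f d -> is_derive t (1 : R) (fun s => - f s) (- d).
Proof. exact: is_deriveN. Qed.

Lemma is_rderM (f g : R -> R) (t d e : R) :
  is_derive t (1 : R) f d -> is_derive t (1 : R) g e ->
  is_derive t (1 : R) (fun s => f s * g s) (d * g t + f t * e).
Proof.
move=> h1 h2; apply: (is_derive_eq (is_deriveM h1 h2)).
by rewrite addrC [d * _]mulrC.
Qed.

Lemma is_rderV (f : R -> R) (t d : R) : f t != 0 ->
  is_derive t (1 : R) f d -> is_derive t (1 : R) (fun s => (f s)^-1) (- (f t ^- 2 * d)).
Proof.
by move=> f0 h1; apply: (is_derive_eq (is_deriveV f0 h1)); rewrite scaleNr.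
Qed.

Lemma is_rder_sqrt (f : R -> R) (t d : R) : 0 < f t ->
  is_derive t (1 : R) f d ->
  is_derive t (1 : R) (fun s => Num.sqrt (f s)) ((2 * Num.sqrt (f t))^-1 * d).
Proof. by move=> f0 h1; apply: is_derive1_comp => //; exact: is_derive1_sqrt. Qed.

Lemma rder_gt0_near (f : R -> R) (t d : R) : 0 < f t ->
  is_derive t (1 : R) f d -> \near t, 0 < f t.
Proof.
move=> f0 h1; have cN : {for t, continuous f}.
  by apply: differentiable_continuous; apply/derivable1_diffP; exact: ex_derive.
exact: (cvgr_gt _ cN).
Qed.

Definition is_cder (f : R -> C) (t : R) (d : C) :=
  is_derive t 1 (fun s => Re (f s)) (Re d) /\
  is_derive t 1 (fun s => Im (f s)) (Im d).

Lemma is_cder_eq f t d d' : is_cder f t d -> d = d' -> is_cder f t d'.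
Proof. by move=> ? <-. Qed.

Lemma is_cder_ext f g t d : f =1 g -> is_cder f t d -> is_cder g t d.
Proof. by move=> /funext->. Qed.

Lemma is_cder_near f g t d : (\near t, f t = g t) -> is_cder f t d -> is_cder g t d.
Proof.
move=> fg [h1 h2]; split; [apply: near_eq_is_derive h1|apply: near_eq_is_derive h2];
  by apply: filterS fg => s ->.
Qed.

Lemma is_cder_unique f t d d' : is_cder f t d -> is_cder f t d' -> d = d'.
Proof.
move=> [h1 h2] [h3 h4]; apply: eq_ReIm.
  by rewrite -(@derive_val _ _ _ _ _ _ _ h1) -(@derive_val _ _ _ _ _ _ _ h3).
by rewrite -(@derive_val _ _ _ _ _ _ _ h2) -(@derive_val _ _ _ _ _ _ _ h4).
Qed.

Lemma is_cder_cst (c : C) t : is_cder (fun=> c) t 0.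
Proof. by split; exact: is_derive_cst. Qed.

Lemma is_cder_real (h : R -> R) t d : is_derive t (1 : R) h d -> is_cder (fun s => (h s)%:C) t d%:C.
Proof. by move=> ?; split => //; exact: is_derive_cst. Qed.

Lemma is_cderD f g t d e : is_cder f t d -> is_cder g t e ->
  is_cder (fun s => f s + g s) t (d + e).
Proof.
move=> [h1 h2] [h3 h4]; split; rewrite ?cReD ?cImD.
  rewrite (_ : (fun s => _) = (fun s => Re (f s)) + (fun s => Re (g s))).
    exact: is_deriveD.
  by apply/funext => s; rewrite cReD.
rewrite (_ : (fun s => _) = (fun s => Im (f s)) + (fun s => Im (g s))).
  exact: is_deriveD.
by apply/funext => s; rewrite cImD.
Qed.

Lemma is_cderN f t d : is_cder f t d -> is_cder (fun s => - f s) t (- d).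
Proof.
move=> [h1 h2]; split; rewrite ?cReN ?cImN.
  rewrite (_ : (fun s => _) = - (fun s => Re (f s))).
    exact: is_deriveN.
  by apply/funext => s; rewrite cReN.
rewrite (_ : (fun s => _) = - (fun s => Im (f s))).
  exact: is_deriveN.
by apply/funext => s; rewrite cImN.
Qed.

Lemma is_cderB f g t d e : is_cder f t d -> is_cder g t e ->
  is_cder (fun s => f s - g s) t (d - e).
Proof. by move=> hf hg; apply: is_cderD => //; exact: is_cderN. Qed.

Lemma is_cderM f g t d e : is_cder f t d -> is_cder g t e ->
  is_cder (fun s => f s * g s) t (d * g t + f t * e).
Proof.
move=> [h1 h2] [h3 h4]; split.
  rewrite (_ : (fun s => _) = (fun s => Re (f s) * Re (g s) + - (Im (f s) * Im (g s)))).
    apply: (is_derive_eq (is_rderD (is_rderM h1 h3) (is_rderN (is_rderM h2 h4)))).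
    by rewrite cReD !cReM; ring.
  by apply/funext => s; rewrite cReM.
rewrite (_ : (fun s => _) = (fun s => Re (f s) * Im (g s) + Im (f s) * Re (g s))).
  apply: (is_derive_eq (is_rderD (is_rderM h1 h4) (is_rderM h2 h3))).
  by rewrite cImD !cImM; ring.
by apply/funext => s; rewrite cImM.
Qed.

Lemma is_cderZ (c : C) f t d : is_cder f t d -> is_cder (fun s => c * f s) t (c * d).
Proof.
move=> h; apply: (is_cder_eq (is_cderM (is_cder_cst c t) h)).
by rewrite mul0r add0r.
Qed.

Lemma is_cderX f t d n : is_cder f t d ->
  is_cder (fun s => f s ^+ n) t (n%:R * f t ^+ n.-1 * d).
Proof.
move=> h; elim: n => [|n IH].
  by rewrite !mul0r; exact: is_cder_cst.
apply: (is_cder_ext (f := fun s => f s * f s ^+ n)); first by move=> s; rewrite exprS.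
apply: (is_cder_eq (is_cderM h IH)) => /=.
case: n IH => [|n] _; first by rewrite !expr0 !mul0r mulr0 addr0 mulr1 !mul1r.
by rewrite /= exprS -[n.+2]addn1 natrD; ring.
Qed.

(** Differentiability is read off the real formulas for the two components of the inverse;
    uniqueness of the derivative of [f * f^-1 = 1] then gives its value. The same device serves for
    [csqrt], with the square in place of the product. *)
Lemma is_cderV f t d : is_cder f t d -> f t != 0 ->
  is_cder (fun s => (f s)^-1) t (- d / f t ^+ 2).
Proof.
move=> h ft0; have [h1 h2] := h.
have n0 := sum_sqr_gt0 ft0.
pose N s := Re (f s) * Re (f s) + Im (f s) * Im (f s).
have hN := is_rderD (is_rderM h1 h1) (is_rderM h2 h2); rewrite -/N in hN.
have Nt0 : 0 < N t by rewrite /N -!expr2.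
have hV := is_rderV (lt0r_neq0 Nt0) hN.
have [e he] : exists e, is_cder (fun s => (f s)^-1) t e.
  eexists (_ +i* _); split => /=.
    rewrite (_ : (fun s => _) = (fun s => Re (f s) * (N s)^-1)).
      exact: is_rderM h1 hV.
    by apply/funext => s; rewrite cReV /N -!expr2.
  rewrite (_ : (fun s => _) = (fun s => - (Im (f s) * (N s)^-1))).
    exact: is_rderN (is_rderM h2 hV).
  by apply/funext => s; rewrite cImV /N -!expr2.
apply: (is_cder_eq he).
have nf : \near t, f t != 0.
  apply: filterS (rder_gt0_near Nt0 hN) => s; apply: contraTneq => fs0.
  by rewrite /N fs0 /= !mulr0 addr0 ltxx.
have h3 : is_cder (fun=> 1) t (d * (f t)^-1 + f t * e).
  apply: is_cder_near (is_cderM h he).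
  by apply: filterS nf => s fs0; rewrite mulfV.
have := is_cder_unique h3 (is_cder_cst 1 t).
move=> /(canRL (addKr _)); rewrite addr0 => h4.
by rewrite -[LHS](mulKf ft0) h4; field.
Qed.

(** The plane cut along the nonpositive reals, where [csqrt] is the branch of the square root with
    positive real part. *)
Definition slit (w : C) := (Im w != 0) || (0 < Re w).

Definition csqrt (w : C) : C :=
  let r := Num.sqrt ((Normc.normc w + Re w) / 2) in r +i* (Im w / (2 * r)).

Lemma normcE2 (w : C) : Normc.normc w = Num.sqrt (Re w ^+ 2 + Im w ^+ 2).
Proof. by case: w. Qed.

Lemma slit_pos w : slit w -> 0 < (Normc.normc w + Re w) / 2.
Proof.
move=> /orP h; rewrite divr_gt0 // normcE2.
case: h => h; last by rewrite ltr_wpDl ?sqrtr_ge0.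
have : `|Re w| < Num.sqrt (Re w ^+ 2 + Im w ^+ 2).
  rewrite -sqrtr_sqr ltr_sqrt.
    by rewrite ltrDl lt_def sqr_ge0 sqrf_eq0 h.
  by rewrite ltr_wpDl ?sqr_ge0 // lt_def sqr_ge0 sqrf_eq0 h.
move=> hlt; rewrite -ltrBlDr sub0r; apply: le_lt_trans hlt.
by rewrite -normrN ler_norm.
Qed.

Lemma Re_csqrt_gt0 w : slit w -> 0 < Re (csqrt w).
Proof. by move=> h; rewrite /= sqrtr_gt0 slit_pos. Qed.

Lemma csqrtK w : slit w -> csqrt w ^+ 2 = w.
Proof.
move=> h; have hp := slit_pos h; have hr := Re_csqrt_gt0 h.
rewrite /csqrt /= in hr *; set r := Num.sqrt _ in hr *.
have r2 : r ^+ 2 = (Normc.normc w + Re w) / 2 by rewrite sqr_sqrtr // ltW.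
have n2 : Normc.normc w ^+ 2 = Re w ^+ 2 + Im w ^+ 2.
  by rewrite normcE2 sqr_sqrtr // addr_ge0 ?sqr_ge0.
have r0 : r != 0 by rewrite gt_eqF.
rewrite expr2; apply: eq_ReIm => /=; last by field.
have -> : Re w = 2 * r ^+ 2 - Normc.normc w by rewrite r2; field.
have hI : Im w ^+ 2 = 4 * r ^+ 2 * (Normc.normc w - r ^+ 2).
  rewrite (_ : Im w ^+ 2 = Normc.normc w ^+ 2 - Re w ^+ 2); last by rewrite n2; ring.
  have -> : Re w = 2 * r ^+ 2 - Normc.normc w by rewrite r2; field.
  by ring.
have -> : Im w / (2 * r) * (Im w / (2 * r)) = Im w ^+ 2 / (4 * r ^+ 2) by field.
by rewrite hI; field.
Qed.

Lemma csqrt_neq0 w : slit w -> csqrt w != 0.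
Proof.
by move=> /Re_csqrt_gt0; apply: contraTneq => ->; rewrite ltxx.
Qed.

Lemma csqrt_unique w s : slit w -> s ^+ 2 = w -> 0 < Re s -> s = csqrt w.
Proof.
move=> h hs s0; have := csqrtK h; rewrite -{2}hs => /eqP; rewrite eqf_sqr.
case/orP => /eqP e //.
by have := Re_csqrt_gt0 h; rewrite e cReN oppr_gt0 ltNge ltW.
Qed.

Lemma is_cder_csqrt f t d : is_cder f t d -> slit (f t) ->
  is_cder (fun s => csqrt (f s)) t (d / (2 * csqrt (f t))).
Proof.
move=> h sf; have [h1 h2] := h.
have hp := slit_pos sf.
pose N s := Re (f s) * Re (f s) + Im (f s) * Im (f s).
have hN := is_rderD (is_rderM h1 h1) (is_rderM h2 h2); rewrite -/N in hN.
have fn0 : f t != 0 by rewrite -(csqrtK sf) expf_neq0 // csqrt_neq0.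
have N0 : 0 < N t by rewrite /N -!expr2; exact: sum_sqr_gt0.
pose P s := (Num.sqrt (N s) + Re (f s)) * 2^-1.
have hP : exists dP, is_derive t (1 : R) P dP.
  eexists; exact: is_rderM (is_rderD (is_rder_sqrt N0 hN) h1) (is_derive_cst _ _ _).
have PE s : P s = (Normc.normc (f s) + Re (f s)) / 2.
  by rewrite /P normcE2 /N -!expr2.
have P0 : 0 < P t by rewrite PE.
have [dP {}hP] := hP.
have hQ := is_rder_sqrt P0 hP.
have Q0 : 2 * Num.sqrt (P t) != 0 by rewrite mulf_neq0 // gt_eqF // sqrtr_gt0.
have hQV := @is_rderV (fun s => 2 * Num.sqrt (P s)) t _ Q0 (is_rderM (is_derive_cst (2 : R) t _) hQ).
have [e he] : exists e, is_cder (fun s => csqrt (f s)) t e.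
  eexists (_ +i* _); split => /=.
    rewrite (_ : (fun s => _) = fun s => Num.sqrt (P s)); first exact: hQ.
    by apply/funext => s; rewrite /= PE.
  rewrite (_ : (fun s => _) = (fun s => Im (f s) * (2 * Num.sqrt (P s))^-1)).
    exact: is_rderM h2 hQV.
  by apply/funext => s; rewrite /= PE.
apply: (is_cder_eq he).
have nf : \near t, slit (f t).
  apply: filterS (rder_gt0_near P0 hP) => s; rewrite PE normcE2 /slit.
  case: eqVneq => //= ->; rewrite expr0n addr0 sqrtr_sqr.
  case: (ltrP 0 (Re (f s))) => // hle.
  by rewrite ler0_norm // addNr mul0r ltxx.
have h3 : is_cder f t (2%:R * csqrt (f t) ^+ 1 * e).
  apply: is_cder_near (is_cderX 2 he).
  by apply: filterS nf => s fs0; rewrite csqrtK.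
have := is_cder_unique h3 h; rewrite expr1 => <-.
by field; rewrite csqrt_neq0.
Qed.

End ComplexDerivative.

(** * Fundamental theorem of calculus and differentiation under the integral *)

Section Leibniz.
Variable R : realType.
Local Notation C := R[i].
Local Notation Re := complex.Re.
Local Notation Im := complex.Im.
Local Notation mu := (@lebesgue_measure R).

Lemma near_open_itv (P : R -> Prop) t : (\near t, P t) ->
  exists2 e : R, 0 < e & forall s, t - e < s < t + e -> P s.
Proof.
move=> /nbhs_ballP[e /= e0 h]; exists e => // s /andP[h1 h2].
by apply: h; rewrite /ball /= ltr_distlC h1 h2.
Qed.

Lemma is_derive_continuous (f : R -> R) t d : is_derive t (1 : R) f d -> {for t, continuous f}.
Proof.
move=> h; apply: differentiable_continuous; apply/derivable1_diffP; exact: ex_derive.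
Qed.

Lemma derive_within_continuous (f : R -> R) (a b : R) :
  (forall t : R, a <= t <= b -> exists d, is_derive t (1 : R) f d) -> {within `[a, b], continuous f}.
Proof.
move=> h; apply: derivable_within_continuous => t; rewrite in_itv /= => /h[d hd].
exact: ex_derive.
Qed.

Lemma within_continuous_integrable (f : R -> R) (a b : R) : {within `[a, b], continuous f} ->
  mu.-integrable `[a, b] (EFin \o f).
Proof. by move=> h; apply: continuous_compact_integrable => //; exact: segment_compact. Qed.

Lemma Rintegral_FTC2 (F f : R -> R) (a b : R) : a <= b ->
  (forall t : R, a <= t <= b -> is_derive t (1 : R) F (f t)) ->
  {within `[a, b], continuous f} ->
  \int[mu]_(t in `[a, b]) f t = F b - F a.
Proof.
rewrite le_eqVlt => /orP[/eqP <- _ _|ab hF cf].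
  by rewrite set_itv1 Rintegral_set1 subrr.
rewrite /Rintegral (continuous_FTC2 ab cf (F := F)) //.
  split.
  - move=> t; rewrite in_itv /= => /andP[h1 h2].
    have := hF t; rewrite !ltW // => /(_ isT) h; exact: ex_derive.
  - apply: cvg_at_right_filter; apply: is_derive_continuous (hF a _).
    by rewrite lexx ltW.
  - apply: cvg_at_left_filter; apply: is_derive_continuous (hF b _).
    by rewrite lexx ltW.
move=> t; rewrite in_itv /= => /andP[h1 h2].
have := hF t; rewrite !ltW // => /(_ isT) h.
by rewrite derive1E; exact: derive_val.
Qed.

Lemma is_derive_Rintegral (h h' : R -> R -> R) (tau e K : R) : 0 < e ->
  (forall s t : R, tau - e < s < tau + e -> 0 <= t <= 1 ->
     is_derive s (1 : R) (h ^~ t) (h' s t)) ->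
  (forall s t : R, tau - e < s < tau + e -> 0 <= t <= 1 -> `|h' s t| <= K) ->
  (forall s : R, tau - e < s < tau + e -> {within `[0, 1], continuous (h s)}) ->
  is_derive tau (1 : R) (fun s => \int[mu]_(t in `[0, 1]) h s t)
    (\int[mu]_(t in `[0, 1]) h' tau t).
Proof.
move=> e0 hd hb hc.
have Itau : `]tau - e, tau + e[%classic tau.
  by rewrite /= in_itv /= ltrDl gtrBl e0.
have K0 : 0 <= K.
  by apply: le_trans (hb tau 0 _ _); rewrite ?normr_ge0 ?lexx ?ler01 // ltrDl gtrBl e0.
have mI : measurable (`[0, 1] : set (measurableTypeR R)) by exact: measurable_itv.
have d1 (s t : R) : tau - e < s < tau + e -> 0 <= t <= 1 -> partial1of2 h s t = h' s t.
  by move=> hs ht; rewrite partial1of2E; have := hd s t hs ht => ?; exact: derive_val.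
have A1 : forall s, `]tau - e, tau + e[%classic s -> mu.-integrable `[0, 1] (EFin \o h s).
  by move=> s /=; rewrite in_itv /= => hs; apply: within_continuous_integrable; exact: hc.
have A2 : forall s t, `]tau - e, tau + e[%classic s -> `[0, 1]%classic t -> derivable (h ^~ t) s 1.
  by move=> s t /=; rewrite !in_itv /= => hs ht; have := hd s t hs ht => ?; exact: ex_derive.
have A3 : forall y : R, 0 <= (cst K) y by move=> y.
have A4 : mu.-integrable `[0, 1] (EFin \o cst K).
  by apply: within_continuous_integrable; apply: derive_within_continuous => t _; exists 0; exact: is_derive_cst.
have A5 : forall s t, `]tau - e, tau + e[%classic s -> `[0, 1]%classic t ->
   `|partial1of2 h s t| <= cst K t.
  by move=> s t /=; rewrite !in_itv /= => hs ht; rewrite d1 //; exact: hb.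
have H1 := derivable_under_integral mI Itau A1 A2 A3 A4 A5.
have H2 := differentiation_under_integral mI Itau A1 A2 A3 A4 A5.
apply: DeriveDef; first exact: H1.
rewrite -derive1E H2; apply: eq_Rintegral => t.
by rewrite inE /= in_itv /= => ht; rewrite d1 // ltrDl gtrBl e0.
Qed.

Lemma is_cder_continuous_Re (f : R -> C) t d : is_cder f t d ->
  {for t, continuous (fun s => Re (f s))}.
Proof. by move=> [h _]; exact: is_derive_continuous h. Qed.

Lemma is_cder_continuous_Im (f : R -> C) t d : is_cder f t d ->
  {for t, continuous (fun s => Im (f s))}.
Proof. by move=> [_ h]; exact: is_derive_continuous h. Qed.

Lemma norm_Re_le (z K : C) : `|z| <= K -> `|Re z| <= Re K.
Proof.
move=> h; have := le_trans (normc_ge_Re z) h.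
by rewrite lecE => /andP[_].
Qed.

Lemma norm_Im_le (z K : C) : `|z| <= K -> `|Im z| <= Re K.
Proof.
move=> h; have : `|z * 'i| <= K.
  by rewrite normrM (_ : `|'i| = 1 :> C) ?mulr1 // normc_def /= expr0n add0r expr1n sqrtr1.
by move=> /norm_Re_le; rewrite ReiNIm normrN.
Qed.

Lemma cintegral01_FTC2 (F f : R -> C) :
  (forall t : R, 0 <= t <= 1 -> is_cder F t (f t)) ->
  (forall t : R, 0 <= t <= 1 -> exists d, is_cder f t d) ->
  cintegral01 f = F 1 - F 0.
Proof.
move=> hF hf; apply: eq_ReIm; rewrite /cintegral01 /= ?cReD ?cReN ?cImD ?cImN.
  apply: (@Rintegral_FTC2 (fun s => Re (F s))) => //; first by move=> t /hF[].
  by apply: derive_within_continuous => t /hf[d [hd _]]; exists (Re d).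
apply: (@Rintegral_FTC2 (fun s => Im (F s))) => //; first by move=> t /hF[].
by apply: derive_within_continuous => t /hf[d [_ hd]]; exists (Im d).
Qed.

Lemma is_cder_cintegral01 (h h' : R -> R -> C) (tau e : R) (K : C) : 0 < e ->
  (forall s t : R, tau - e < s < tau + e -> 0 <= t <= 1 -> is_cder (h ^~ t) s (h' s t)) ->
  (forall s t : R, tau - e < s < tau + e -> 0 <= t <= 1 -> `|h' s t| <= K) ->
  (forall s t : R, tau - e < s < tau + e -> 0 <= t <= 1 -> exists d, is_cder (h s) t d) ->
  is_cder (fun s => cintegral01 (h s)) tau (cintegral01 (h' tau)).
Proof.
move=> e0 hd hb hc; split => /=.
  apply: (@is_derive_Rintegral (fun s t => Re (h s t)) (fun s t => Re (h' s t)) tau e (Re K)) => //.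
  - by move=> s t hs ht; case: (hd s t hs ht).
  - by move=> s t hs ht; apply: norm_Re_le; exact: hb.
  - move=> s hs; apply: derive_within_continuous => t ht.
    by have [d [h1 _]] := hc s t hs ht; exists (Re d).
apply: (@is_derive_Rintegral (fun s t => Im (h s t)) (fun s t => Im (h' s t)) tau e (Re K)) => //.
- by move=> s t hs ht; case: (hd s t hs ht).
- by move=> s t hs ht; apply: norm_Im_le; exact: hb.
- move=> s hs; apply: derive_within_continuous => t ht.
  by have [d [_ h1]] := hc s t hs ht; exists (Im d).
Qed.

End Leibniz.

(** * Primitives defined as integrals along segments from 0 *)

Section Primitive.
Variable R : realType.
Local Notation C := R[i].
Local Notation Re := complex.Re.
Local Notation Im := complex.Im.

(** From [r^-1 <= 1 + r^-2], which allows a lower bound on a square to be used without extracting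
    its root. *)
Lemma normC_le1D (x : C) (m : R) : 0 < m -> m%:C <= `|x ^+ 2| -> `|x^-1| <= (1 + m^-1)%:C.
Proof.
move=> m0; rewrite normrX normfV normc_def; set r := Num.sqrt _.
have r0 : 0 <= r by exact: sqrtr_ge0.
rewrite -[_%:C ^+ 2]rmorphXn /= -fmorphV /= !lecR => h.
have rp : 0 < r by rewrite lt_def r0 andbT; apply: contraTneq h => ->; rewrite expr0n /= -ltNge.
rewrite -(ler_pM2r (mulr_gt0 m0 (exprn_gt0 2 rp))).
have -> : r^-1 * (m * r ^+ 2) = m * r by field; rewrite gt_eqF.
have -> : (1 + m^-1) * (m * r ^+ 2) = (m + 1) * r ^+ 2 by field; rewrite gt_eqF.
rewrite [r ^+ 2]expr2 mulrA ler_pM2r //; rewrite expr2 in h.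
case: (lerP 1 r) => r1; nra.
Qed.

(** The bound is uniform in the scaling [c]: it dominates the derivative of the integrand of [Phi]
    along the whole segment from 0 to [z], for all [z] near a given point. *)
Lemma slit1D_lower (u : C) : slit (1 + u) -> exists2 m : R, 0 < m &
  exists2 e : R, 0 < e & forall w : C, `|Re w - Re u| < e -> `|Im w - Im u| < e ->
  forall c : R, 0 <= c <= 1 -> m%:C <= `|1 + c%:C * w|.
Proof.
have lowRe (z : C) (m : R) : m <= `|Re z| -> m%:C <= `|z|.
  by move=> h; apply: le_trans (normc_ge_Re z); rewrite lecR.
have lowIm (z : C) (m : R) : m <= `|Im z| -> m%:C <= `|z|.
  move=> h; have -> : `|z| = `|z * 'i|.
    by rewrite normrM (_ : `|'i| = 1 :> C) ?mulr1 // normc_def /= expr0n add0r expr1n sqrtr1.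
  by apply: lowRe; rewrite ReiNIm normrN.
rewrite /slit cReD cImD /= add0r => /orP[hI|hR].
  have nI : 0 < `|Im u| by rewrite normr_gt0.
  pose M := `|Re u| + `|Im u| + 2 * `|Im u|.
  have MI : 0 < M by rewrite /M; have := normr_ge0 (Re u); lra.
  exists ((`|Im u| / 2) / M); first by rewrite !divr_gt0.
  exists (`|Im u| / 2); first by rewrite divr_gt0.
  move=> w h1 h2 c /andP[c0 c1].
  have hw : `|w| <= M%:C.
    rewrite [w]complexE; apply: le_trans (ler_normD _ _) _.
    have -> : `|(Re w)%:C| = `|Re w|%:C by rewrite normc_def /= expr0n addr0 sqrtr_sqr.
    have -> : `|'i * (Im w)%:C| = `|Im w|%:C.
      by rewrite normc_def /= !mul0r !mul1r subr0 add0r expr0n add0r sqrtr_sqr.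
    rewrite -rmorphD /= lecR /M.
    have := ler_normD (Re w - Re u) (Re u); rewrite subrK.
    have := ler_normD (Im w - Im u) (Im u); rewrite subrK.
    by move: h1 h2; lra.
  have hImw : `|Im u| / 2 <= `|Im w|.
    have := ler_normB (Im w) (Im w - Im u); rewrite opprB addrC subrK.
    by move: h2; lra.
  (* [1 + c w] times the conjugate of [w] has imaginary part [- Im w], because [c |w|^2] is real. *)
  have h3 : `|1 + c%:C * w| * `|w| >= (`|Im u| / 2)%:C.
    rewrite -(normcJ w) -normrM; apply: lowIm.
    apply: le_trans hImw _.
    case: w {h1 h2 hw} => a b /=.
    rewrite !mul0r !subr0 !addr0 add0r.
    by rewrite (_ : (1 + c * a) * - b + c * b * a = - b) ?normrN //; ring.
  have Mc : 0 < M%:C :> C by rewrite ltcR.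
  rewrite -(ler_pM2l Mc) -rmorphM /= [M * _]mulrC divfK ?gt_eqF //.
  by rewrite [leRHS]mulrC; apply: le_trans h3 _; rewrite ler_wpM2l.
set b := (1 + Re u) / 2.
have b0 : 0 < b by rewrite divr_gt0.
exists (Num.min 1 b); first by rewrite lt_min ltr01.
exists b => // w h1 h2 c /andP[c0 c1]; apply: lowRe.
have -> : Re (1 + c%:C * w) = 1 + c * Re w by case: w {h1 h2} => a d /=; ring.
have hb : - 1 + b < Re w.
  by move: h1; rewrite ltr_norml => /andP[+ _]; rewrite /b; lra.
apply: le_trans (ler_norm _).
case: (leP 1 b) => b1; nra.
Qed.

(* A primitive of [z ^ a / sqrt (1 + z ^ M)], as an integral along [0, z]. *)
Definition Phi (a M : nat) (z : C) : C :=
  cintegral01 (fun t => z ^+ a.+1 * t%:C ^+ a / csqrt (1 + (t%:C * z) ^+ M)).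

Lemma is_cder_id (t : R) : is_cder (fun s : R => s%:C) t 1.
Proof. by apply: is_cder_real; exact: is_derive_id. Qed.

Lemma slit_scale (u : C) (c : R) : slit (1 + u) -> 0 <= c <= 1 -> slit (1 + c%:C * u).
Proof.
rewrite /slit; case: u => a b /= h /andP[c0 c1].
have := h; rewrite !add0r !mul0r subr0 addr0.
have [->|cn] := eqVneq c 0; first by rewrite !mul0r addr0 ltr01 orbT.
have cp : 0 < c by rewrite lt_def cn.
rewrite mulf_eq0 (negPf cn) /=; case/orP => [->//|h1]; apply/orP; right; nra.
Qed.

Lemma Phi_slit (z : C) M (t : R) : slit (1 + z ^+ M) -> 0 <= t <= 1 ->
  slit (1 + (t%:C * z) ^+ M).
Proof.
move=> h /andP[t0 t1]; rewrite exprMn -rmorphXn /=.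
by apply: slit_scale => //; rewrite exprn_ge0 //= exprn_ile1.
Qed.

Lemma near_bounded (f : R -> C) t d : is_cder f t d -> exists K : C, \near t, `|f t| <= K.
Proof.
move=> h; exists (`|Re (f t)| + 1 + (`|Im (f t)| + 1))%:C.
have c1 := is_cder_continuous_Re h; have c2 := is_cder_continuous_Im h.
have n1 : \forall s \near t, `|Re (f s)| < `|Re (f t)| + 1.
  by apply: (cvgr_lt _ (cvg_norm c1)); rewrite ltrDl.
have n2 : \forall s \near t, `|Im (f s)| < `|Im (f t)| + 1.
  by apply: (cvgr_lt _ (cvg_norm c2)); rewrite ltrDl.
apply: filterS2 n1 n2 => s h1 h2.
rewrite [f s]complexE; apply: le_trans (ler_normD _ _) _.
have -> : `|(Re (f s))%:C| = `|Re (f s)|%:C by rewrite normc_def /= expr0n addr0 sqrtr_sqr.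
have -> : `|'i * (Im (f s))%:C| = `|Im (f s)|%:C.
  by rewrite normc_def /= !mul0r !mul1r subr0 add0r expr0n add0r sqrtr_sqr.
by rewrite -rmorphD /= lecR lerD // ltW.
Qed.

(* With [f w = w ^+ a / csqrt (1 + w ^+ M)], the derivative of [s |-> z s * f (t * z s)]
   is [z' s] times the derivative of [t |-> t * f (t * z s)]; integrating the latter
   over [0, 1] gives [f (z s)]. *)
Lemma is_cder_Phi a M (z z' : R -> C) tau : (0 < M)%N ->
  (\near tau, is_cder z tau (z' tau)) -> (exists K : C, \near tau, `|z' tau| <= K) ->
  slit (1 + z tau ^+ M) ->
  is_cder (fun s => Phi a M (z s)) tau (z' tau * (z tau ^+ a / csqrt (1 + z tau ^+ M))).
Proof.
move=> M0 hz [K1 hK1] sl.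
have hz0 := nbhs_singleton hz.
pose S s (t : R) := csqrt (1 + (t%:C * z s) ^+ M).
pose h s (t : R) := z s ^+ a.+1 * t%:C ^+ a / S s t.
pose g s (t : R) := a.+1%:R * z s ^+ a * t%:C ^+ a / S s t
   - z s ^+ a.+1 * t%:C ^+ a * (M%:R * t%:C ^+ M * z s ^+ M.-1) / (2 * S s t ^+ 3).
pose h' s t := z' s * g s t.
have [m m0 [e0 e0p hm]] := slit1D_lower sl.
have hu := is_cderX M hz0.
have nS : \near tau, slit (1 + z tau ^+ M).
  have hu1 := is_cderD (is_cder_cst 1 tau) hu.
  move: sl; rewrite {1}/slit => /orP[sI|sR].
    have : \near tau, Im (1 + z tau ^+ M) != 0.
      have := is_cder_continuous_Im hu1 => cI.
      have : \near tau, 0 < `|Im (1 + z tau ^+ M)|.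
        by apply: (cvgr_gt _ (cvg_norm cI)); rewrite normr_gt0.
      by apply: filterS => s; rewrite normr_gt0.
    by apply: filterS => s hs; rewrite /slit hs.
  have : \near tau, 0 < Re (1 + z tau ^+ M) by apply: (cvgr_gt _ (is_cder_continuous_Re hu1)).
  by apply: filterS => s hs; rewrite /slit hs orbT.
have n2 : \near tau, forall c : R, 0 <= c <= 1 -> m%:C <= `|1 + c%:C * z tau ^+ M|.
  have /cvgrPdist_lt/(_ _ e0p) c1 := is_cder_continuous_Re hu.
  have /cvgrPdist_lt/(_ _ e0p) c2 := is_cder_continuous_Im hu.
  apply: filterS2 c1 c2 => s h1 h2 c hc.
  by apply: hm => //; rewrite distrC.
have [K2 hK2] := near_bounded hz0.
have [e e_gt0 he] : exists2 e : R, 0 < e & forall s, tau - e < s < tau + e ->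
  [/\ is_cder z s (z' s), `|z' s| <= K1, slit (1 + z s ^+ M),
   (forall c : R, 0 <= c <= 1 -> m%:C <= `|1 + c%:C * z s ^+ M|) & `|z s| <= K2].
  apply: near_open_itv; near=> s; split; near: s => //.
have Sn0 (s t : R) : tau - e < s < tau + e -> 0 <= t <= 1 -> S s t != 0.
  by move=> hs ht; apply/csqrt_neq0/Phi_slit => //; case: (he s hs).
have Ssl (s t : R) : tau - e < s < tau + e -> 0 <= t <= 1 -> slit (1 + (t%:C * z s) ^+ M).
  by move=> hs ht; apply: Phi_slit => //; case: (he s hs).
have taue : tau - e < tau < tau + e by rewrite ltrDl gtrBl e_gt0.
have dSt (s t : R) : tau - e < s < tau + e -> 0 <= t <= 1 ->
   is_cder (S s) t (M%:R * t%:C ^+ M.-1 * z s ^+ M / (2 * S s t)).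
  move=> hs ht.
  have H : is_cder (fun t : R => 1 + (t%:C * z s) ^+ M) t
      (0 + M%:R * (t%:C * z s) ^+ M.-1 * (1 * z s + t%:C * 0)).
    exact: (is_cderD (is_cder_cst 1 t) (is_cderX M (is_cderM (is_cder_id t) (is_cder_cst (z s) t)))).
  apply: (is_cder_eq (is_cder_csqrt H (Ssl s t hs ht))); rewrite -/(S s t).
  rewrite -[in z s ^+ M](prednK M0) exprMn [z s ^+ _.+1]exprS.
  by rewrite add0r mulr0 addr0 mul1r; congr (_ / _); ring.
have ex_g (s t : R) : tau - e < s < tau + e -> 0 <= t <= 1 -> exists d, is_cder (g s) t d.
  move=> hs ht; have s0 := Sn0 s t hs ht; have ds := dSt s t hs ht.
  eexists; apply: is_cderB.
    apply: is_cderM (is_cderV ds s0).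
    exact: is_cderM (is_cder_cst _ _) (is_cderX a (is_cder_id t)).
  apply: is_cderM (is_cderV (is_cderM (is_cder_cst 2 t) (is_cderX 3 ds)) _).
    apply: is_cderM (is_cderM (is_cder_cst _ _) (is_cderX a (is_cder_id t))) _.
    apply: is_cderM (is_cder_cst _ _).
    exact: is_cderM (is_cder_cst _ _) (is_cderX M (is_cder_id t)).
  by rewrite mulf_neq0 ?expf_neq0 // pnatr_eq0.
have dh (s t : R) : tau - e < s < tau + e -> 0 <= t <= 1 -> is_cder (h ^~ t) s (h' s t).
  move=> hs ht; have s0 := Sn0 s t hs ht; have [hzs _ _ _ _] := he s hs.
  have H : is_cder (fun s : R => 1 + (t%:C * z s) ^+ M) s
      (0 + M%:R * (t%:C * z s) ^+ M.-1 * (t%:C * z' s)).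
    exact: (is_cderD (is_cder_cst 1 s) (is_cderX M (is_cderZ _ hzs))).
  have H2 := is_cder_csqrt H (Ssl s t hs ht); rewrite -/(S s t) in H2.
  have H3 := is_cderM (is_cderM (is_cderX a.+1 hzs) (is_cder_cst (t%:C ^+ a) s)) (is_cderV H2 s0).
  apply: (is_cder_eq H3); rewrite -/(S s t) /h' /g /= exprMn.
  rewrite -[in t%:C ^+ M](prednK M0) [t%:C ^+ _.+1]exprS.
  by field.
have dh0 (s t : R) : tau - e < s < tau + e -> 0 <= t <= 1 -> exists d, is_cder (h s) t d.
  move=> hs ht; have s0 := Sn0 s t hs ht.
  eexists; apply: is_cderM (is_cderV (dSt s t hs ht) s0).
  exact: is_cderM (is_cder_cst _ _) (is_cderX a (is_cder_id t)).
have dG (t : R) : 0 <= t <= 1 ->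
    is_cder (fun t : R => z tau ^+ a * t%:C ^+ a.+1 / S tau t) t (g tau t).
  move=> ht; have s0 := Sn0 _ _ taue ht.
  have H := is_cderM (is_cderM (is_cder_cst (z tau ^+ a) t) (is_cderX a.+1 (is_cder_id t)))
     (is_cderV (dSt _ _ taue ht) s0).
  apply: (is_cder_eq H); rewrite /g /=.
  rewrite -[in t%:C ^+ M](prednK M0) -[in z tau ^+ M](prednK M0) !exprS /=.
  by field.
have [K hK] : exists K : C, forall s t : R, tau - e < s < tau + e -> 0 <= t <= 1 -> `|h' s t| <= K.
  pose B : C := (1 + m^-1)%:C.
  have B0 : 0 <= B by rewrite ler0c addr_ge0 // invr_ge0 ltW.
  pose K2' := K2.
  exists (K1 * (a.+1%:R * K2 ^+ a * B + K2 ^+ a.+1 * (M%:R * K2 ^+ M.-1) * (2^-1 * B ^+ 3))).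
  move=> s t hs ht; have [_ h1 h2 h3 h4] := he s hs.
  have K20 : 0 <= K2 by apply: le_trans h4.
  have tn : `|t%:C| <= 1 :> C.
    by case/andP: ht => t0 t1; rewrite ger0_norm ?ler0c // (_ : 1 = 1%:C) // lecR.
  have tX n : `|t%:C ^+ n| <= 1 :> C by rewrite normrX exprn_ile1.
  have zX n : `|z s ^+ n| <= K2 ^+ n by rewrite normrX lerXn2r // nnegrE.
  have SB : `|(S s t)^-1| <= B.
    apply: normC_le1D => //; rewrite csqrtK; last exact: Ssl.
    rewrite exprMn -rmorphXn; apply: h3.
    by case/andP: ht => t0 t1; rewrite exprn_ge0 //= exprn_ile1.
  have SB3 : `|(S s t)^-1 ^+ 3| <= B ^+ 3 by rewrite normrX lerXn2r // nnegrE.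
  rewrite /h' normrM ler_pM //.
  apply: le_trans (ler_normB _ _) _; apply: lerD.
    rewrite normrM ler_pM // -[leRHS]mulr1 normrM ler_pM // normrM ler_pM //.
    by rewrite normr_nat.
  rewrite normrM ler_pM //; last first.
    by rewrite invfM normrM -exprVn ler_pM // ger0_norm ?invr_ge0 ?ler0n.
  rewrite normrM ler_pM //.
    by rewrite -[leRHS]mulr1 normrM ler_pM.
  rewrite normrM ler_pM // -[leRHS]mulr1 normrM ler_pM //.
  by rewrite normr_nat.
have := is_cder_cintegral01 e_gt0 dh hK dh0; rewrite -/(Phi a M (z _)).
move/is_cder_eq; apply.
rewrite (cintegral01_FTC2 (F := fun t : R => z' tau * (z tau ^+ a * t%:C ^+ a.+1 / S tau t))).
- rewrite expr0n /= mulr0 mul0r mulr0 subr0 /S rmorph1 !mul1r expr1n mulr1 //.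
- by move=> t ht; apply: is_cderZ; exact: dG.
- move=> t ht; have [d hd] := ex_g _ _ taue ht.
  by exists (z' tau * d); apply: is_cderZ.
Unshelve. all: by end_near. Qed.

End Primitive.

(** * The complex exponential, and square roots in opposite charts *)

Section Exponential.
Variable R : realType.
Local Notation C := R[i].
Local Notation Re := complex.Re.
Local Notation Im := complex.Im.
Local Notation mu := (@lebesgue_measure R).

Definition cexp (z : C) : C := (expR (Re z))%:C * (cos (Im z) +i* sin (Im z)).

Lemma Re_cexp z : Re (cexp z) = expR (Re z) * cos (Im z).
Proof. by rewrite /cexp cReM /= mul0r subr0. Qed.

Lemma Im_cexp z : Im (cexp z) = expR (Re z) * sin (Im z).
Proof. by rewrite /cexp cImM /= mul0r addr0. Qed.

Lemma cexpD (z w : C) : cexp (z + w) = cexp z * cexp w.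
Proof.
by apply: eq_ReIm; rewrite !(cReM, cImM, Re_cexp, Im_cexp, cReD, cImD) expRD ?cosD ?sinD; ring.
Qed.

Lemma cexp0 : cexp 0 = 1.
Proof. by apply: eq_ReIm; rewrite ?Re_cexp ?Im_cexp /= ?cos0 ?sin0 ?mulr0 ?expR0 ?mulr1. Qed.

Lemma cexpX z n : cexp z ^+ n = cexp (n%:R * z).
Proof.
elim: n => [|n IH]; first by rewrite mul0r cexp0.
by rewrite exprS IH -cexpD -nat1r mulrDl mul1r.
Qed.

Lemma cexpN z : cexp (- z) * cexp z = 1.
Proof. by rewrite -cexpD addNr cexp0. Qed.

Lemma cexp_neq0 z : cexp z != 0.
Proof.
by apply: contra_eq_neq (cexpN z) => ->; rewrite mulr0 eq_sym oner_eq0.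
Qed.

Lemma is_cder_cexp (l : C) t : is_cder (fun s : R => cexp (l * s%:C)) t (l * cexp (l * t%:C)).
Proof.
have hR (s : R) : Re (l * s%:C) = Re l * s by rewrite cReM /= mulr0 subr0.
have hI (s : R) : Im (l * s%:C) = Im l * s by rewrite cImM /= mulr0 add0r.
have hlin (a : R) : is_derive t (1 : R) (fun s : R => a * s) a.
  apply: (is_derive_eq (is_rderM (is_derive_cst a t 1) (is_derive_id t 1))).
  by rewrite mul0r add0r mulr1.
have hE : is_derive t (1 : R) (fun s => expR (Re l * s)) (expR (Re l * t) * Re l).
  exact: (is_derive1_comp (f := expR) (g := fun s => Re l * s)).
have hC : is_derive t (1 : R) (fun s => cos (Im l * s)) (- sin (Im l * t) * Im l).
  exact: (is_derive1_comp (f := cos) (g := fun s => Im l * s)).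
have hS : is_derive t (1 : R) (fun s => sin (Im l * s)) (cos (Im l * t) * Im l).
  exact: (is_derive1_comp (f := sin) (g := fun s => Im l * s)).
split.
  rewrite (_ : (fun s => _) = fun s => expR (Re l * s) * cos (Im l * s)).
    apply: (is_derive_eq (is_rderM hE hC)).
    by rewrite cReM Re_cexp Im_cexp hR hI; ring.
  by apply/funext => s; rewrite Re_cexp hR hI.
rewrite (_ : (fun s => _) = fun s => expR (Re l * s) * sin (Im l * s)).
  apply: (is_derive_eq (is_rderM hE hS)).
  by rewrite cImM Re_cexp Im_cexp hR hI; ring.
by apply/funext => s; rewrite Im_cexp hR hI.
Qed.

Lemma cexp_2pi : cexp (0 +i* (pi *+ 2)) = 1.
Proof. by apply: eq_ReIm; rewrite ?Re_cexp ?Im_cexp /= ?cos2pi ?sin2pi ?mulr0 ?expR0 ?mulr1. Qed.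

Lemma slit_cexp (z : C) : `|Im z| < pi -> slit (cexp z).
Proof.
move=> h; rewrite /slit Re_cexp Im_cexp mulf_eq0 gt_eqF ?expR_gt0 //=.
have [->|] := eqVneq (Im z) 0; first by rewrite cos0 mulr1 expR_gt0 orbT.
have h2 (x : R) : 0 < x < pi -> sin x != 0 by move=> /sin_gt0_pi /lt0r_neq0.
move=> n0; have [hp|hn] := lerP 0 (Im z).
  by rewrite h2 // lt_def n0 hp -[Im z]ger0_norm.
rewrite -[Im z]opprK sinN oppr_eq0 h2 //.
by rewrite oppr_gt0 hn -[- _]ger0_norm ?oppr_ge0 ?ltW // normrN.
Qed.

(** The argument is taken nonnegative rather than centred at 0, so that the index of the sector in
    [sector_decomp] is the truncation of a nonnegative number. *)
Lemma cexp_surj (z : C) : z != 0 -> exists2 l, z = cexp l & 0 <= Im l.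
Proof.
move=> z0; have n0 := sum_sqr_gt0 z0.
set r := Num.sqrt (Re z ^+ 2 + Im z ^+ 2).
have r0 : 0 < r by rewrite sqrtr_gt0.
have r2 : r ^+ 2 = Re z ^+ 2 + Im z ^+ 2 by rewrite sqr_sqrtr // ltW.
have cb : -1 <= Re z / r <= 1.
  rewrite -ler_norml normrM normfV [`|r|]gtr0_norm // ler_pdivrMr // mul1r.
  by rewrite -sqrtr_sqr ler_wsqrtr // lerDl sqr_ge0.
set t := acos (Re z / r).
have ct : cos t = Re z / r by rewrite acosK.
have st : sin t = `|Im z| / r.
  rewrite sin_acos // -[`|Im z|]sqrtr_sqr.
  have -> : 1 - (Re z / r) ^+ 2 = Im z ^+ 2 / r ^+ 2.
    have rn : r ^+ 2 != 0 by rewrite expf_neq0 // gt_eqF.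
    by rewrite expr_div_n -[X in X - _](divff rn) -mulrBl {1}r2 addrAC subrr add0r.
  by rewrite sqrtrM ?sqr_ge0 // sqrtrV ?sqr_ge0 // !sqrtr_sqr [`|r|]gtr0_norm.
have t0 : 0 <= t by exact: acos_ge0.
have [hI|hI] := lerP 0 (Im z).
  exists (ln r +i* t) => //; apply: eq_ReIm; rewrite ?Re_cexp ?Im_cexp /= lnK ?posrE //.
    by rewrite ct mulrC divfK ?gt_eqF.
  by rewrite st ger0_norm // mulrC divfK ?gt_eqF.
exists (ln r +i* (- t + pi *+ 2)).
  apply: eq_ReIm; rewrite ?Re_cexp ?Im_cexp /= lnK ?posrE //.
    by rewrite cosD2pi cosN ct mulrC divfK ?gt_eqF.
  by rewrite sinD2pi sinN st ltr0_norm // mulNr opprK mulrC divfK ?gt_eqF.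
by rewrite /= mulr2n; have := acos_lepi cb; rewrite -/t; have := pi_ge0 R; lra.
Qed.

Definition croot (m : nat) : C := cexp (0 +i* ((pi *+ 2) / m%:R)).

Lemma crootX m n : croot m ^+ n = cexp (0 +i* ((pi *+ 2) / m%:R *+ n)).
Proof.
rewrite /croot cexpX; congr cexp; apply: eq_ReIm => /=.
  by rewrite -(rmorph_nat (real_complex R)) /= !mul0r mulr0 subr0.
by rewrite -(rmorph_nat (real_complex R)) /= mul0r addr0 mulr_natl.
Qed.

Lemma croot_unity m : (0 < m)%N -> croot m ^+ m = 1.
Proof.
move=> m0; rewrite crootX -mulr_natr divfK ?cexp_2pi // pnatr_eq0.
by rewrite -lt0n.
Qed.

Lemma slit_sqr (w : C) : 0 < Re w -> slit (w ^+ 2).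
Proof.
case: w => a b /= a0; rewrite /slit expr2 /=.
have [->|b0] := eqVneq b 0; first by rewrite !mulr0 subr0 mulr_gt0 ?orbT.
by rewrite [b * a]mulrC -mulr2n mulrn_eq0 /= mulf_neq0 // gt_eqF.
Qed.

Lemma slit1D (u : C) : slit u -> slit (1 + u).
Proof.
rewrite /slit cReD cImD /= add0r => /orP[->//|h].
by rewrite addr_gt0 ?orbT.
Qed.

(** The square of the quotient is clear; the point is that its real part is positive. The numbers
    [1 + u] and [u] have the same imaginary part, so their two roots lie in the same quadrant. *)
Lemma csqrt_inv (u : C) : slit u -> csqrt (1 + u) / csqrt u = csqrt (1 + u^-1).
Proof.
move=> hu; have hu1 := slit1D hu.
have e1 := csqrtK hu; have e2 := csqrtK hu1.
have p1 := Re_csqrt_gt0 hu; have p2 := Re_csqrt_gt0 hu1.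
have n1 := csqrt_neq0 hu.
set r := csqrt u in e1 p1 n1 *; set s := csqrt _ in e2 p2 *.
have hsq : (s / r) ^+ 2 = 1 + u^-1.
  by rewrite expr_div_n e1 e2 mulrDl mul1r addrC divff // -e1 expf_neq0.
have hp : 0 < Re (s / r).
  have hI : Re s * Im s = Re r * Im r.
    have : Im (s ^+ 2) = Im (r ^+ 2) by rewrite e1 e2 cImD /= add0r.
    by rewrite !expr2 !cImM; lra.
  rewrite cReM cReV cImV.
  have nn := sum_sqr_gt0 n1.
  have -> : Re s * (Re r / (Re r ^+ 2 + Im r ^+ 2)) - Im s * - (Im r / (Re r ^+ 2 + Im r ^+ 2))
     = (Re s * Re r + Im s * Im r) / (Re r ^+ 2 + Im r ^+ 2) by ring.
  rewrite divr_gt0 // -(pmulr_rgt0 _ p2).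
  have -> : Re s * (Re s * Re r + Im s * Im r) = Re s ^+ 2 * Re r + (Re s * Im s) * Im r by ring.
  rewrite hI.
  have -> : Re s ^+ 2 * Re r + Re r * Im r * Im r = Re r * (Re s ^+ 2 + Im r ^+ 2) by ring.
  by rewrite mulr_gt0 // ltr_pwDl ?sqr_ge0 // exprn_gt0.
by apply: csqrt_unique => //; rewrite -hsq; exact: slit_sqr.
Qed.

Lemma cintegral01Z (c : C) (f : R -> C) : (forall t : R, 0 <= t <= 1 -> exists d, is_cder f t d) ->
  cintegral01 (fun t => c * f t) = c * cintegral01 f.
Proof.
move=> hf.
have mI : measurable (`[0, 1] : set (measurableTypeR R)) by exact: measurable_itv.
have iR : mu.-integrable `[0, 1] (EFin \o fun t => Re (f t)).
  apply: within_continuous_integrable; apply: derive_within_continuous => t /hf[d [hd _]].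
  by exists (Re d).
have iI : mu.-integrable `[0, 1] (EFin \o fun t => Im (f t)).
  apply: within_continuous_integrable; apply: derive_within_continuous => t /hf[d [_ hd]].
  by exists (Im d).
have iZ (k : R) g : mu.-integrable `[0, 1] (EFin \o g) ->
   mu.-integrable `[0, 1] (EFin \o fun t => k * g t).
  move=> ig; rewrite (_ : EFin \o _ = fun t => (k%:E * (EFin \o g) t)%E).
    exact: integrableZl.
  by apply/funext => t; rewrite /= EFinM.
apply: eq_ReIm; rewrite /cintegral01 ?cReM ?cImM /=.
  under eq_Rintegral do rewrite cReM.
  by rewrite RintegralB ?RintegralZl //; exact: iZ.
under eq_Rintegral do rewrite cImM.
by rewrite RintegralD ?RintegralZl //; exact: iZ.
Qed.

Lemma PhiZ a M (w z : C) : (0 < M)%N -> w ^+ M = 1 -> slit (1 + z ^+ M) ->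
  Phi a M (w * z) = w ^+ a.+1 * Phi a M z.
Proof.
move=> M0 wM sl; rewrite /Phi -cintegral01Z.
  congr cintegral01; apply/funext => t.
  by rewrite mulrCA exprMn [(w * (_ * _)) ^+ M]exprMn wM mul1r !mulrA.
move=> t ht; eexists; apply: is_cderM.
  exact: is_cderM (is_cder_cst _ _) (is_cderX a (is_cder_id t)).
have H := is_cderD (is_cder_cst 1 t) (is_cderX M (is_cderM (is_cder_id t) (is_cder_cst z t))).
have s1 := Phi_slit sl ht.
by apply: is_cderV (is_cder_csqrt H s1) _; exact: csqrt_neq0.
Qed.

End Exponential.

(** * Periods of [y ^ 2 = x ^ m + 1] *)

Section Overlap.
Variable R : realType.
Local Notation C := R[i].
Local Notation Re := complex.Re.
Local Notation Im := complex.Im.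

Lemma is_cder0_constant (f : R -> C) :
  (forall t : R, 0 <= t <= 1 -> is_cder f t 0) -> f 1 = f 0.
Proof.
move=> h; apply/eqP; rewrite -subr_eq0; apply/eqP.
rewrite -(cintegral01_FTC2 (f := fun=> 0) h).
  by apply: eq_ReIm; rewrite /cintegral01 /= Rintegral_cst //= mul0r.
by move=> t _; exists 0; exact: is_cder_cst.
Qed.

Variable g : nat.
Local Notation m := g.*2.+1.

(* [x ^ i dx / y] equals [- 2 v ^ (m - 2 i - 3) dv / sqrt (1 + v ^ (2 m))] for
   [x = v ^ -2]. *)
Definition period_coef (i : nat) : C := Phi i m 1 + 2 * Phi (m - i.*2 - 3) m.*2 1.

Lemma cexp_scale (l : C) (t : R) n : cexp (l * t%:C) ^+ n = cexp (n%:R * l * t%:C).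
Proof. by rewrite cexpX mulrA. Qed.

Lemma slit_cexp_scale (l : C) n (t : R) : `|n%:R * Im l| < pi -> 0 <= t <= 1 ->
  slit (cexp (n%:R * l * t%:C)).
Proof.
move=> h /andP[t0 t1]; apply: slit_cexp.
have -> : Im (n%:R * l * t%:C) = n%:R * Im l * t.
  by case: l h => a b _; rewrite -(rmorph_nat (real_complex R)) /=; ring.
rewrite normrM [`|t|]ger0_norm //; apply: le_lt_trans h.
by rewrite ler_piMr.
Qed.

Lemma is_cder_Phi_cexp a M (l : C) (t : R) : (0 < M)%N -> `|M%:R * Im l| < pi -> 0 <= t <= 1 ->
  is_cder (fun s : R => Phi a M (cexp (l * s%:C))) t
    (l * cexp (l * t%:C) ^+ a.+1 / csqrt (1 + cexp (l * t%:C) ^+ M)).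
Proof.
move=> M0 hl ht.
have hz : forall s, is_cder (fun s : R => cexp (l * s%:C)) s (l * cexp (l * s%:C)).
  by move=> s; exact: is_cder_cexp.
have sl : slit (1 + cexp (l * t%:C) ^+ M).
  by rewrite cexp_scale; apply: slit1D; exact: slit_cexp_scale.
have [K hK] := near_bounded (is_cderZ l (hz t)).
have H := @is_cder_Phi R a M (fun s => cexp (l * s%:C)) (fun s => l * cexp (l * s%:C)) t M0.
apply: (is_cder_eq (H _ _ sl)).
- by near=> s; exact: hz.
- by exists K.
- by rewrite exprS !mulrA.
Unshelve. all: by end_near. Qed.

(** [period_coef] is the integral of [x^i dx / y] from 0 to infinity, split at [x = 1]. Moving the
    splitting point along [exp (l t)] does not change the sum: the two derivatives cancel as long as
    [x ^+ m] stays off the cut. *)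
Lemma overlap_sector (i : nat) (l : C) : (i < g)%N -> `|m%:R * Im l| < pi ->
  Phi i m (cexp l) + 2 * Phi (m - i.*2 - 3) m.*2 (cexp (- l / 2)) = period_coef i.
Proof.
move=> ig hl.
pose F (s : R) := Phi i m (cexp (l * s%:C)) + 2 * Phi (m - i.*2 - 3) m.*2 (cexp (- l / 2 * s%:C)).
have c0 : (0 : R)%:C = 0 :> C by [].
have c1 : (1 : R)%:C = 1 :> C by [].
suff : F 1 = F 0 by rewrite /F /period_coef c0 c1 !mulr1 !mulr0 !cexp0.
apply: is_cder0_constant => t ht.
have hl2 : `|m.*2%:R * Im (- l / 2)| < pi.
  have -> : m.*2%:R * Im (- l / 2) = - (m%:R * Im l).
    have -> : (2 : C) = (2 : R)%:C by rewrite rmorph_nat.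
    case: l {hl F} => a b; rewrite -fmorphV /= -mul2n natrM; by field.
  by rewrite normrN.
have m20 : (0 < m.*2)%N by rewrite double_gt0.
have d1 := is_cder_Phi_cexp i (ltn0Sn _) hl ht.
have d2 := is_cder_Phi_cexp (m - i.*2 - 3) m20 hl2 ht.
apply: (is_cder_eq (is_cderD d1 (is_cderZ 2 d2))).
set x := cexp (l * t%:C); set v := cexp (- l / 2 * t%:C).
have xv : v ^+ 2 * x = 1.
  rewrite /v /x cexpX -cexpD (_ : _ + _ = 0) ?cexp0 //; by field.
have v0 : v != 0 by exact: cexp_neq0.
have x0 : x != 0 by exact: cexp_neq0.
have su : slit (x ^+ m) by rewrite /x cexp_scale; exact: slit_cexp_scale.
(* The argument of [v ^- m] is half of [m * Im l * t], hence less than [pi / 2] in absolute value,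
   which singles out the principal root. *)
have hr : v ^- m = csqrt (x ^+ m).
  have e1 : (v ^- m) ^+ 2 = x ^+ m.
    rewrite -exprVn -exprM mulnC exprM exprVn.
    by congr (_ ^+ m); rewrite -[LHS]mulr1 -xv mulKf // expf_neq0.
  apply: csqrt_unique => //.
  have -> : v ^- m = cexp (m%:R * (l / 2) * t%:C).
    apply: (mulfI (expf_neq0 m v0)); rewrite divff ?expf_neq0 //.
    by rewrite /v cexpX -cexpD (_ : _ + _ = 0) ?cexp0 //; field.
  rewrite Re_cexp mulr_gt0 ?expR_gt0 //.
  have -> : Im (m%:R * (l / 2) * t%:C) = m%:R * Im l * t / 2.
    have -> : (2 : C) = (2 : R)%:C by rewrite rmorph_nat.
    case: l {hl F hl2 d1 d2 x v xv v0 x0 su e1} => a b.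
    by rewrite -(rmorph_nat (real_complex R)) -fmorphV /=; field.
  apply: cos_gt0_pihalf; rewrite -ltr_norml normrM [`|_^-1|]ger0_norm ?invr_ge0 //.
  rewrite ltr_pM2r ?invr_gt0 // normrM; case/andP: ht => t0 t1.
  by rewrite [`|t|]ger0_norm //; apply: le_lt_trans hl; rewrite ler_piMr.
have hinv := csqrt_inv su.
have E2 : (x ^+ m)^-1 = v ^+ m.*2.
  by apply: (mulIf (expf_neq0 m x0)); rewrite mulVf ?expf_neq0 // -mul2n exprM -exprMn xv expr1n.
rewrite -hr E2 invrK in hinv; rewrite -hinv.
have s0 : csqrt (1 + x ^+ m) != 0 by apply: csqrt_neq0; exact: slit1D.
have ev : x ^+ i.+1 = v ^+ (m - i.*2 - 3).+1 / v ^+ m.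
  have k1 : (m = (m - i.*2 - 3).+1 + i.+1.*2)%N by clear -ig; lia.
  rewrite {2}k1 exprD invfM mulrA divff ?expf_neq0 // mul1r.
  apply: (mulIf (expf_neq0 i.+1.*2 v0)); rewrite mulVf ?expf_neq0 //.
  by rewrite -mul2n exprM -exprMn mulrC xv expr1n.
rewrite ev; move: (v ^+ (m - i.*2 - 3).+1) (csqrt _) s0 (v ^+ m) (expf_neq0 m v0) => A S S0 B B0.
by field; rewrite S0 B0.
Qed.

(** A negative real [x ^+ m] would be greater than -1 by the first condition, and so would its
    inverse by the second. *)
Lemma slit_both (x : C) (v : C) : v ^+ 2 * x = 1 -> slit (1 + x ^+ m) ->
  slit (1 + v ^+ m.*2) -> slit (x ^+ m).
Proof.
move=> xv h1 h2.
have x0 : x != 0 by apply: contra_eq_neq xv => ->; rewrite mulr0 eq_sym oner_eq0.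
have E2 : v ^+ m.*2 = (x ^+ m)^-1.
  by apply: (mulIf (expf_neq0 m x0)); rewrite mulVf ?expf_neq0 // -mul2n exprM -exprMn xv expr1n.
move: h1 h2; rewrite E2 /slit !cReD !cImD !add0r => h1 h2.
have [hI|//] := eqVneq (Im (x ^+ m)) 0.
rewrite hI eqxx /= in h1 *.
have n0 : x ^+ m != 0 by rewrite expf_neq0.
have := sum_sqr_gt0 n0.
rewrite cImV cReV hI !mul0r oppr0 eqxx /= expr0n addr0 in h2 *; move=> hp.
have r0 : Re (x ^+ m) != 0 by move: hp; apply: contraTneq => ->; rewrite expr0n ltxx.
have : Re (x ^+ m) / Re (x ^+ m) ^+ 2 = (Re (x ^+ m))^-1 by field.
move: h2 => /[swap] -> h2; rewrite ltNge; apply/negP => hle.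
have hn : Re (x ^+ m) < 0 by rewrite lt_def eq_sym r0.
have : (Re (x ^+ m))^-1 * Re (x ^+ m) = 1 by rewrite mulVf.
by move: h1 h2 hn => /=; nra.
Qed.

(** The rays where [x ^+ m] is negative cut the plane into [m] open sectors, permuted by the
    rotations of order [m]; [k] numbers the sector. *)
Lemma sector_decomp (x : C) : slit (x ^+ m) ->
  exists k l, x = croot R m ^+ k * cexp l /\ `|m%:R * Im l| < pi.
Proof.
move=> sl.
have x0 : x != 0.
  apply: contraTneq sl => ->; rewrite expr0n /= /slit /= eqxx ltxx //.
have [l xl l0] := cexp_surj x0.
have pi0 : 0 < pi :> R by exact: pi_gt0.
have p2 : 0 < pi *+ 2 :> R by rewrite mulrn_wgt0.
have m0 : 0 < m%:R :> R by rewrite ltr0n.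
set q := (m%:R * Im l + pi) / (pi *+ 2).
have q0 : 0 <= q by rewrite divr_ge0 ?(ltW p2) // addr_ge0 ?(ltW pi0) // mulr_ge0 // ler0n.
have := truncn_itv q0; set k := Num.truncn q => /andP[k1 k2].
exists k, (l - (0 +i* ((pi *+ 2) / m%:R *+ k))).
have hx : x = croot R m ^+ k * cexp (l - (0 +i* (pi *+ 2 / m%:R *+ k))).
  by rewrite crootX -cexpD addrC subrK.
split => //.
set d := Im _.
have dE : m%:R * d = m%:R * Im l - (pi *+ 2) * k%:R.
  by rewrite /d cImD cImN /= -mulr_natr; field; rewrite gt_eqF.
have hd1 : - pi <= m%:R * d.
  rewrite dE; move: k1; rewrite /q ler_pdivlMr // => k1.
  by rewrite lerBrDr addrC lerBlDr mulrC.
have hd2 : m%:R * d < pi.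
  rewrite dE; move: k2; rewrite /q ltr_pdivrMr // -natr1 mulrDl mul1r => k2.
  by move: k2; rewrite mulr2n; nra.
rewrite ltr_norml hd2 andbT lt_def hd1 andbT.
(* The value [- pi] belongs to the boundary ray, where [x ^+ m] is negative. *)
apply: contraTneq sl => e.
rewrite hx exprMn -exprM mulnC exprM croot_unity // expr1n mul1r cexpX /slit Re_cexp Im_cexp.
have -> : forall z : C, Im (m%:R * z) = m%:R * Im z.
  by move=> z; rewrite -(rmorph_nat (real_complex R)) /= ; case: z => a b /=; ring.
rewrite -/d e sinN cosN sinpi cospi oppr0 mulr0 eqxx /= mulrN1 oppr_gt0 -leNgt.
exact: ltW (expR_gt0 _).
Qed.

(** A rotation brings [x] into the sector around the positive reals, where [overlap_sector] applies.
    The signs [s] and [t] compare [y] with the principal roots in the two charts, and [v] is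
    determined by [x] up to a sign [e]. *)
Lemma overlap (x y v s t : C) : v ^+ 2 * x = 1 -> slit (1 + x ^+ m) -> slit (1 + v ^+ m.*2) ->
  y = s * csqrt (1 + x ^+ m) -> y * v ^+ m = t * csqrt (1 + v ^+ m.*2) ->
  s ^+ 2 = 1 -> t ^+ 2 = 1 ->
  exists k, forall i, (i < g)%N ->
   s * Phi i m x + 2 * t * Phi (m - i.*2 - 3) m.*2 v = s * croot R m ^+ (k * i.+1) * period_coef i.
Proof.
move=> xv h1 h2 hy1 hy2 s1 t1.
have su := slit_both xv h1 h2.
have [k [l [xl hl]]] := sector_decomp su.
set z := croot R m in xl *.
have zm : z ^+ m = 1 by exact: croot_unity.
have z0 : z != 0 by exact: cexp_neq0.
pose w := cexp (- l / 2); pose x' := cexp l.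
have xw : w ^+ 2 * x' = 1.
  rewrite /w /x' cexpX -cexpD (_ : _ + _ = 0) ?cexp0 //; by field.
(* As [m = 2 g + 1], this is a square root of [z ^- k] that is itself an m-th root of unity. *)
pose eta := z ^+ (k * g).
have eta2 : eta ^+ 2 * z ^+ k = 1.
  by rewrite /eta -exprM -exprD -mulnA muln2 -mulnSr mulnC exprM zm expr1n.
have etam : eta ^+ m = 1 by rewrite /eta -exprM mulnC exprM zm expr1n.
have x0 : x' != 0 by exact: cexp_neq0.
have w0 : w != 0 by exact: cexp_neq0.
have eta0 : eta != 0 by rewrite expf_neq0.
have [e e2 ve] : exists2 e : C, e ^+ 2 = 1 & v = e * (eta * w).
  exists (v / (eta * w)); last by rewrite divfK // mulf_neq0.
  have : v ^+ 2 = (eta * w) ^+ 2.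
    apply: (mulIf x0); apply: (mulIf (expf_neq0 k z0)).
    rewrite -mulrA [x' * _]mulrC -xl xv exprMn -mulrA [x' * _]mulrC mulrACA eta2 mul1r.
    by rewrite xw.
  by rewrite expr_div_n => ->; rewrite divff // expf_neq0 // mulf_neq0.
have xm : x ^+ m = x' ^+ m by rewrite xl exprMn -exprM mulnC exprM zm expr1n mul1r.
have eodd n : e ^+ n.*2.+1 = e by rewrite exprS -mul2n exprM e2 expr1n mulr1.
have vm : v ^+ m = e * w ^+ m by rewrite ve !exprMn etam mul1r eodd.
have su' : slit (x' ^+ m) by rewrite -xm.
have hS : csqrt (1 + x' ^+ m) * w ^+ m = csqrt (1 + w ^+ m.*2).
  have hinv := csqrt_inv su'.
  have hr : w ^- m = csqrt (x' ^+ m).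
    have e1 : (w ^- m) ^+ 2 = x' ^+ m.
      rewrite -exprVn -exprM mulnC exprM exprVn.
      by congr (_ ^+ m); rewrite -[LHS]mulr1 -xw mulKf // expf_neq0.
    apply: csqrt_unique => //.
    have -> : w ^- m = cexp (m%:R * (l / 2)).
      apply: (mulfI (expf_neq0 m w0)); rewrite divff ?expf_neq0 //.
    by rewrite /w cexpX -cexpD (_ : _ + _ = 0) ?cexp0 //; field.
    rewrite Re_cexp mulr_gt0 ?expR_gt0 //.
    have -> : Im (m%:R * (l / 2)) = m%:R * Im l / 2.
      have -> : (2 : C) = (2 : R)%:C by rewrite rmorph_nat.
      case: (l) => a b.
      by rewrite -(rmorph_nat (real_complex R)) -fmorphV /=; field.
    apply: cos_gt0_pihalf; rewrite -ltr_norml normrM [`|_^-1|]ger0_norm ?invr_ge0 //.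
    by rewrite ltr_pM2r ?invr_gt0.
  have E2 : (x' ^+ m)^-1 = w ^+ m.*2.
    by apply: (mulIf (expf_neq0 m x0)); rewrite mulVf ?expf_neq0 // -mul2n exprM -exprMn xw expr1n.
  by rewrite -hr E2 invrK in hinv.
have wm2 : v ^+ m.*2 = w ^+ m.*2.
  by rewrite -muln2 !exprM vm exprMn e2 mul1r.
have te : t = s * e.
  move: hy2; rewrite hy1 vm xm wm2 -hS => /esym.
  have nn : csqrt (1 + x' ^+ m) * w ^+ m != 0.
    by rewrite mulf_neq0 ?expf_neq0 // csqrt_neq0 //; exact: slit1D.
  by move=> h; apply: (mulIf nn); rewrite h; ring.
exists k => i ig.
have sx' : slit (1 + x' ^+ m) by rewrite -xm.
have sw : slit (1 + w ^+ m.*2) by rewrite -wm2.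
have m20 : (0 < m.*2)%N by rewrite double_gt0.
have zkm : (z ^+ k) ^+ m = 1 by rewrite -exprM mulnC exprM zm expr1n.
rewrite xl (PhiZ i (ltn0Sn _) zkm sx') ve [e * (eta * w)]mulrA (PhiZ _ m20 _ sw); last first.
  by rewrite -mul2n exprM [(_ * _) ^+ 2]exprMn e2 mul1r -exprM mulnC exprM etam expr1n.
rewrite te [(e * eta) ^+ _]exprMn.
(* The exponent is odd, so the sign [e] of [v] comes out once and cancels the one in [t = s * e]. *)
have ei : ((m - i.*2 - 3).+1 = (g - i.+1).*2.+1)%N by clear -ig; lia.
rewrite ei eodd.
have -> : eta ^+ (g - i.+1).*2.+1 = z ^+ (k * i.+1).
  have h3 : eta ^+ (g - i.+1).*2.+1 * eta ^+ i.+1.*2 = 1.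
    by rewrite -exprD (_ : (_ + _)%N = m) //; clear -ig; lia.
  apply: (mulIf (expf_neq0 i.+1.*2 eta0)); rewrite h3.
  by rewrite [z ^+ _]exprM -mul2n [eta ^+ _]exprM -exprMn mulrC eta2 expr1n.
rewrite -(overlap_sector ig hl) -/x' -/w exprM.
have -> : 2 * (s * e) * (e * z ^+ k ^+ i.+1 * Phi (m - i.*2 - 3) m.*2 w)
  = e ^+ 2 * (2 * s * z ^+ k ^+ i.+1 * Phi (m - i.*2 - 3) m.*2 w) by ring.
by rewrite e2; ring.
Qed.

End Overlap.

(** * Continuity, integrals over subintervals and continuous induction *)

Section Continuity.
Variable R : realType.
Local Notation C := R[i].
Local Notation Re := complex.Re.
Local Notation Im := complex.Im.
Local Notation mu := (@lebesgue_measure R).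

Definition ccont (f : R -> C) (t : R) :=
  {for t, continuous (fun s => Re (f s))} /\ {for t, continuous (fun s => Im (f s))}.

Lemma is_cder_ccont f t d : is_cder f t d -> ccont f t.
Proof. by move=> h; split; [exact: is_cder_continuous_Re h|exact: is_cder_continuous_Im h]. Qed.

Lemma ccontM f g t : ccont f t -> ccont g t -> ccont (fun s => f s * g s) t.
Proof.
move=> [f1 f2] [g1 g2]; split.
  rewrite (_ : (fun s => _) = (fun s => Re (f s) * Re (g s) - Im (f s) * Im (g s))).
    by apply: continuousB; apply: continuousM.
  by apply/funext => s; rewrite cReM.
rewrite (_ : (fun s => _) = (fun s => Re (f s) * Im (g s) + Im (f s) * Re (g s))).
  by apply: continuousD; apply: continuousM.
by apply/funext => s; rewrite cImM.
Qed.

Lemma ccont_bounded (f : R -> C) t : ccont f t -> exists K : C, \near t, `|f t| <= K.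
Proof.
move=> [c1 c2]; exists (`|Re (f t)| + 1 + (`|Im (f t)| + 1))%:C.
have n1 : \forall s \near t, `|Re (f s)| < `|Re (f t)| + 1.
  by apply: (cvgr_lt _ (cvg_norm c1)); rewrite ltrDl.
have n2 : \forall s \near t, `|Im (f s)| < `|Im (f t)| + 1.
  by apply: (cvgr_lt _ (cvg_norm c2)); rewrite ltrDl.
apply: filterS2 n1 n2 => s h1 h2.
rewrite [f s]complexE; apply: le_trans (ler_normD _ _) _.
have -> : `|(Re (f s))%:C| = `|Re (f s)|%:C by rewrite normc_def /= expr0n addr0 sqrtr_sqr.
have -> : `|'i * (Im (f s))%:C| = `|Im (f s)|%:C.
  by rewrite normc_def /= !mul0r !mul1r subr0 add0r expr0n add0r sqrtr_sqr.
by rewrite -rmorphD /= lecR lerD // ltW.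
Qed.

Lemma ccont_slit (f : R -> C) t : ccont f t -> slit (f t) -> \near t, slit (f t).
Proof.
move=> [cR cI] /orP[sI|sR].
  have : \near t, 0 < `|Im (f t)|.
    by apply: (cvgr_gt _ (cvg_norm cI)); rewrite normr_gt0.
  by apply: filterS => s; rewrite normr_gt0 /slit => ->.
have : \near t, 0 < Re (f t) by apply: (cvgr_gt _ cR).
by apply: filterS => s hs; rewrite /slit hs orbT.
Qed.

Lemma ccontV (f : R -> C) t : ccont f t -> f t != 0 -> ccont (fun s => (f s)^-1) t.
Proof.
move=> [f1 f2] f0; have n0 := lt0r_neq0 (sum_sqr_gt0 f0).
have cN : {for t, continuous (fun s => (Re (f s) * Re (f s) + Im (f s) * Im (f s))^-1)}.
  apply: (@continuousV R R (fun s => Re (f s) * Re (f s) + Im (f s) * Im (f s))).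
    by rewrite -!expr2.
  by apply: continuousD; apply: continuousM.
split.
  rewrite (_ : (fun s => _) = (fun s => Re (f s) * (Re (f s) * Re (f s) + Im (f s) * Im (f s))^-1)).
    exact: continuousM.
  by apply/funext => s; rewrite cReV !expr2.
rewrite (_ : (fun s => _) = (fun s => - (Im (f s) * (Re (f s) * Re (f s) + Im (f s) * Im (f s))^-1))).
  by apply: continuousN; apply: continuousM.
by apply/funext => s; rewrite cImV !expr2.
Qed.

Definition cintegral (a b : R) (f : R -> C) : C :=
  (\int[mu]_(t in `[a, b]) Re (f t)) +i* (\int[mu]_(t in `[a, b]) Im (f t)).

Lemma cintegral_FTC2 (F f : R -> C) (a b : R) : a <= b ->
  (forall t : R, a <= t <= b -> is_cder F t (f t)) ->
  (forall t : R, a <= t <= b -> ccont f t) ->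
  cintegral a b f = F b - F a.
Proof.
move=> ab hF hf.
have wc (h : R -> R) : (forall t : R, a <= t <= b -> {for t, continuous h}) ->
    {within `[a, b], continuous h}.
  move=> hc; apply: continuous_in_subspaceT => t; rewrite inE /= in_itv /=; exact: hc.
apply: eq_ReIm; rewrite /cintegral /= ?cReD ?cReN ?cImD ?cImN.
  apply: (@Rintegral_FTC2 R (fun s => Re (F s))) => //; first by move=> t /hF[].
  by apply: wc => t /hf[].
apply: (@Rintegral_FTC2 R (fun s => Im (F s))) => //; first by move=> t /hF[].
by apply: wc => t /hf[].
Qed.

Lemma cintegral_split (f : R -> C) (a b c : R) : a <= b -> b <= c ->
  (forall t : R, a <= t <= c -> ccont f t) ->
  cintegral a c f = cintegral a b f + cintegral b c f.
Proof.
move=> ab bc hf.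
have int (h : R -> R) u v : a <= u -> v <= c -> (forall t : R, a <= t <= c -> {for t, continuous h}) ->
    mu.-integrable `[u, v] (EFin \o h).
  move=> au vc hc; apply: within_continuous_integrable.
  apply: continuous_in_subspaceT => t; rewrite inE /= in_itv /= => /andP[h1 h2].
  by apply: hc; rewrite (le_trans au h1) (le_trans h2 vc).
have spl (h : R -> R) : (forall t : R, a <= t <= c -> {for t, continuous h}) ->
    \int[mu]_(t in `[a, c]) h t = \int[mu]_(t in `[a, b]) h t + \int[mu]_(t in `[b, c]) h t.
  move=> hc; rewrite addrC -[LHS](subrK (\int[mu]_(t in `[a, b]) h t)); congr (_ + _).
  rewrite Rintegral_itvB ?bnd_simp //; last exact: int.
  rewrite Rintegral_itv_obnd_cbnd //.
  apply: integrableS (int h b c ab (lexx c) hc) => //.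
  by apply: subset_itvr; rewrite bnd_simp.
apply: eq_ReIm; rewrite ?cReD ?cImD /=; apply: spl => t /hf[] //.
Qed.

(** A supremum argument. Continuing a branch along a path only asks that [P] propagate forward
    between points close to a given one. *)
Lemma unit_interval_ind (P : R -> Prop) : P 0 ->
  (forall t0 : R, 0 <= t0 <= 1 -> exists2 e : R, 0 < e & forall s t : R,
     0 <= s -> s <= t -> t <= 1 -> `|s - t0| < e -> `|t - t0| < e -> P s -> P t) ->
  P 1.
Proof.
move=> P0 hloc.
pose S := [set t : R | 0 <= t <= 1 /\ P t].
have S0 : S 0 by split; rewrite ?lexx ?ler01.
have ubS : ubound S 1 by move=> t [/andP[]].
have hS : has_sup S by split; [exists 0|exists 1].
set T := sup S.
have T0 : 0 <= T by apply: ub_le_sup => //; exists 1.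
have T1 : T <= 1 by apply: ge_sup => //; exists 0.
have [e e0 he] : exists2 e : R, 0 < e & forall s t : R,
     0 <= s -> s <= t -> t <= 1 -> `|s - T| < e -> `|t - T| < e -> P s -> P t.
  by apply: hloc; rewrite T0 T1.
have [s [/andP[s0 s1] Ps] sT] : exists2 s, S s & T - e < s.
  by apply: sup_adherent.
have sleT : s <= T by apply: ub_le_sup; [exists 1|split => //; rewrite s0 s1].
pose u := Num.min 1 (T + e / 2).
have e2 : 0 < e / 2 by rewrite divr_gt0.
have Tu : T <= u by rewrite le_min T1 lerDl ltW.
have u1 : u <= 1 by rewrite ge_min lexx.
have Pu : P u.
  apply: (he s u) => //; first exact: le_trans sleT Tu.
    by rewrite distrC ger0_norm ?subr_ge0 // ltrBlDr -ltrBlDl.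
  rewrite ger0_norm ?subr_ge0 // ltrBlDr.
  have : u <= T + e / 2 by rewrite ge_min lexx orbT.
  lra.
have uT : u <= T.
  apply: ub_le_sup; first by exists 1.
  by split => //; rewrite u1 (le_trans T0 Tu).
have : u = 1.
  rewrite /u /Num.min; case: ltP => // h.
  move: uT; rewrite /u; case: leP h => // ; lra.
by move=> <-.
Qed.

End Continuity.

(** * Analytic continuation along a loop *)

Section Periods.
Variable R : realType.
Local Notation C := R[i].
Local Notation Re := complex.Re.
Local Notation Im := complex.Im.
Variable g : nat.
Local Notation m := g.*2.+1.
Local Notation zeta := (croot R m).

Definition pmap (P : {poly rat}) : {poly C} := map_poly (ratr : rat -> C) P.

Definition in_span (w : nat -> C) := exists P : {poly rat},
  forall i, (i < g)%N -> w i = period_coef R g i * (pmap P).[zeta ^+ i.+1].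

(** The vectors in [in_span] form a group, which plays the part of the monodromy: it absorbs the
    difference of any two branches over the same point. *)
Lemma in_span_ext w w' : (forall i, (i < g)%N -> w i = w' i) -> in_span w -> in_span w'.
Proof. by move=> e [P hP]; exists P => i ig; rewrite -e // hP. Qed.

Lemma in_spanB w w' : in_span w -> in_span w' -> in_span (fun i => w i - w' i).
Proof.
move=> [P hP] [Q hQ]; exists (P - Q) => i ig.
by rewrite hP // hQ // /pmap rmorphB /= hornerD hornerN mulrBr.
Qed.

Lemma in_spanN w : in_span w -> in_span (fun i => - w i).
Proof.
move=> [P hP]; exists (- P) => i ig.
by rewrite hP // /pmap rmorphN /= hornerN mulrN.
Qed.

Lemma in_span0 : in_span (fun=> 0).
Proof. by exists 0 => i _; rewrite /pmap rmorph0 horner0 mulr0. Qed.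

Lemma in_span_sign (s : C) k : s ^+ 2 = 1 ->
  in_span (fun i => s * zeta ^+ (k * i.+1) * period_coef R g i).
Proof.
move=> /eqP; rewrite sqrf_eq1 => /orP[]/eqP->.
  exists ('X^k) => i _; rewrite /pmap map_polyXn hornerXn mul1r -exprM [(i.+1 * _)%N]mulnC.
  by rewrite mulrC.
exists (- 'X^k) => i _; rewrite /pmap rmorphN /= map_polyXn hornerN hornerXn -exprM.
by rewrite [(i.+1 * _)%N]mulnC mulrC mulN1r.
Qed.

(* [near0] and [near_oo] are the charts with coordinate [x] and [v = x ^ (- 1 / 2)]. *)
Definition near0 (x y : C) (w : nat -> C) := slit (1 + x ^+ m) /\
  exists s, [/\ s ^+ 2 = 1, y = s * csqrt (1 + x ^+ m) &
    in_span (fun i => w i - s * Phi i m x)].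

Definition near_oo (x y : C) (w : nat -> C) := exists v t,
  [/\ v ^+ 2 * x = 1, slit (1 + v ^+ m.*2), t ^+ 2 = 1, y * v ^+ m = t * csqrt (1 + v ^+ m.*2) &
    in_span (fun i => w i + 2 * t * Phi (m - i.*2 - 3) m.*2 v)].

(* The branches at [(x, y)] of the multivalued function obtained by integrating
   the [x ^ i dx / y]. *)
Definition branch x y w := near0 x y w \/ near_oo x y w.

Lemma near0_near_oo x y w w' : near0 x y w -> near_oo x y w' -> in_span (fun i => w i - w' i).
Proof.
move=> [h1 [s [s1 hy1 hs]]] [v [t [xv h2 t1 hy2 ht]]].
have [k hk] := overlap xv h1 h2 hy1 hy2 s1 t1.
have := in_spanB (in_spanB hs ht) (in_spanN (in_span_sign k s1)).
by apply: in_span_ext => i ig; rewrite -hk //; ring.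
Qed.

(** Between the two charts the difference is computed by [overlap]. Within the chart at infinity,
    replacing [v] by [- v] changes both the sign [t] and the odd function [Phi]. *)
Lemma branch_unique x y w w' : branch x y w -> branch x y w' -> in_span (fun i => w i - w' i).
Proof.
case=> h [] h'.
- move: h h' => [h1 [s [s1 hy1 hs]]] [_ [s' [s1' hy1' hs']]].
  have E : s = s' by apply: (mulIf (csqrt_neq0 h1)); rewrite -hy1 -hy1'.
  by have := in_spanB hs hs'; apply: in_span_ext => i _; rewrite E; ring.
- exact: near0_near_oo h h'.
- have := in_spanN (near0_near_oo h' h); apply: in_span_ext => i _.
  by rewrite opprB.
move: h h' => [v [t [xv h2 t1 hy2 ht]]] [v' [t' [xv' _ t1' hy2' ht']]].
have v0 : v != 0 by apply: contra_eq_neq xv => ->; rewrite expr0n mul0r eq_sym oner_eq0.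
have x0 : x != 0 by apply: contra_eq_neq xv => ->; rewrite mulr0 eq_sym oner_eq0.
have [e e2 ve] : exists2 e : C, e ^+ 2 = 1 & v' = e * v.
  exists (v' / v); last by rewrite divfK.
  have -> : (v' / v) ^+ 2 = v' ^+ 2 / v ^+ 2 by rewrite expr_div_n.
  have -> : v' ^+ 2 = v ^+ 2 by apply: (mulIf x0); rewrite xv xv'.
  by rewrite divff // expf_neq0.
have eodd n : e ^+ n.*2.+1 = e by rewrite exprS -mul2n exprM e2 expr1n mulr1.
have e2m : e ^+ m.*2 = 1 by rewrite -mul2n exprM e2 expr1n.
have te : t' = e * t.
  apply: (mulIf (csqrt_neq0 h2)); rewrite -mulrA -hy2.
  have vv : v' ^+ m.*2 = v ^+ m.*2 by rewrite ve exprMn e2m mul1r.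
  by rewrite -vv -hy2' ve exprMn eodd; ring.
have m20 : (0 < m.*2)%N by rewrite double_gt0.
have := in_spanB ht ht'; apply: in_span_ext => i ig.
have ei : ((m - i.*2 - 3).+1 = (g - i.+1).*2.+1)%N by clear -ig; lia.
rewrite ve (PhiZ _ m20 e2m h2) te ei eodd.
have -> : 2 * (e * t) * (e * Phi (m - i.*2 - 3) m.*2 v) = e ^+ 2 * (2 * t * Phi (m - i.*2 - 3) m.*2 v) by ring.
by rewrite e2; ring.
Qed.

Variables (x y : R -> C).
Hypothesis xy_loop : curve_loop m x y.

Let dx := cderive x.

Lemma C1_is_cder (f : R -> C) t : C1 f -> is_cder f t (cderive f t).
Proof.
move=> hf; have [d1 _] := hf _ (or_introl erefl).
have [d2 _] := hf _ (or_intror erefl).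
split; first by apply: DeriveDef; [exact: d1|rewrite /cderive /= derive1E].
by apply: DeriveDef; [exact: d2|rewrite /cderive /= derive1E].
Qed.

Lemma C1_ccont (f : R -> C) t : C1 f -> ccont (cderive f) t.
Proof.
move=> hf; have [_ d1] := hf _ (or_introl erefl).
have [_ d2] := hf _ (or_intror erefl).
by split; [exact: d1|exact: d2].
Qed.

Let hx t : is_cder x t (dx t).
Proof. by case: xy_loop => h _ _ _; exact: C1_is_cder. Qed.

Let hdx t : ccont dx t.
Proof. by case: xy_loop => h _ _ _; exact: C1_ccont. Qed.

Let cx t : ccont x t. Proof. exact: is_cder_ccont (hx t). Qed.

Let cy t : ccont y t.
Proof. by case: xy_loop => _ h _ _; exact: is_cder_ccont (C1_is_cder t h). Qed.

Let hy (t : R) : 0 <= t <= 1 -> y t ^+ 2 = x t ^+ m + 1 /\ y t != 0.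
Proof. by case: xy_loop => _ _ _; apply. Qed.

Let om i t := x t ^+ i * dx t / y t.

Lemma ccontX (f : R -> C) t n : ccont f t -> ccont (fun s => f s ^+ n) t.
Proof.
move=> hf; elim: n => [|n IH].
  exact: is_cder_ccont (is_cder_cst 1 t).
rewrite (_ : (fun s => _) = (fun s => f s * f s ^+ n)); first exact: ccontM.
by apply/funext => s; rewrite exprS.
Qed.

Let com i (t : R) : 0 <= t <= 1 -> ccont (om i) t.
Proof.
move=> /hy[_ y0]; apply: ccontM; last exact: ccontV.
by apply: ccontM => //; exact: ccontX.
Qed.

Lemma near_sqrt1 (f : R -> C) t : ccont f t -> f t = 1 ->
  \forall s \near t, f s ^+ 2 = 1 -> f s = 1.
Proof.
move=> [cR _] f1.
have : \forall s \near t, 0 < Re (f s) by apply: (cvgr_gt _ cR); rewrite f1.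
apply: filterS => s hs /eqP; rewrite sqrf_eq1 => /orP[/eqP//|/eqP e].
by move: hs; rewrite e /= oppr_gt0 ltNge ler01.
Qed.

(** A lift of the loop near [t0] to the multivalued integral. The whole coset of [G s] modulo
    [in_span] consists of branches, so that lifts over neighbouring intervals can be glued. *)
Definition local_primitive (t0 : R) := exists2 e : R, 0 < e & exists G : R -> nat -> C,
  forall s : R, 0 <= s <= 1 -> `|s - t0| < e ->
   (forall w, in_span (fun i => w i - G s i) -> branch (x s) (y s) w) /\
   (forall i, (i < g)%N -> is_cder (G ^~ i) s (om i s)).

Lemma local_primitive0 (t0 : R) : 0 <= t0 <= 1 -> slit (1 + x t0 ^+ m) -> local_primitive t0.
Proof.
move=> ht0 sl.
have [y2 y0] := hy ht0.
have c0 := csqrt_neq0 sl; have c2 := csqrtK sl.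
pose c t := csqrt (1 + x t ^+ m).
have hc1 t : is_cder (fun t => 1 + x t ^+ m) t (0 + m%:R * x t ^+ m.-1 * dx t).
  exact: (is_cderD (is_cder_cst 1 t) (is_cderX m (hx t))).
have n1 : \near t0, slit (1 + x t0 ^+ m) by apply: ccont_slit (is_cder_ccont (hc1 t0)) sl.
have [s0 s02 s0E] : exists2 s0 : C, s0 ^+ 2 = 1 & y t0 = s0 * c t0.
  exists (y t0 / c t0); last by rewrite divfK.
  by rewrite expr_div_n y2 /c c2 addrC divff // -c2 expf_neq0.
have s00 : s0 != 0 by rewrite -sqrf_eq0 s02 oner_eq0.
have sc0 : s0 * c t0 != 0 by rewrite mulf_neq0.
(* The sign of [y] relative to the chart: [q] is continuous at [t0] and its square is 1, so it
   cannot jump to -1 nearby. *)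
pose q t := y t * (s0 * c t)^-1.
have cq : ccont q t0.
  apply: ccontM (cy t0) _; apply: ccontV sc0.
  by apply: is_cder_ccont (is_cderZ s0 (is_cder_csqrt (hc1 t0) sl)).
have q1 : q t0 = 1 by rewrite /q s0E divff.
have n2 := near_sqrt1 cq q1.
have [e e0 he] : exists2 e : R, 0 < e & forall s, t0 - e < s < t0 + e ->
   slit (1 + x s ^+ m) /\ (q s ^+ 2 = 1 -> q s = 1).
  by apply: near_open_itv; near=> s; split; near: s.
exists e => //; exists (fun t i => s0 * Phi i m (x t)) => s hs hse.
have [sls hq] : slit (1 + x s ^+ m) /\ (q s ^+ 2 = 1 -> q s = 1).
  by apply: he; rewrite -ltr_distl.
have cs0 := csqrt_neq0 sls; have cs2 := csqrtK sls.
have [y2s y0s] := hy hs.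
have ys : y s = s0 * c s.
  have qs : q s = 1.
    apply: hq; rewrite /q exprMn exprVn exprMn s02 mul1r y2s /c cs2 addrC divff //.
    by rewrite -cs2 expf_neq0.
  exact: divr1_eq qs.
split.
  by move=> w hw; left; split => //; exists s0.
move=> i ig.
have nx : \near s, is_cder x s (dx s) by near=> r; exact: hx.
have H := @is_cder_Phi R i m x dx s (ltn0Sn _) nx (ccont_bounded (hdx s)) sls.
apply: (is_cder_eq (is_cderZ s0 H)).
have s0V : s0^-1 = s0 by apply: (mulfI s00); rewrite divff // -expr2 s02.
by rewrite /om ys invfM s0V /c; ring.
Unshelve. all: by end_near. Qed.

(** The points missed by the chart at 0 are those where [1 + x ^+ m] is real and negative, zero
    being excluded by [y != 0]. There [x ^+ m < -1], so [1 + x ^- m] is positive and the chart at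
    infinity applies. *)
Lemma local_primitive_oo (t0 : R) : 0 <= t0 <= 1 -> ~~ slit (1 + x t0 ^+ m) -> local_primitive t0.
Proof.
move=> ht0 nsl.
have [y2 y0] := hy ht0.
have [xI xR] : Im (x t0 ^+ m) = 0 /\ Re (x t0 ^+ m) < - 1.
  move: nsl; rewrite /slit negb_or negbK cImD cReD /= add0r -leNgt => /andP[/eqP hI hR].
  split => //; rewrite lt_def; apply/andP; split; last by move: hR; lra.
  apply: contra y0 => /eqP hR2.
  rewrite -sqrf_eq0 y2; apply/eqP; apply: eq_ReIm; rewrite ?cReD ?cImD ?hI -?hR2 /= ?addr0 //.
  by rewrite addNr.
have x0 : x t0 != 0.
  by move: xR; apply: contraTneq => ->; rewrite expr0n /= -leNgt oppr_le0 ler01.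
pose v0 := sqrtC ((x t0)^-1).
have v02 : v0 ^+ 2 = (x t0)^-1 by rewrite /v0 sqrtCK.
have v0x : v0 ^+ 2 * x t0 = 1 by rewrite v02 mulVf.
have v00 : v0 != 0.
  by apply: contra_eq_neq v0x => ->; rewrite expr0n mul0r eq_sym oner_eq0.
(* A differentiable choice of [x ^ (- 1 / 2)] near [t0], where the quotient [x t0 / x t] is close to
   1. *)
pose v t := v0 * csqrt (x t0 / x t).
have one : csqrt 1 = 1 :> C.
  by apply/esym/csqrt_unique; rewrite ?expr1n //= ?ltr01 // /slit /= ltr01 orbT.
have vt0 : v t0 = v0 by rewrite /v divff // one mulr1.
have cxx : ccont (fun t => x t0 / x t) t0.
  by apply: ccontM; [exact: is_cder_ccont (is_cder_cst _ _)|exact: ccontV].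
have n1 : \forall s \near t0, slit (x t0 / x s).
  by apply: ccont_slit cxx _; rewrite divff // /slit /= ltr01 orbT.
have v2 s : slit (x t0 / x s) -> v s ^+ 2 * x s = 1.
  move=> sl; have xs0 : x s != 0.
    by apply: contraTneq sl => ->; rewrite invr0 mulr0 /slit /= eqxx ltxx.
  by rewrite /v exprMn csqrtK // v02 mulKf // mulVf.
pose v' s := - (v s ^+ 3 * dx s) / 2.
have hv s : slit (x t0 / x s) -> is_cder v s (v' s).
  move=> sl; have xs0 : x s != 0.
    by apply: contraTneq sl => ->; rewrite invr0 mulr0 /slit /= eqxx ltxx.
  have H := is_cderZ v0 (is_cder_csqrt (is_cderZ (x t0) (is_cderV (hx s) xs0)) sl).
  apply: (is_cder_eq H); rewrite /v'.
  have c0 := csqrt_neq0 sl; have c2 := csqrtK sl.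
  have -> : v s ^+ 3 = v0 ^+ 2 * v0 * (csqrt (x t0 / x s) ^+ 2) ^+ 2 / csqrt (x t0 / x s).
    by rewrite /v; move: (csqrt _) c0 => c c0; field.
  rewrite c2 v02; move: (csqrt _) c0 => c c0; field.
  by rewrite c0 xs0 x0.
have slv : slit (1 + v t0 ^+ m.*2).
  have vx : v t0 ^+ m.*2 * x t0 ^+ m = 1.
    by rewrite vt0 -mul2n exprM -exprMn v0x expr1n.
  have xm0 : x t0 ^+ m != 0 by rewrite expf_neq0.
  have -> : v t0 ^+ m.*2 = (x t0 ^+ m)^-1 by apply: (mulIf xm0); rewrite vx mulVf.
  rewrite /slit cReD cReV /= xI expr0n addr0; apply/orP; right.
  have r0 : Re (x t0 ^+ m) != 0 by rewrite lt_eqF // (lt_trans xR) // oppr_lt0 ltr01.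
  have -> : Re (x t0 ^+ m) / Re (x t0 ^+ m) ^+ 2 = (Re (x t0 ^+ m))^-1 by field.
  have : (Re (x t0 ^+ m))^-1 * Re (x t0 ^+ m) = 1 by rewrite mulVf.
  by move: xR; nra.
have slt0 : slit (x t0 / x t0) by rewrite divff // /slit /= ltr01 orbT.
have hv0 := hv t0 slt0.
pose c t := csqrt (1 + v t ^+ m.*2).
have hc1 : is_cder (fun t => 1 + v t ^+ m.*2) t0 (0 + m.*2%:R * v t0 ^+ m.*2.-1 * v' t0).
  exact: (is_cderD (is_cder_cst 1 _) (is_cderX m.*2 hv0)).
have n2 : \near t0, slit (1 + v t0 ^+ m.*2) by apply: ccont_slit (is_cder_ccont hc1) slv.
have E s : 0 <= s <= 1 -> slit (x t0 / x s) -> (y s * v s ^+ m) ^+ 2 = 1 + v s ^+ m.*2.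
  move=> hs sl; have [y2s _] := hy hs.
  rewrite exprMn y2s -exprM muln2 mulrDl mul1r; congr (_ + _).
  by rewrite -[m.*2]mul2n exprM -exprMn mulrC v2 // expr1n.
have c0 := csqrt_neq0 slv; have c2 := csqrtK slv.
have [s0 s02 s0E] : exists2 s0 : C, s0 ^+ 2 = 1 & y t0 * v t0 ^+ m = s0 * c t0.
  exists (y t0 * v t0 ^+ m / c t0); last by rewrite divfK.
  rewrite expr_div_n E // /c c2 divff // -c2 expf_neq0 //.
have s00 : s0 != 0 by rewrite -sqrf_eq0 s02 oner_eq0.
pose q t := y t * v t ^+ m * (s0 * c t)^-1.
have sc0 : s0 * c t0 != 0 by rewrite mulf_neq0.
have cq : ccont q t0.
  apply: ccontM; first by apply: ccontM; [exact: cy | apply: ccontX; exact: is_cder_ccont hv0].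
  apply: ccontV sc0.
  exact: is_cder_ccont (is_cderZ s0 (is_cder_csqrt hc1 slv)).
have q1 : q t0 = 1 by rewrite /q s0E divff.
have n3 := near_sqrt1 cq q1.
have [e e0 he] : exists2 e : R, 0 < e & forall s, t0 - e < s < t0 + e ->
   [/\ slit (x t0 / x s), slit (1 + v s ^+ m.*2) & q s ^+ 2 = 1 -> q s = 1].
  apply: near_open_itv; near=> s; split; near: s => //.
exists e => //; exists (fun t i => - (2 * s0) * Phi (m - i.*2 - 3) m.*2 (v t)) => s hs hse.
have [slx sls hq] : [/\ slit (x t0 / x s), slit (1 + v s ^+ m.*2) & q s ^+ 2 = 1 -> q s = 1].
  by apply: he; rewrite -ltr_distl.
have cs0 := csqrt_neq0 sls; have cs2 := csqrtK sls.
have v2s := v2 s slx.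
have ys : y s * v s ^+ m = s0 * c s.
  have qs : q s = 1.
    apply: hq; rewrite /q exprMn (E s hs slx) exprVn [(s0 * _) ^+ 2]exprMn s02 mul1r /c cs2 divff //.
    by rewrite -cs2 expf_neq0.
  exact: divr1_eq qs.
split.
  move=> w hw; right; exists (v s), s0; split => //.
  by apply: in_span_ext hw => i _; ring.
move=> i ig.
have nv : \near s, is_cder v s (v' s).
  have : \forall r \near s, r \in `]t0 - e, t0 + e[ by apply: near_in_itvoo; rewrite in_itv /= -ltr_distl.
  apply: filterS => r; rewrite in_itv /= => hr; apply: hv.
  by have [] := he r hr.
have bv : exists K : C, \near s, `|v' s| <= K.
  apply: ccont_bounded; apply: ccontM; last exact: is_cder_ccont (is_cder_cst _ _).
  rewrite (_ : (fun s => - _) = (fun s => v s ^+ 3 * dx s * (-1))); last first.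
    by apply/funext => r; rewrite mulrN1.
  apply: ccontM; last exact: is_cder_ccont (is_cder_cst _ _).
  by apply: ccontM; [apply: ccontX; exact: is_cder_ccont (hv s slx) | exact: hdx].
have m20 : (0 < m.*2)%N by rewrite double_gt0.
have H := @is_cder_Phi R (m - i.*2 - 3) m.*2 v v' s m20 nv bv sls.
apply: (is_cder_eq (is_cderZ (- (2 * s0)) H)).
have s0V : s0^-1 = s0 by apply: (mulfI s00); rewrite divff // -expr2 s02.
have vs0 : v s != 0 by apply: contra_eq_neq v2s => ->; rewrite expr0n mul0r eq_sym oner_eq0.
have xs : x s = v s ^- 2 by apply: (mulfI (expf_neq0 2 vs0)); rewrite v2s divff // expf_neq0.
rewrite /om; have -> : (y s)^-1 = v s ^+ m * s0 / c s.
  have -> : y s = s0 * c s / v s ^+ m by rewrite -ys mulfK // expf_neq0.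
  by rewrite invf_div invfM s0V; ring.
have ei : (m = (m - i.*2 - 3) + 3 + i.*2)%N by clear -ig; lia.
rewrite xs {3}ei !exprD /v'.
have -> : v s ^- 2 ^+ i = (v s ^+ i.*2)^-1 by rewrite -mul2n exprVn exprM.
move: (v s ^+ i.*2) (expf_neq0 i.*2 vs0) => V V0.
by rewrite /c; field; rewrite V0 cs0.
Unshelve. all: by end_near. Qed.

Lemma branch_ext x0 y0 w w' : (forall i, (i < g)%N -> w i = w' i) -> branch x0 y0 w -> branch x0 y0 w'.
Proof.
move=> e [[h [s [h1 h2 h3]]]|[v [t [h1 h2 h3 h4 h5]]]]; [left; split => //|right].
  by exists s; split => //; apply: in_span_ext h3 => i ig; rewrite e.
by exists v, t; split => //; apply: in_span_ext h5 => i ig; rewrite e.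
Qed.

(** Integration from an initial branch leads along the loop to a branch over the same point; the
    difference of the two is the period. *)
Lemma period_in_span : in_span (fun i => cintegral01 (om i)).
Proof.
have lp t0 : 0 <= t0 <= 1 -> local_primitive t0.
  move=> ht0; have [sl|nsl] := boolP (slit (1 + x t0 ^+ m)).
    exact: local_primitive0.
  exact: local_primitive_oo.
have h01 : 0 <= (0 : R) <= 1 by rewrite lexx ler01.
have [e0 e0p [G0 /(_ 0 h01)]] := lp 0 h01.
rewrite subrr normr0 => /(_ e0p)[hb0 _].
pose w0 := G0 0.
have b0 : branch (x 0) (y 0) w0.
  by apply: hb0; apply: in_span_ext in_span0 => i _; rewrite subrr.
pose W (t : R) i := w0 i + cintegral 0 t (om i).
have b1 : branch (x 1) (y 1) (W 1).
  apply: (@unit_interval_ind _ (fun t => branch (x t) (y t) (W t))).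
    apply: branch_ext b0 => i _; rewrite /W /cintegral set_itv1 !Rintegral_set1.
    by rewrite [LHS](_ : _ = w0 i + 0) // addr0.
  move=> t0 /lp[e ep [G hG]]; exists e => // s t s0 st t1 hs ht bs.
  have hs01 : 0 <= s <= 1 by rewrite s0 (le_trans st t1).
  have ht01 : 0 <= t <= 1 by rewrite t1 (le_trans s0 st).
  have [Gs _] := hG s hs01 hs; have [Gt _] := hG t ht01 ht.
  have bG : branch (x s) (y s) (G s).
    by apply: Gs; apply: in_span_ext in_span0 => i _; rewrite subrr.
  apply: Gt; apply: in_span_ext (branch_unique bs bG) => i ig.
  rewrite /W (cintegral_split s0 st); last first.
    move=> r /andP[r0 rt]; apply: com; rewrite r0; exact: le_trans rt t1.
  rewrite (cintegral_FTC2 (F := G ^~ i) st).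
  - by ring.
  - move=> r /andP[sr rt].
    have r01 : 0 <= r <= 1 by rewrite (le_trans s0 sr) (le_trans rt t1).
    have hr : `|r - t0| < e.
      move: hs ht; rewrite !ltr_distl => /andP[h1 h2] /andP[h3 h4].
      by rewrite (lt_le_trans h1 sr) (le_lt_trans rt h4).
    by have [_ /(_ i ig)] := hG r r01 hr.
  - move=> r /andP[sr rt]; apply: com.
    by rewrite (le_trans s0 sr) (le_trans rt t1).
case: xy_loop => _ _ [ex ey] _.
rewrite -ex -ey in b1.
apply: in_span_ext (branch_unique b1 b0) => i _.
by rewrite /W addrC addKr.
Qed.

End Periods.

Section JacobianPeriods.
Variable R : realType.
Local Notation C := R[i].

Lemma jacobian_period_form (g : nat) (v : 'rV[C]_(genus g.*2.+1)) :
  jacobian_lattice R g.*2.+1 v ->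
  exists P : {poly rat}, forall i,
    v 0 i = period_coef R g i * (pmap R P).[croot R g.*2.+1 ^+ i.+1].
Proof.
have gE : genus g.*2.+1 = g by rewrite /genus /= doubleK.
move=> [q [c [s [hs ->]]]].
have H : forall j : 'I_q, exists P : {poly rat}, forall i,
    s j 0 i = period_coef R g i * (pmap R P).[croot R g.*2.+1 ^+ i.+1].
  move=> j; have [x [y [hl ->]]] := hs j.
  have [P hP] := period_in_span hl; exists P => i.
  by rewrite mxE -hP // -[X in (_ < X)%N]gE.
have [P hP] := boolp.choice H.
exists (\sum_j (c j)%:~R *: P j) => i.
rewrite summxE /pmap raddf_sum /= horner_sum mulr_sumr; apply: eq_bigr => j _.
by rewrite mxE hP map_polyZ hornerZ /= ratr_int; ring.
Qed.

End JacobianPeriods.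

(** * Cyclotomic polynomials and roots of unity *)

Section Cyclotomic.

Definition PhiQ n : {poly rat} := map_poly intr 'Phi_n.

Lemma prod_PhiQ n : (0 < n)%N -> \prod_(d <- divisors n) PhiQ d = 'X^n - 1.
Proof.
move=> n0; rewrite /PhiQ -rmorph_prod /= prod_Cyclotomic //.
by rewrite rmorphB /= rmorph1 map_polyXn.
Qed.

Lemma PhiQ_monic n : PhiQ n \is monic.
Proof. by apply: monic_map; exact: Cyclotomic_monic. Qed.

Lemma size_PhiQ n : size (PhiQ n) = (totient n).+1.
Proof.
rewrite /PhiQ size_map_inj_poly ?size_Cyclotomic //; exact: intr_inj.
Qed.

Lemma PhiQ_dvd_Xn_sub_1 d n : (0 < n)%N -> (d %| n)%N -> PhiQ d %| 'X^n - 1.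
Proof.
move=> n0; rewrite dvdn_divisors // => dn; rewrite -prod_PhiQ // (big_rem d) //=.
exact: dvdp_mulIl.
Qed.

Variable K : numFieldType.
Local Notation toK := (map_poly (ratr : rat -> K)).

Lemma root_Xn_sub_1 n (z : K) : root (toK ('X^n - 1)) z = (z ^+ n == 1).
Proof. by rewrite /root rmorphB /= rmorph1 map_polyXn !hornerE subr_eq0. Qed.

Lemma root_map_dvdp (f g : {poly rat}) (z : K) : f %| g -> root (toK f) z -> root (toK g) z.
Proof. by move=> fg; apply: root_dvdp; rewrite dvdp_map. Qed.

Lemma prim_root_PhiQ n (z : K) : n.-primitive_root z -> root (toK (PhiQ n)) z.
Proof.
move=> hz; have n0 := prim_order_gt0 hz.
have : root (toK ('X^n - 1)) z by rewrite root_Xn_sub_1 prim_expr_order.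
rewrite -prod_PhiQ // rmorph_prod /= /root horner_prod => /eqP.
move=> /eqP; rewrite prodf_seq_eq0 => /hasP[d dn /= hd].
move: dn; rewrite -dvdn_divisors // => dn.
suff : d = n by move=> <-.
apply/eqP; rewrite eqn_dvd dn (prim_order_dvd hz) -root_Xn_sub_1.
by apply: root_map_dvdp hd; apply: PhiQ_dvd_Xn_sub_1 => //; exact: dvdn_gt0 dn.
Qed.

(** If the exact order of [z] were a proper divisor of [n], then [z] would be a root of two distinct
    factors of the separable polynomial [X^n - 1]. *)
Lemma root_PhiQ n (z : K) : (0 < n)%N -> root (toK (PhiQ n)) z -> n.-primitive_root z.
Proof.
move=> n0 hz.
have zn : z ^+ n = 1.
  by apply/eqP; rewrite -root_Xn_sub_1; apply: root_map_dvdp hz; exact: PhiQ_dvd_Xn_sub_1.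
have [d hd dn] := prim_order_exists n0 zn.
have [<- //|nd] := eqVneq d n.
have hz2 := prim_root_PhiQ hd.
have : separable_poly ('X^n - 1 : {poly rat}).
  by apply: separable_Xn_sub_1; rewrite pnatr_eq0 -lt0n.
rewrite -prod_PhiQ // (big_rem n) ?divisors_id //= (big_rem d) //=; last first.
  by rewrite mem_rem_uniq ?divisors_uniq // !inE nd -dvdn_divisors.
rewrite separable_mul => /and3P[_ _]; rewrite coprimepMr => /andP[+ _].
rewrite -(coprimep_map (ratr : rat -> K)) => hc.
by have := coprimep_root hc hz; rewrite -/(root _ _) hz2.
Qed.

End Cyclotomic.

Lemma PhiQ_irreducible n (d : {poly rat}) : (0 < n)%N -> d %| PhiQ n -> size d != 1%N -> PhiQ n %| d.
Proof.
move=> n0 dn sd.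
have sd' : size (map_poly (ratr : rat -> algC) d) != 1%N by rewrite size_map_poly.
have /closed_rootP[z hz] := sd'.
have hp : n.-primitive_root z.
  by apply: root_PhiQ => //; exact: root_map_dvdp dn hz.
have [p [pE pm hroot]] := minCpolyP z.
suff -> : PhiQ n = p by rewrite -hroot.
apply: (map_inj_poly (fmorph_inj (ratr : {rmorphism rat -> algC}))); first by rewrite rmorph0.
rewrite -pE (minCpoly_cyclotomic hp) -(Cintr_Cyclotomic hp) /PhiQ -map_poly_comp.
by apply: eq_map_poly => i /=; rewrite ratr_int.
Qed.

Lemma prim_root_min (K : numFieldType) n (z : K) (f : {poly rat}) : n.-primitive_root z ->
  (map_poly ratr f).[z] = 0 -> PhiQ n %| f.
Proof.
move=> hz fz; have n0 := prim_order_gt0 hz.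
apply: dvdp_trans (dvdp_gcdr (PhiQ n) f).
apply: PhiQ_irreducible; rewrite ?dvdp_gcdl //.
apply: contraTneq (prim_root_PhiQ hz) => s1.
have hc : coprimep (PhiQ n) f by rewrite /coprimep s1.
move: hc; rewrite -(coprimep_map (ratr : rat -> K)) coprimep_sym => hc.
by apply: (coprimep_root hc); apply/rootP.
Qed.

Lemma coprimep_PhiQ d e : (0 < d)%N -> (0 < e)%N -> d != e -> coprimep (PhiQ d) (PhiQ e).
Proof.
move=> d0 e0 de; rewrite -(coprimep_map (ratr : rat -> algC)).
apply/Pdiv.ClosedField.coprimepP => z /(root_PhiQ d0) hd.
apply: contra de => /(root_PhiQ e0) he.
rewrite eqn_dvd (prim_order_dvd hd) (prim_expr_order he) eqxx /=.
by rewrite (prim_order_dvd he) (prim_expr_order hd) eqxx.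
Qed.

(** The substitute for Galois automorphisms: irreducibility of the cyclotomic polynomial carries
    every rational relation from one primitive root to the others. *)
Lemma prim_root_galois (K : numFieldType) n (z w : K) (f : {poly rat}) :
  n.-primitive_root z -> n.-primitive_root w ->
  (map_poly ratr f).[z] = 0 -> (map_poly ratr f).[w] = 0.
Proof.
move=> hz hw /(prim_root_min hz) hf.
by apply/rootP; apply: root_map_dvdp hf _; exact: prim_root_PhiQ.
Qed.

(** * Complex roots of unity and interpolation at them *)

Section RootsOfUnity.
Variable R : realType.
Local Notation C := R[i].

Lemma croot_prim q : (0 < q)%N -> q.-primitive_root (croot R q).
Proof.
move=> q0; have hq := croot_unity R q0.
have [d hd dq] := prim_order_exists q0 hq.
have d0 := prim_order_gt0 hd.
suff : ~~ (d < q)%N.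
  rewrite -leqNgt => qd; move: hd; rewrite (_ : d = q) //.
  by apply/eqP; rewrite eqn_leq qd dvdn_leq.
apply/negP => dltq.
have qR : 0 < q%:R :> R by rewrite ltr0n.
have dR : 0 < d%:R :> R by rewrite ltr0n.
pose a : R := pi / q%:R * d%:R.
have a0 : 0 < a by rewrite mulr_gt0 // divr_gt0 // pi_gt0.
have api : a < pi.
  by rewrite /a mulrAC ltr_pdivrMr // ltr_pM2l ?pi_gt0 // ltr_nat.
have := prim_expr_order hd; rewrite crootX => /(congr1 (@complex.Re R)).
rewrite Re_cexp /= expR0 mul1r (_ : _ *+ d = a *+ 2); last by rewrite /a mulr_natr mulrnAl -!mulrnA mulnC.
rewrite cos_mulr2n cos2sin2 => h.
have : 0 < sin a by apply: sin_gt0_pi; rewrite a0.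
have : sin a ^+ 2 = 0 by move: h; rewrite mulr2n; lra.
by move=> /eqP; rewrite sqrf_eq0 => /eqP->; rewrite ltxx.
Qed.

Lemma conj_cexp (z : C) : (cexp z)^*%C = cexp z^*%C.
Proof.
have hR (w : C) : complex.Re w^*%C = complex.Re w by case: w.
have hI (w : C) : complex.Im w^*%C = - complex.Im w by case: w.
by apply: eq_ReIm; rewrite ?hR ?hI ?Re_cexp ?Im_cexp ?hR ?hI ?cosN ?sinN ?mulrN.
Qed.

Lemma conj_croot q : (0 < q)%N -> (croot R q)^*%C = croot R q ^+ q.-1.
Proof.
move=> q0; have z0 : croot R q != 0 by exact: cexp_neq0.
apply: (mulfI z0); rewrite -exprS prednK // croot_unity //.
rewrite /croot conj_cexp -cexpD (_ : _ + _ = 0) ?cexp0 //.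
by apply: eq_ReIm; rewrite /= ?addr0 ?subrr.
Qed.

(** The CM type [0 < a < q / 2]; for [q > 1], 0 drops out since it is not prime to [q]. Throughout,
    negation modulo [q] is multiplication by [q.-1], which keeps residues in [nat]. *)
Definition halfunits q := [seq a <- iota 0 q./2.+1 | coprime a q].

Lemma halfunitsP q a : odd q -> (1 < q)%N ->
  (a \in halfunits q) = [&& (0 < a)%N, (a.*2 < q)%N & coprime a q].
Proof.
move=> oq q1; rewrite mem_filter mem_iota add0n leq0n /= andbC.
have -> : (a < q./2.+1)%N = (a.*2 < q)%N.
  by rewrite ltnS -[in RHS](odd_double_half q) oq add1n ltnS leq_double.
by case: a => //=; rewrite /coprime gcd0n gtn_eqF // andbF.
Qed.

Lemma halfunits_uniq q : uniq (halfunits q).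
Proof. by rewrite filter_uniq // iota_uniq. Qed.

Lemma geometric_root q (z : C) : z ^+ q = 1 -> z != 1 -> \sum_(i < q) z ^+ i = 0.
Proof.
move=> zq z1; have z10 : z - 1 != 0 by rewrite subr_eq0.
by apply: (mulfI z10); rewrite mulr0 -subrX1 zq subrr.
Qed.

(** The Lagrange interpolation polynomial of the class of [b] at the q-th roots of unity, obtained
    by Fourier inversion. *)
Definition delta q (b : nat) : {poly C} :=
  \poly_(i < q) (q%:R^-1 * croot R q ^+ (q.-1 * b * i)).

Lemma delta_mod q a b : (0 < q)%N -> a = b %[mod q] -> delta q a = delta q b.
Proof.
move=> q0 ab; have hp := croot_prim q0.
apply/polyP => i; rewrite !coef_poly; case: ifP => // _; congr (_ * _).
apply/eqP; rewrite (eq_prim_root_expr hp); apply/eqP.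
by rewrite -mulnA -modnMmr -(modnMml a) ab modnMml modnMmr mulnA.
Qed.

Lemma horner_delta q a b : (0 < q)%N -> (delta q b).[croot R q ^+ a] = (a == b %[mod q])%:R.
Proof.
move=> q0; have hp := croot_prim q0; set z := croot R q in hp *.
have qn0 : q%:R != 0 :> C by rewrite pnatr_eq0 -lt0n.
rewrite horner_poly.
have -> : \sum_(i < q) q%:R^-1 * z ^+ (q.-1 * b * i) * (z ^+ a) ^+ i
   = q%:R^-1 * \sum_(i < q) (z ^+ (q.-1 * b + a)) ^+ i.
  by rewrite mulr_sumr; apply: eq_bigr => i _; rewrite -!exprM mulnDl exprD mulrA.
have E : (z ^+ (q.-1 * b + a) == 1) = (a == b %[mod q]).
  rewrite -(prim_order_dvd hp) -(eqn_modDl (q.-1 * b) a b) -mulSnr prednK //.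
  by rewrite modnMr /dvdn.
case: eqVneq E => [e|ne] <-.
  rewrite e (eq_bigr (fun=> 1)) => [|i _]; last by rewrite expr1n.
  by rewrite sumr_const card_ord mulVf.
rewrite geometric_root ?mulr0 // -exprM mulnC exprM (prim_expr_order hp) expr1n //.
Qed.

Lemma conj_croot_exp q a : (0 < q)%N -> (croot R q ^+ a)^*%C = croot R q ^+ (q.-1 * a).
Proof. by move=> q0; rewrite exprM -conj_croot //; exact: (rmorphXn (@conjc R)). Qed.

End RootsOfUnity.

(* The circulant matrix with entries the signs of the residues [u * a] in
   [-q / 2, q / 2] is regular on odd functions. *)
Definition half_sum_regular (R : realType) (q : nat) := forall F : nat -> R[i],
  (forall a b, a = b %[mod q] -> F a = F b) -> (forall a, F (q.-1 * a)%N = - F a) ->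
  (forall u, coprime u q -> \sum_(a <- halfunits q) F (u * a)%N = 0) ->
  forall a, coprime a q -> F a = 0.

(* [P.[T]]; the ring of matrices of arbitrary size may be trivial, so [horner_mx]
   does not apply. *)
Definition poly_mx (K : nzRingType) (N : nat) (T : 'M[K]_N) (P : {poly K}) : 'M[K]_N :=
  \sum_(i < size P) P`_i *: T ^+ i.

(* The projection onto the eigenspace of [T] for the eigenvalue [croot R q ^+ b],
   when [T ^+ q = 1]. *)
Definition eigenproj (R : realType) q (N : nat) (T : 'M[rat]_N) b : 'M[R[i]]_N :=
  q%:R^-1 *: \sum_(i < q) croot R q ^+ (q.-1 * b * i) *: map_mx ratr (T ^+ i).

(** The rational homology is the field of q-th roots of unity, [T] acting as multiplication by a
    primitive one, with CM type [halfunits q]: over C, the eigenspaces of the opposite exponents are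
    killed by the map [B] to the tangent space. *)
Definition CM_by (R : realType) q n (T : 'M[rat]_(n.*2)) (B : 'M[R[i]]_(n.*2, n)) :=
  [/\ n.*2 = totient q, T ^+ q = 1, poly_mx T (PhiQ q) = 0 &
    forall b, b \in halfunits q -> eigenproj R q T (q.-1 * b) *m B = 0].

(** * Half sums of odd characters *)

Section Sieve.
Variable K : numFieldType.

Lemma big_multiples (F : nat -> K) (P : pred nat) p M : (0 < p)%N ->
  \sum_(1 <= n < M.+1 | P n && (p %| n)%N) F n =
  \sum_(1 <= n < (M %/ p).+1 | P (p * n)%N) F (p * n)%N.
Proof.
move=> p0; elim: M => [|M IH]; first by rewrite div0n !big_geq.
rewrite big_mkcond big_nat_recr //= -big_mkcond /= IH divnS //.
case: (boolP (p %| M.+1)%N) => [hp|hp]; last by rewrite andbF addr0.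
rewrite andbT add1n [RHS]big_mkcond [RHS]big_nat_recr //= -big_mkcond; congr (_ + _).
have e : (p * (M %/ p).+1)%N = M.+1.
  by have := divnK hp; rewrite divnS // hp add1n mulnC.
by rewrite e.
Qed.

(* [n] has no prime factor below [k.+1]. *)
Definition rough k n := all (fun p => ~~ (p %| n)%N) [seq p <- iota 0 k.+1 | prime p].

Lemma roughS k n : rough k.+1 n = rough k n && (prime k.+1 ==> ~~ (k.+1 %| n)%N).
Proof.
rewrite /rough -[in LHS](addn1 k.+1) iotaD filter_cat all_cat /= add0n.
by case: (prime k.+1); rewrite /= ?andbT.
Qed.

Lemma rough0 n : rough 0 n. Proof. by []. Qed.

Lemma rough1 k : rough k 1.
Proof. by apply/allP => p; rewrite mem_filter => /andP[/prime_gt1]; case: p => [|[]]. Qed.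

Lemma rough_mul k p n : prime p -> (k < p)%N -> rough k (p * n) = rough k n.
Proof.
move=> pp kp; apply: eq_in_all => l; rewrite mem_filter mem_iota add0n ltnS => /and3P[pl _ lk].
rewrite Euclid_dvdM // (dvdn_prime2 pl pp); case: eqP => // e.
by move: kp; rewrite -e ltnNge lk.
Qed.

Lemma rough_gt k n : rough k n -> (1 < n)%N -> (k < n)%N.
Proof.
move=> /allP h n1; rewrite ltnNge; apply/negP => nk.
have /h : pdiv n \in [seq p <- iota 0 k.+1 | prime p]; last by rewrite pdiv_dvd.
rewrite mem_filter pdiv_prime // mem_iota add0n ltnS.
by rewrite (leq_trans _ nk) // dvdn_leq ?pdiv_dvd // ltnW.
Qed.

Definition small (u : nat -> K) :=
  forall d, 0 < d -> exists M0, forall M, (M0 <= M)%N -> `|u M| <= d.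

Lemma smallD u v : small u -> small v -> small (fun M => u M + v M).
Proof.
move=> hu hv d d0; have d2 : 0 < d / 2 by rewrite divr_gt0.
have [M1 h1] := hu _ d2; have [M2 h2] := hv _ d2.
exists (maxn M1 M2) => M; rewrite geq_max => /andP[a b].
by rewrite [d]splitr (le_trans (ler_normD _ _)) // lerD ?h1 ?h2.
Qed.

Lemma smallZ a u : small u -> small (fun M => a * u M).
Proof.
move=> hu d d0; have a1 : 0 < 1 + `|a| by rewrite ltr_pwDl.
have [M1 h1] := hu _ (divr_gt0 d0 a1).
exists M1 => M /h1 h; rewrite normrM.
apply: le_trans (_ : `|a| * (d / (1 + `|a|)) <= _); first by rewrite ler_wpM2l.
by rewrite mulrCA ger_pMr // ler_pdivrMr // mul1r lerDr.
Qed.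

Section OneSeries.
Variables (c w : nat -> K).
Hypotheses (cM : forall a b, c (a * b)%N = c a * c b) (c1 : c 1%N = 1).
Hypothesis cw : forall n, (0 < n)%N -> `|c n| <= w n.
Hypothesis w_ge0 : forall n, 0 <= w n.
Hypothesis w_tail : forall d, 0 < d -> exists N, forall M, \sum_(N <= n < M) w n <= d.

Definition rough_sum k M := \sum_(1 <= n < M.+1 | rough k n) c n.
Definition euler k := \prod_(0 <= p < k.+1 | prime p) (1 - c p).

(** One sieve step: the k-rough multiples of the prime [k.+1] are its products with the k-rough
    numbers, and [c] is multiplicative. *)
Lemma rough_sumS k M : prime k.+1 ->
  rough_sum k.+1 M = rough_sum k M - c k.+1 * rough_sum k (M %/ k.+1).
Proof.
move=> pk; rewrite /rough_sum [X in X - _](bigID (fun n => (k.+1 %| n)%N)) /= big_multiples //.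
have -> : c k.+1 * (\sum_(1 <= n < (M %/ k.+1).+1 | rough k n) c n) =
    \sum_(1 <= n < (M %/ k.+1).+1 | rough k (k.+1 * n)) c (k.+1 * n)%N.
  rewrite mulr_sumr; apply: eq_big => [n|n _]; first by rewrite rough_mul.
  by rewrite cM.
by rewrite addrAC subrr add0r; apply: eq_bigl => n; rewrite roughS pk.
Qed.

Lemma norm_rough_sum k (m M : nat) : (0 < m)%N ->
  `|\sum_(m <= n < M | rough k n) c n| <= \sum_(m <= n < M) w n.
Proof.
move=> m0; apply: le_trans (ler_norm_sum _ _ _) _.
rewrite big_mkcond big_nat [in leRHS]big_nat; apply: ler_sum => n /andP[mn _].
have n0 : (0 < n)%N by apply: leq_trans mn.
by case: ifP => _; rewrite ?cw ?normr0.
Qed.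

Lemma small_tail k p : (0 < p)%N -> small (fun M => rough_sum k M - rough_sum k (M %/ p)).
Proof.
move=> p0 d d0; have [N hN] := w_tail d0.
exists (p * N)%N => M hM.
have h1 : (N <= M %/ p)%N by rewrite leq_divRL // mulnC.
have h2 : (M %/ p <= M)%N by exact: leq_div.
rewrite /rough_sum (@big_cat_nat _ _ _ (M %/ p).+1 1 M.+1) //= addrAC subrr add0r.
apply: le_trans (norm_rough_sum _ _ _) _ => //.
apply: le_trans (hN M.+1).
rewrite [leRHS](@big_cat_nat _ _ _ (M %/ p).+1) //= ?lerDr ?sumr_ge0 //.
by rewrite ltnW.
Qed.

(** The Euler product without infinite sums: sieving by the primes up to [k] multiplies partial sums
    by [euler k], up to the discrepancy between the bounds [M] and [M %/ p], which is controlled by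
    a tail of [w]. *)
Lemma small_rough_sum k : small (fun M => rough_sum k M - euler k * rough_sum 0 M).
Proof.
elim: k => [|k IH].
  move=> d d0; exists 0%N => M _; rewrite /euler big_mkcond big_nat1 /= mul1r subrr normr0.
  exact: ltW.
have eS : euler k.+1 = euler k * (if prime k.+1 then 1 - c k.+1 else 1).
  by rewrite /euler [LHS]big_mkcond big_nat_recr //= -big_mkcond.
case: (boolP (prime k.+1)) eS => pk -> ; last first.
  move=> d d0; have [M0 h] := IH d d0; exists M0 => M /h.
  have -> : rough_sum k.+1 M = rough_sum k M.
    by apply: eq_bigl => n; rewrite roughS (negbTE pk) andbT.
  by rewrite mulr1.
have h := smallD (smallZ (1 - c k.+1) IH) (smallZ (c k.+1) (@small_tail k k.+1 isT)).
move=> d /h [M0 hM]; exists M0 => M /hM; rewrite rough_sumS //.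
by congr (`|_| <= _); ring.
Qed.

(** Apart from 1, rough numbers exceed [k], so what remains is dominated by a tail of [w]. *)
Lemma rough_sum_near1 d : 0 < d -> exists k0, forall k M, (k0 <= k)%N -> (0 < M)%N -> `|rough_sum k M - 1| <= d.
Proof.
move=> d0; have [N hN] := w_tail d0; exists N => k M kN M0.
rewrite /rough_sum big_mkcond big_ltn // rough1 c1 addrAC subrr add0r.
have [Mk|kM] := leqP M.+1 k.+1.
  rewrite big_nat big1 ?normr0 ?ltW // => n /andP[n2 nM]; case: ifP => // /rough_gt -/(_ n2) kn.
  by move: (leq_trans nM Mk); rewrite ltnS leqNgt kn.
apply: le_trans (ler_norm_sum _ _ _) _; apply: le_trans (hN M.+1).
apply: le_trans (_ : \sum_(k.+1 <= n < M.+1) w n <= _); last first.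
  rewrite [leRHS](@big_cat_nat _ _ _ k.+1) //=; last exact: ltnW kM.
    by rewrite lerDr sumr_ge0.
  exact: leqW.
have [k0|k0] := posnP k.
  rewrite k0 [leRHS]big_ltn ?ltnS //; apply: ler_wpDl => //.
  by apply: ler_sum_nat => n /andP[n2 _]; rewrite [rough 0 n]rough0 cw // ltnW.
rewrite (@big_cat_nat _ _ _ k.+1) //=; last exact: ltnW.
rewrite big_nat big1 ?add0r; last first.
  move=> n /andP[n2 nk]; case: ifP; rewrite ?normr0 // => /rough_gt -/(_ n2).
  by rewrite ltnNge -ltnS nk.
rewrite big_nat [leRHS]big_nat; apply: ler_sum => n /andP[n2 _]; case: ifP; rewrite ?normr0 // cw //.
exact: leq_trans n2.
Qed.

Lemma euler_mul_near1 d : 0 < d -> exists k0, forall k, (k0 <= k)%N ->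
  exists M0, forall M, (M0 <= M)%N -> 1 - d <= `|euler k| * `|\sum_(1 <= n < M.+1) c n|.
Proof.
move=> d0; have d2 : 0 < d / 2 by rewrite divr_gt0.
have [k0 hk] := rough_sum_near1 d2; exists k0 => k kk.
have [M0 hM] := @small_rough_sum k _ d2; exists M0.+1 => M MM.
have := hk k M kk (leq_ltn_trans (leq0n _) MM); have := hM M (ltnW MM).
have -> : rough_sum 0 M = \sum_(1 <= n < M.+1) c n by apply: eq_bigl => n; rewrite rough0.
rewrite -normrM; set X := euler k * _; set D := rough_sum k M => h1 h2.
have : `|1 - X| <= d.
  rewrite [d]splitr (_ : 1 - X = (D - X) - (D - 1)); last by ring.
  by apply: le_trans (ler_normB _ _) _; rewrite lerD.
move=> h3; rewrite lerBlDr -lerBlDl.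
by apply: le_trans h3; rewrite -{1}[1]normr1 lerB_dist.
Qed.

End OneSeries.

(** Each finite Euler product times the corresponding partial sum is close to 1, whereas the Euler
    factors of the whole family multiply to at most 1. *)
Lemma euler_family_lower f (c : 'I_f -> nat -> K) (w : nat -> K) :
  (forall j a b, c j (a * b)%N = c j a * c j b) -> (forall j, c j 1%N = 1) ->
  (forall j n, (0 < n)%N -> `|c j n| <= w n) -> (forall n, 0 <= w n) ->
  (forall d, 0 < d -> exists N, forall M, \sum_(N <= n < M) w n <= d) ->
  (forall p, prime p -> \prod_j `|1 - c j p| <= 1) ->
  exists M0, forall M, (M0 <= M)%N -> 2^-1 <= \prod_j `|\sum_(1 <= n < M.+1) c j n|.
Proof.
(* With [d = 1 / (2 (f + 1))], Bernoulli's inequality gives [(1 - d) ^ f >= 1 - f d >= 1 / 2]. *)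
move=> cM c1 cw w0 wt hp; pose d : K := (f.+1.*2)%:R^-1.
have d0 : 0 < d by rewrite invr_gt0 ltr0n.
have /boolp.choice[k0 hk0] j := euler_mul_near1 (cM j) (c1 j) (cw j) w0 wt d0.
pose k := (\max_j k0 j)%N.
have /boolp.choice[M0 hM0] j := hk0 j k (leq_bigmax j).
exists (\max_j M0 j)%N => M hM.
have h j : 1 - d <= `|euler (c j) k| * `|\sum_(1 <= n < M.+1) c j n|.
  by apply: hM0; apply: leq_trans hM; exact: leq_bigmax.
have E1 : \prod_j `|euler (c j) k| <= 1.
  under eq_bigr => j _ do rewrite /euler normr_prod.
  rewrite exchange_big /=; apply: prodr_ile1 => p pp.
  by rewrite hp // prodr_ge0.
have d1 : 0 <= 1 - d by rewrite subr_ge0 invf_le1 ?ltr0n // ler1n.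
apply: le_trans (_ : (1 - d) ^+ f <= _).
  have : 1 - f%:R * d <= (1 - d) ^+ f.
    elim: (f) => [|i IH]; first by rewrite mul0r subr0 expr0.
    rewrite exprSr; apply: le_trans (ler_wpM2r d1 IH).
    rewrite -subr_ge0 -natr1 (_ : _ - _ = i%:R * d ^+ 2); last by ring.
    by rewrite mulr_ge0 ?ler0n ?exprn_ge0 // ltW.
  apply: le_trans; rewrite lerBrDr -lerBrDl.
  rewrite /d -[leRHS](_ : 2^-1 = _); last by field.
  rewrite ler_pdivrMr ?ltr0n // -muln2 natrM mulrCA mulVf ?mulr1 ?pnatr_eq0 //.
  by rewrite ler_nat.
apply: le_trans (_ : \prod_j (`|euler (c j) k| * `|\sum_(1 <= n < M.+1) c j n|) <= _).
  rewrite -{1}[f]card_ord -prodr_const; apply: ler_prod => j _.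
  by rewrite d1 h.
rewrite big_split /=; apply: ler_piMl => //.
exact: prodr_ge0.
Qed.

End Sieve.

(** * Summation by parts *)

Section Abel.
Variable K : numFieldType.
Implicit Types (a b : nat -> K).

Lemma abel_summation a b M :
  \sum_(1 <= n < M.+1) a n * b n = (\sum_(1 <= n < M.+1) a n) * b M +
    \sum_(1 <= n < M) (\sum_(1 <= m < n.+1) a m) * (b n - b n.+1).
Proof.
elim: M => [|M IH]; first by rewrite !big_geq // mul0r addr0.
rewrite big_nat_recr //= IH; case: M {IH} => [|M]; first by rewrite !big_nat1 !big_geq //; ring.
rewrite [\sum_(1 <= n < M.+2) _ * (_ - _)]big_nat_recr //= [\sum_(1 <= n < M.+3) a n]big_nat_recr //=.
by ring.
Qed.

Lemma abel_bound_decr a b Q M : (forall n, `|\sum_(1 <= m < n.+1) a m| <= Q) ->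
  (forall n, 0 <= b n.+1) -> (forall n, (0 < n)%N -> b n.+1 <= b n) ->
  `|\sum_(1 <= n < M.+1) a n * b n| <= Q * b 1%N.
Proof.
move=> hQ b0 hb; have Q0 : 0 <= Q by apply: le_trans (hQ 0%N).
case: M => [|M]; first by rewrite big_geq // normr0 mulr_ge0.
rewrite abel_summation; apply: le_trans (ler_normD _ _) _.
apply: le_trans (_ : Q * b M.+1 + \sum_(1 <= n < M.+1) Q * (b n - b n.+1) <= _).
  apply: lerD; first by rewrite normrM (ger0_norm (b0 _)) ler_wpM2r.
  apply: le_trans (ler_norm_sum _ _ _) _; apply: ler_sum_nat => n /andP[n0 _].
  by rewrite normrM [X in _ * X]ger0_norm ?subr_ge0 ?hb // ler_wpM2r ?subr_ge0 ?hb.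
rewrite -mulr_sumr -mulrDr ler_wpM2l //.
under eq_bigr => n _ do rewrite -opprB.
by rewrite sumrN telescope_sumr // opprB addrC subrK.
Qed.

Lemma sum_inv_squares M : \sum_(1 <= n < M.+2) (n%:R^-1 ^+ 2 : K) <= 2 - (M.+1)%:R^-1.
Proof.
elim: M => [|M IH]; first by rewrite big_nat1 invr1 expr1n lerBrDr; exact: lexx.
rewrite big_nat_recr //=; apply: le_trans (lerD IH (lexx _)) _.
rewrite -subr_ge0; set x : K := M.+1%:R; have -> : M.+2%:R = x + 1 by rewrite /x natr1.
have x0 : 0 < x by rewrite ltr0n.
have x1 : 0 < x + 1 by rewrite addr_gt0.
have -> : 2 - (x + 1)^-1 - (2 - x^-1 + (x + 1)^-1 ^+ 2) = (x * (x + 1) ^+ 2)^-1.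
  by field; rewrite !gt_eqF.
by rewrite invr_ge0 mulr_ge0 ?exprn_ge0 ?ltW.
Qed.

(** Meant for a series with sum zero and partial sums [O(1 / n)]: slowly varying weights then yield
    [O(e)] up to the boundary term [C / M]. The factor 2 bounds the sum of the [1 / n^2]. *)
Lemma abel_bound_smallsum a b C e M : 0 <= C -> 0 <= e -> (0 < M)%N ->
  (forall n, (0 < n)%N -> `|\sum_(1 <= m < n.+1) a m| <= C / n%:R) ->
  (forall n, 0 <= b n.+1 <= 1) -> (forall n, (0 < n)%N -> 0 <= b n - b n.+1 <= e / n%:R) ->
  `|\sum_(1 <= n < M.+1) a n * b n| <= C / M%:R + 2 * C * e.
Proof.
move=> C0 e0; case: M => // M _ ha hb hd; rewrite abel_summation.
apply: le_trans (ler_normD _ _) _; apply: lerD.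
  have /andP[b0 b1] := hb M.
  by rewrite normrM (ger0_norm b0); apply: le_trans (ler_pM _ _ (ha M.+1 isT) b1) _; rewrite ?mulr1.
have h n : (1 <= n < M.+1)%N -> `|(\sum_(1 <= m < n.+1) a m) * (b n - b n.+1)| <= C * e * n%:R^-1 ^+ 2.
  move=> /andP[n0 _]; have /andP[d0 d1] := hd n n0.
  rewrite normrM (ger0_norm d0); apply: le_trans (ler_pM _ _ (ha n n0) d1) _ => //.
  by rewrite expr2 mulrACA.
apply: le_trans (ler_norm_sum _ _ _) _; apply: le_trans (ler_sum_nat h) _.
rewrite -mulr_sumr -[2 * C * e]mulrA mulrC ler_wpM2r ?mulr_ge0 //.
case: (M) => [|k]; first by rewrite big_geq.
by apply: le_trans (sum_inv_squares k) _; rewrite gerDl oppr_le0 invr_ge0.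
Qed.

End Abel.

(** * The weights n^(-1-e) and their tails *)

Section Weights.
Variable R : realType.
Variable e : R.
Hypotheses (e_gt0 : 0 < e).

(* [vwt n] is [n ^ (- e)]. *)
Definition vwt (n : nat) : R := expR (- (e * ln n%:R)).
Definition wt (n : nat) : R := if n is 0 then 0 else vwt n / n%:R.

Lemma vwt_gt0 n : 0 < vwt n. Proof. exact: expR_gt0. Qed.
Lemma vwt1 : vwt 1 = 1. Proof. by rewrite /vwt ln1 mulr0 oppr0 expR0. Qed.

Lemma wtE n : (0 < n)%N -> wt n = vwt n / n%:R. Proof. by case: n. Qed.

Lemma wt_ge0 n : 0 <= wt n.
Proof. by case: n => // n; rewrite divr_ge0 // ltW // vwt_gt0. Qed.

Lemma wt1 : wt 1 = 1. Proof. by rewrite wtE // vwt1 divr1. Qed.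

Lemma vwtM a b : (0 < a)%N -> (0 < b)%N -> vwt (a * b) = vwt a * vwt b.
Proof.
move=> a0 b0; rewrite /vwt natrM lnM ?posrE ?ltr0n // -expRD; congr expR; ring.
Qed.

Lemma wtM a b : wt (a * b) = wt a * wt b.
Proof.
have [->|a0] := posnP a; first by rewrite mul0n mul0r.
have [->|b0] := posnP b; first by rewrite muln0 mulr0.
rewrite !wtE // ?muln_gt0 ?a0 // vwtM // natrM.
by field; rewrite !pnatr_eq0 -!lt0n a0 b0.
Qed.

Lemma vwt_step n : (0 < n)%N -> vwt n.+1 = vwt n * expR (- (e * ln (1 + n%:R^-1))).
Proof.
move=> n0; rewrite /vwt -expRD; congr expR.
have n0' : 0 < n%:R :> R by rewrite ltr0n.
have -> : n.+1%:R = n%:R * (1 + n%:R^-1) :> R by rewrite mulrDr mulr1 divff ?gt_eqF // natr1.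
by rewrite lnM ?posrE // ?addr_gt0 ?invr_gt0 //; ring.
Qed.

Lemma vwt_diff_le n : (0 < n)%N -> vwt n - vwt n.+1 <= e / n%:R.
Proof.
move=> n0; rewrite vwt_step // -{1}[vwt n]mulr1 -mulrBr.
have n0' : 0 < n%:R :> R by rewrite ltr0n.
have h1 : ln (1 + n%:R^-1) <= n%:R^-1 :> R by apply: le_ln1Dx; rewrite (lt_trans _ (_ : 0 < _)) ?invr_gt0 // ltrN10.
have h2 := expR_ge1Dx (- (e * ln (1 + n%:R^-1))).
have v1 : vwt n <= 1.
  by rewrite -expR0 ler_expR oppr_le0 mulr_ge0 ?(ltW e_gt0) ?ln_ge0 ?ler1n.
apply: le_trans (_ : vwt n * (e * ln (1 + n%:R^-1)) <= _).
  by rewrite ler_wpM2l ?(ltW (vwt_gt0 _)) // lerBlDr -lerBlDl.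
have l0 : 0 <= ln (1 + n%:R^-1) :> R by rewrite ln_ge0 // lerDl invr_ge0.
apply: le_trans (_ : 1 * (e * ln (1 + n%:R^-1)) <= _).
  by rewrite ler_wpM2r // mulr_ge0 // ltW.
by rewrite mul1r ler_wpM2l // ltW.
Qed.

(** A telescoping form of the comparison of the sum of the [n ^ (-1-e)] with an integral. The factor
    [e] is what bounds the total by [1 + 1 / e], that is, by a simple pole. *)
Lemma wt_le_vwt_diff n : (0 < n)%N -> e * wt n.+1 <= vwt n - vwt n.+1.
Proof.
move=> n0; rewrite wtE //.
have n0' : 0 < n%:R :> R by rewrite ltr0n.
have n1' : 0 < n.+1%:R :> R by rewrite ltr0n.
have -> : vwt n = vwt n.+1 * expR (e * ln (1 + n%:R^-1)).
  by rewrite vwt_step // -mulrA -expRD addNr expR0 mulr1.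
have h : n.+1%:R^-1 <= ln (1 + n%:R^-1) :> R.
  have p0 : 0 < 1 + n%:R^-1 :> R by rewrite addr_gt0 // invr_gt0.
  have := @le_ln1Dx R (- n.+1%:R^-1).
  have -> : 1 + - n.+1%:R^-1 = (1 + n%:R^-1)^-1 :> R.
    by rewrite -natr1; field; rewrite natr1 !gt_eqF // addr_gt0.
  rewrite lnV ?posrE // lerN2; apply.
  by rewrite ltrN2 invf_lt1 // ltr1n.
have h2 := expR_ge1Dx (e * ln (1 + n%:R^-1)).
have := vwt_gt0 n.+1; set V := vwt n.+1 => V0.
rewrite -[X in _ - X]mulr1 -mulrBr mulrCA ler_wpM2l ?(ltW V0) //.
have : e / n.+1%:R <= e * ln (1 + n%:R^-1) by rewrite ler_wpM2l // ltW.
by move=> h3; rewrite lerBrDl; apply: le_trans h2; rewrite lerD2l.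
Qed.

Lemma wt_sum_le N M : (0 < N)%N -> \sum_(N.+1 <= n < M) wt n <= vwt N / e.
Proof.
move=> N0; rewrite ler_pdivlMr // mulr_suml.
have [MN|NM] := leqP M N.+1; first by rewrite big_geq // ltW // vwt_gt0.
case: M NM => // M; rewrite ltnS => NM.
rewrite big_add1 /=; apply: le_trans (_ : \sum_(N <= n < M) (vwt n - vwt n.+1) <= _).
  apply: ler_sum_nat => n /andP[nN _]; rewrite mulrC wt_le_vwt_diff //.
  exact: leq_trans nN.
under eq_bigr => n _ do rewrite -opprB.
by rewrite sumrN (telescope_sumr vwt (ltnW NM)) opprB gerDl oppr_le0 (ltW (vwt_gt0 _)).
Qed.

Lemma vwt_small d : 0 < d -> exists N, vwt N.+1 <= d.
Proof.
move=> d0; exists (Num.Def.truncn (expR (- (ln d / e)))).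
rewrite /vwt -[leRHS]lnK ?posrE // ler_expR lerNl.
rewrite mulrC -ler_pdivrMr // -mulNr -[leLHS]expRK ler_ln ?posrE ?expR_gt0 ?ltr0n //.
by rewrite mulNr ltW // truncnS_gt.
Qed.

Lemma wt_tail d : 0 < d -> exists N, forall M, \sum_(N <= n < M) wt n <= d.
Proof.
move=> d0; have [N hN] := vwt_small (mulr_gt0 d0 e_gt0).
exists N.+2 => M; apply: le_trans (wt_sum_le _ _) _ => //.
by rewrite ler_pdivrMr.
Qed.

Lemma wt_sum_total M : \sum_(1 <= n < M) wt n <= 1 + e^-1.
Proof.
have [M1|M1] := leqP M 1; first by rewrite big_geq // addr_ge0 // invr_ge0 ltW.
by rewrite big_ltn // wt1 lerD2l -[e^-1]mul1r -vwt1 wt_sum_le.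
Qed.

End Weights.

(** * Partial sums of the Fourier series of a square wave *)

Section SquareWave.
Variable R : realType.

Definition sqwave N (x : R) : R := \sum_(k < N) sin ((k.*2.+1)%:R * x) / (k.*2.+1)%:R.

Lemma is_rder_lin (a t : R) : is_derive t (1 : R) (fun s : R => a * s) a.
Proof.
apply: (is_derive_eq (is_rderM (is_derive_cst a t 1) (is_derive_id t 1))).
by rewrite mul0r add0r mulr1.
Qed.

Lemma is_rder_sin_lin (a t : R) : is_derive t (1 : R) (fun s : R => sin (a * s)) (cos (a * t) * a).
Proof.
have hl := is_rder_lin a t.
exact: (is_derive1_comp (f := sin) (g := fun s => a * s)).
Qed.

Lemma is_rder_cos_lin (a t : R) : is_derive t (1 : R) (fun s : R => cos (a * s)) (- sin (a * t) * a).
Proof.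
have hl := is_rder_lin a t.
exact: (is_derive1_comp (f := cos) (g := fun s => a * s)).
Qed.

Lemma is_rder_sqwave N (t : R) : is_derive t (1 : R) (sqwave N) (\sum_(k < N) cos ((k.*2.+1)%:R * t)).
Proof.
elim: N => [|N IH].
  rewrite big_ord0 (_ : sqwave 0 = cst 0); first exact: is_derive_cst.
  by apply/funext => x; rewrite /sqwave big_ord0.
rewrite (_ : sqwave N.+1 = fun x => sqwave N x + sin ((N.*2.+1)%:R * x) * (N.*2.+1)%:R^-1); last first.
  by apply/funext => x; rewrite /sqwave big_ord_recr.
rewrite big_ord_recr /=; apply: is_rderD => //.
apply: (is_derive_eq (is_rderM (is_rder_sin_lin _ t) (is_derive_cst _ t 1))).
by rewrite mulr0 addr0 mulfK // pnatr_eq0.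
Qed.

Lemma sum_cos_odd N (t : R) : 2 * sin t * (\sum_(k < N) cos ((k.*2.+1)%:R * t)) = sin ((N.*2)%:R * t).
Proof.
elim: N => [|N IH]; first by rewrite big_ord0 mulr0 mul0r sin0.
rewrite big_ord_recr /= mulrDr IH.
have -> : (N.+1.*2)%:R * t = (N.*2.+1)%:R * t + t by rewrite doubleS -[(N.*2.+2)%:R]natr1; ring.
have -> : (N.*2)%:R * t = (N.*2.+1)%:R * t - t by rewrite -[(N.*2.+1)%:R]natr1; ring.
by rewrite sinB sinD; ring.
Qed.

(* [sqwave N] is the partial sum of a Fourier series that is constant on
   ]0, pi[; adding [cos (2Nx) / (4N sin x)] makes its derivative O(1/N). *)
Lemma sqwave_almost_cst (d : R) : 0 < d -> exists2 c : R, 0 <= c & forall N x y, (0 < N)%N ->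
  x \in `[d, pi - d]%R -> y \in `[d, pi - d]%R -> `|sqwave N x - sqwave N y| <= c / N%:R.
Proof.
move=> d0; have [hd|hd] := leP d (pi - d); last first.
  exists 0 => // N x y _; rewrite in_itv /= => /andP[h1 h2].
  by have := le_trans h1 h2; rewrite leNgt hd.
have cs : {within `[d, pi - d], continuous (@sin R)} by apply: continuous_subspaceT; exact: continuous_sin.
have [z zI zmin] := EVT_min hd cs.
have s0 : 0 < sin z.
  apply: sin_gt0_pi; move: zI; rewrite in_itv /= => /andP[h1 h2].
  by apply/andP; split; lra.
set s := sin z in s0 zmin.
exists (s^-1 / 2 + s^-1 ^+ 2 * pi / 4).
  by rewrite addr_ge0 ?mulr_ge0 ?invr_ge0 ?exprn_ge0 ?invr_ge0 ?pi_ge0 // ltW.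
move=> N x y N0; wlog xy : x y / x <= y.
  move=> H xI yI; have [xy|yx] := leP x y; first exact: H.
  by rewrite distrC; apply: H => //; exact: ltW.
move=> xI yI; have N0' : 0 < N%:R :> R by rewrite ltr0n.
have sub t : t \in `[x, y]%R -> t \in `[d, pi - d]%R.
  move: xI yI; rewrite !in_itv /= => /andP[x1 x2] /andP[y1 y2] /andP[t1 t2].
  by apply/andP; split; lra.
have sin_pos t : t \in `[x, y]%R -> s <= sin t by move=> /sub/zmin.
pose h t := sqwave N t + cos ((N.*2)%:R * t) * ((4 * N%:R)^-1 * (sin t)^-1).
pose dh t : R := - ((4 * N%:R)^-1 * (cos ((N.*2)%:R * t) * cos t) * (sin t)^-1 ^+ 2).
have hder t : t \in `[x, y]%R -> is_derive t (1 : R) h (dh t).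
  move=> tI; have st : sin t != 0 by rewrite gt_eqF // (lt_le_trans s0) // sin_pos.
  have h1 := is_rderV st (is_derive_sin t).
  have h2 := is_rderM (is_derive_cst ((4 * N%:R)^-1 : R) t 1) h1.
  apply: (is_derive_eq (is_rderD (is_rder_sqwave N t) (is_rderM (is_rder_cos_lin (N.*2)%:R t) h2))).
  have := sum_cos_odd N t; set X := \sum_(k < N) _ => hX.
  have -> : X = sin ((N.*2)%:R * t) / (2 * sin t) by rewrite -hX; field; rewrite st.
  rewrite /dh -muln2 natrM /= -exprVn; field.
  by rewrite st gt_eqF.
have hcont : {within `[x, y], continuous h}.
  by apply: derivable_within_continuous => t /hder htder; exact: ex_derive.
have hder' t : t \in `]x, y[%R -> is_derive t (1 : R) h (dh t).
  by move=> tI; apply: hder; move: tI; rewrite !in_itv /= => /andP[/ltW -> /ltW ->].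
have [t tI e] := MVT_segment xy hder' hcont.
have n0 : 0 < (4 * N%:R)^-1 :> R by rewrite invr_gt0 mulr_gt0.
have inv_le u : u \in `[x, y]%R -> 0 <= (sin u)^-1 <= s^-1.
  move=> /sin_pos su; have u0 := lt_le_trans s0 su.
  by rewrite invr_ge0 ltW //= lef_pV2 ?posrE.
have dh_le : `|dh t| <= (4 * N%:R)^-1 * s^-1 ^+ 2.
  have /andP[i0 i1] := inv_le t tI.
  rewrite /dh normrN normrM [X in X * _ <= _]normrM [`|cos _ * _|]normrM normrX (gtr0_norm n0) (ger0_norm i0) -mulrA ler_wpM2l ?(ltW n0) //.
  apply: le_trans (_ : 1 * (sin t)^-1 ^+ 2 <= _).
    by rewrite ler_wpM2r ?exprn_ge0 // mulr_ile1 ?cos_max.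
  by rewrite mul1r !expr2 (ler_pM i0 i0 i1 i1).
have corr_le u : u \in `[x, y]%R -> `|cos ((N.*2)%:R * u) * ((4 * N%:R)^-1 * (sin u)^-1)| <= (4 * N%:R)^-1 * s^-1.
  move=> /inv_le /andP[i0 i1].
  rewrite !normrM (gtr0_norm n0) (ger0_norm i0).
  apply: le_trans (_ : 1 * ((4 * N%:R)^-1 * (sin u)^-1) <= _).
    by rewrite ler_wpM2r ?cos_max // mulr_ge0 // ltW.
  by rewrite mul1r ler_wpM2l // ltW.
have xx : x \in `[x, y]%R by rewrite in_itv /= lexx.
have yy : y \in `[x, y]%R by rewrite in_itv /= lexx xy.
have yx : 0 <= y - x <= pi.
  move: xI yI; rewrite !in_itv /= => /andP[x1 x2] /andP[y1 y2].
  by apply/andP; split; lra.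
have /andP[yx0 yx1] := yx.
have -> : sqwave N x - sqwave N y = - (h y - h x) +
    (cos ((N.*2)%:R * y) * ((4 * N%:R)^-1 * (sin y)^-1) - cos ((N.*2)%:R * x) * ((4 * N%:R)^-1 * (sin x)^-1)).
  by rewrite /h; ring.
rewrite e; apply: le_trans (ler_normD _ _) _.
apply: le_trans (_ : (4 * N%:R)^-1 * s^-1 ^+ 2 * pi + ((4 * N%:R)^-1 * s^-1 + (4 * N%:R)^-1 * s^-1) <= _).
  apply: lerD; last by apply: le_trans (ler_normB _ _) _; rewrite lerD ?corr_le.
  by rewrite normrN normrM (ger0_norm yx0) ler_pM.
by rewrite le_eqVlt; apply/orP; left; apply/eqP; field; rewrite !gt_eqF.
Qed.

End SquareWave.

Lemma eqn_modMl_coprime d u a b : coprime u d -> (u * a == u * b %[mod d])%N = (a == b %[mod d])%N.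
Proof.
move=> ud; wlog ab : a b / (a <= b)%N.
  by move=> H; case/orP: (leq_total a b) => /H // h; rewrite eq_sym h eq_sym.
rewrite eq_sym [RHS]eq_sym !eqn_mod_dvd ?leq_mul2l ?ab ?orbT // -mulnBr Gauss_dvdr //.
by rewrite coprime_sym.
Qed.

Lemma sum_mod_mul (V : nmodType) d u (F : nat -> V) : (0 < d)%N -> coprime u d ->
  (forall a b, a = b %[mod d] -> F a = F b) -> \sum_(a < d) F (u * a)%N = \sum_(a < d) F a.
Proof.
case: d => // d _ ud hF.
pose f (a : 'I_d.+1) : 'I_d.+1 := inord (u * a %% d.+1).
have fE a : f a = (u * a %% d.+1)%N :> nat by rewrite inordK // ltn_pmod.
have finj : injective f.
  move=> a b /(congr1 (@nat_of_ord _)); rewrite !fE => /eqP.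
  by rewrite eqn_modMl_coprime // !modn_small // => /eqP/val_inj.
rewrite [RHS](reindex_inj finj); apply: eq_bigr => a _.
by apply: hF; rewrite fE modn_mod.
Qed.

Lemma coprime_sub a d : (a <= d)%N -> coprime (d - a) d = coprime a d.
Proof.
move=> ad; rewrite /coprime -{2 3}(subnK ad) gcdnDl gcdnDr gcdnC //.
Qed.

Lemma big_half (V : Type) (idx : V) (op : Monoid.com_law idx) d (h : nat -> V) :
  odd d -> (1 < d)%N -> (forall a, ~~ coprime a d -> h a = idx) ->
  \big[op/idx]_(a < d) h a = \big[op/idx]_(a <- halfunits d) op (h a) (h (d - a)%N).
Proof.
move=> od d1 h0; rewrite -(big_mkord xpredT) /halfunits big_filter.
set k := d./2; have dE : d = k.*2.+1 by rewrite -[LHS]odd_double_half od.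
have kd : (k <= d)%N by rewrite dE -addnn -addnS leq_addr.
have -> : \big[op/idx]_(a <- iota 0 k.+1 | coprime a d) op (h a) (h (d - a)%N) =
  \big[op/idx]_(0 <= a < k.+1) op (h a) (h (d - a)%N).
  rewrite /index_iota subn0 [LHS]big_mkcond big_seq [RHS]big_seq; apply: eq_bigr => a.
  rewrite mem_iota add0n ltnS => /andP[_ ad]; case: ifP => // /negbT hc.
  have ad' : (a <= d)%N by apply: leq_trans ad _.
  by rewrite !h0 ?Monoid.mulm1 // coprime_sub.
rewrite big_split /= [X in op _ X]big_nat_recl // subn0 h0 ?Monoid.mul1m; last first.
  by rewrite /coprime gcdnn gtn_eqF.
rewrite (@big_cat_nat _ _ _ k.+1) //=; last by rewrite dE ltnS -addnn leq_addr.
congr (op _ _); rewrite -[X in \big[_/_]_(X <= _ < _) _]add0n big_addn.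
have -> : (d - k.+1 = k)%N by rewrite {1}dE subSS -addnn addnK.
rewrite big_nat_rev /= big_nat [RHS]big_nat; apply: eq_bigr => a /andP[_ ak].
congr h; rewrite dE; lia.
Qed.

Lemma sum_periodic (V : nmodType) D (F : nat -> V) : (0 < D)%N ->
  (forall a b, a = b %[mod D] -> F a = F b) -> \sum_(a < D) F a = 0 ->
  forall n, \sum_(0 <= a < n) F a = \sum_(0 <= a < n %% D) F a.
Proof.
move=> D0 hF hz n; rewrite {1}(divn_eq n D); elim: (n %/ D)%N => [|q IH]; first by rewrite mul0n add0n.
rewrite mulSn -addnA (@big_cat_nat _ _ _ D) //=; last exact: leq_addr.
rewrite big_mkord hz add0r -[X in \big[_/_]_(X <= _ < _) _]add0n big_addn addKn -IH.
by apply: eq_bigr => a _; apply: hF; rewrite modnDr.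
Qed.

Lemma sum_odd_terms (V : nmodType) (F : nat -> V) n :
  \sum_(1 <= m < n.+1) (if odd m then F m else 0) = \sum_(k < uphalf n) F k.*2.+1.
Proof.
elim: n => [|n IH]; first by rewrite big_geq // big_ord0.
rewrite big_nat_recr //= IH uphalf_half; case: ifP => on; last by rewrite addr0 (negbFE on).
by rewrite (negbTE on) add0n big_ord_recr /= -[X in F X.+1](odd_double_half n) (negbTE on).
Qed.

Lemma prod_root_factors (K : fieldType) h (z T : K) : h.-primitive_root z -> T != 0 ->
  \prod_(j < h) (1 - z ^+ j * T) = 1 - T ^+ h.
Proof.
move=> hz T0; have := congr1 (fun P => P.[T^-1]) (factor_Xn_sub_1 hz).
rewrite horner_prod hornerD hornerN hornerXn hornerC big_mkord => e.
have -> : 1 - T ^+ h = T ^+ h * (T^-1 ^+ h - 1).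
  by rewrite mulrBr mulr1 -exprMn mulfV // expr1n.
rewrite -e -[X in T ^+ X * _]card_ord -prodr_const -big_split; apply: eq_bigr => j _ /=.
by rewrite hornerXsubC mulrBr mulfV // mulrC.
Qed.

(** With [h] the exact order of [z], the product without absolute values is
    [(1 - T ^ h) ^ (f / h)]. *)
Lemma prod_unity_factors (K : numFieldType) f (z T : K) : (0 < f)%N -> z ^+ f = 1 ->
  0 < T -> T <= 1 -> \prod_(j < f) `|1 - z ^+ j * T| <= 1.
Proof.
move=> f0 zf T0 T1; have [h hz /dvdnP[e fE]] := prim_order_exists f0 zf.
rewrite -normr_prod fE -(big_mkord xpredT (fun j => 1 - z ^+ j * T)).
have -> : \prod_(0 <= j < e * h) (1 - z ^+ j * T) = (1 - T ^+ h) ^+ e.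
  elim: e {fE} => [|e IH]; first by rewrite mul0n big_geq.
  rewrite mulSn (@big_cat_nat _ _ _ h) //=; last exact: leq_addr.
  rewrite exprS -IH big_mkord prod_root_factors ?gt_eqF //; congr (_ * _).
  rewrite -[X in \big[_/_]_(X <= _ < _) _]add0n big_addn addKn.
  by apply: eq_bigr => j _; rewrite exprD (prim_expr_order hz) mulr1.
have Th : 0 <= T ^+ h <= 1 by rewrite exprn_ge0 ?exprn_ile1 // ltW.
have /andP[Th0 Th1] := Th.
by rewrite normrX exprn_ile1 // ger0_norm ?subr_ge0 // lerBlDr lerDl.
Qed.

Lemma prodr_le_exp (K : numFieldType) f (P : pred 'I_f) (F : 'I_f -> K) D : 1 <= D ->
  (forall j, P j -> 0 <= F j <= D) -> \prod_(j < f | P j) F j <= D ^+ f.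
Proof.
move=> D1 hF; rewrite big_mkcond -[X in D ^+ X]card_ord -prodr_const.
by apply: ler_prod => j _; case: ifP => [/hF|]; rewrite ?ler01.
Qed.

(** * An odd primitive character with vanishing half sum does not exist *)

Section OddCharacter.
Variable R : realType.
Local Notation C := R[i].
Local Notation Re := (@complex.Re R).
Local Notation Im := (@complex.Im R).
Variables (p i : nat).
Hypotheses (p_prime : prime p) (p_odd : odd p).
Local Notation d := (p ^ i.+1)%N.
Variable chi : nat -> C.
Hypotheses (chiM : forall a b, chi (a * b)%N = chi a * chi b) (chi1 : chi 1%N = 1).
Hypothesis chi0 : forall a, ~~ coprime a p -> chi a = 0.
Hypothesis chi_mod : forall a b, a = b %[mod d] -> chi a = chi b.
Hypothesis chi_odd : chi d.-1 = -1.
Hypothesis chi_prim : exists u, [/\ coprime u p, u = 1 %[mod p ^ i] & chi u != 1].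
Hypothesis chi_half : \sum_(a <- halfunits d) chi a = 0.
Local Notation om := (croot R d).

Let p_gt0 : (0 < p)%N := prime_gt0 p_prime.
Let d_gt0 : (0 < d)%N. Proof. by rewrite expn_gt0 p_gt0. Qed.
Let d_gt1 : (1 < d)%N. Proof. by rewrite -(exp1n i.+1) ltn_exp2r // prime_gt1. Qed.
Let d_odd : odd d. Proof. by rewrite oddX p_odd orbT. Qed.
Let om_prim : d.-primitive_root om := croot_prim R d_gt0.

Let coprime_d a : coprime a d = coprime a p. Proof. by rewrite coprime_pexpr. Qed.

Let om_mod a b : a = b %[mod d] -> om ^+ a = om ^+ b.
Proof. by move=> e; apply/eqP; rewrite (eq_prim_root_expr om_prim) e. Qed.

Lemma chiX a n : chi (a ^ n) = chi a ^+ n.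
Proof. by elim: n => [|n IH]; rewrite ?expn0 ?expr0 // expnS chiM IH exprS. Qed.

Lemma chi_totient a : coprime a p -> chi a ^+ totient d = 1.
Proof.
move=> ap; rewrite -chiX -chi1; apply: chi_mod.
by apply: Euler_exp_totient; rewrite coprime_d.
Qed.

Lemma totient_d_gt0 : (0 < totient d)%N. Proof. by rewrite totient_gt0. Qed.

Lemma chi_neq0 a : coprime a p -> chi a != 0.
Proof.
move=> /chi_totient h; apply/eqP => e; move: h; rewrite e expr0n gtn_eqF ?totient_d_gt0 //.
by move/eqP; rewrite eq_sym oner_eq0.
Qed.

Lemma chi_norm a : coprime a p -> `|chi a| = 1.
Proof.
move=> /chi_totient h; apply/eqP; rewrite -(@pexpr_eq1 _ _ (totient d)) ?totient_d_gt0 //.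
by rewrite -normrX h normr1.
Qed.

Lemma chi_opp a : (0 < a)%N -> (a < d)%N -> chi (d - a)%N = - chi a.
Proof.
move=> a0 ad; rewrite -mulN1r -chi_odd -chiM; apply: chi_mod; apply/eqP.
rewrite -(eqn_modDr a) subnK; last exact: ltnW.
by rewrite -mulSnr prednK // modnn modnMr.
Qed.

Definition gauss k : C := \sum_(a < d) chi a * om ^+ (a * k).

Lemma gauss_mul u k : coprime u p -> chi u * gauss (u * k) = gauss k.
Proof.
move=> up; rewrite /gauss mulr_sumr.
rewrite -[RHS](@sum_mod_mul _ d u (fun a => chi a * om ^+ (a * k))) ?coprime_d //.
  by apply: eq_bigr => a _; rewrite mulrA chiM mulnA [(a * u)%N]mulnC.
move=> a b ab; rewrite (chi_mod ab); congr (_ * _); apply: om_mod.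
by rewrite -modnMml ab modnMml.
Qed.

Lemma gauss_mod a b : a = b %[mod d] -> gauss a = gauss b.
Proof.
move=> ab; apply: eq_bigr => k _; congr (_ * _); apply: om_mod.
by rewrite -modnMmr ab modnMmr.
Qed.

(** For [k] prime to [p] this is a change of variable. Otherwise the unit [u] witnessing primitivity
    satisfies [u k = k] modulo [d] with [chi u != 1], which kills the Gauss sum, while the right
    side is 0 because [0^-1 = 0]. *)
Lemma gauss_inv k : gauss k = (chi k)^-1 * gauss 1.
Proof.
case: (boolP (coprime k p)) => kp.
  by rewrite -(gauss_mul 1 kp) muln1 mulKf // chi_neq0.
rewrite chi0 // invr0 mul0r; have [u [up u1 chiu]] := chi_prim.
have pk : (p %| k)%N by move: kp; rewrite coprime_sym prime_coprime // negbK.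
have e : (u * k = k %[mod d])%N.
  have [k' ->] : exists k', k = (p * k')%N by exists (k %/ p)%N; rewrite mulnC divnK.
  by rewrite mulnCA expnS -!muln_modr -modnMml u1 modnMml mul1n.
have := gauss_mul k up; rewrite (gauss_mod e) => /eqP.
rewrite -subr_eq0 -[X in _ - X]mul1r -mulrBl mulf_eq0 subr_eq0 (negbTE chiu) /=.
by move/eqP.
Qed.

(** Otherwise all Gauss sums vanish, and so does [chi 1] by Fourier inversion. *)
Lemma gauss1_neq0 : gauss 1 != 0.
Proof.
apply/eqP => g0; have gk k : gauss k = 0 by rewrite gauss_inv g0 mulr0.
have : \sum_(a < d) chi a * (delta R d 1).[om ^+ a] = 0.
  under eq_bigr => a _ do rewrite horner_poly mulr_sumr.
  rewrite exchange_big big1 // => b _ /=.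
  transitivity (d%:R^-1 * om ^+ (d.-1 * 1 * b) * gauss b); last by rewrite gk mulr0.
  rewrite /gauss mulr_sumr; apply: eq_bigr => a _.
  by rewrite -exprM; ring.
rewrite (bigD1 (Ordinal d_gt1)) //= horner_delta // eqxx mulr1 chi1 big1 ?addr0.
  by move/eqP; rewrite oner_eq0.
move=> a a1; rewrite horner_delta // !modn_small //.
case: eqP => [e|]; last by rewrite mulr0.
by case/eqP: a1; apply: val_inj.
Qed.

Let xa (a : nat) : R := pi *+ 2 / d%:R * a%:R.

Lemma Im_om_exp a k : Im (om ^+ (a * k)) = sin (k%:R * xa a).
Proof.
rewrite crootX Im_cexp /= expR0 mul1r; congr sin.
by rewrite /xa -mulr_natr natrM; ring.
Qed.

Lemma gauss_halfsum k : gauss k = 2 * 'i%C * \sum_(a <- halfunits d) chi a * (sin (k%:R * xa a))%:C.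
Proof.
rewrite /gauss (@big_half _ _ _ d (fun a => chi a * om ^+ (a * k))) //; last first.
  by move=> a; rewrite coprime_d => /chi0 ->; rewrite mul0r.
rewrite mulr_sumr big_seq [RHS]big_seq; apply: eq_bigr => a.
rewrite halfunitsP // => /and3P[a0 a2 _].
have ad : (a < d)%N by apply: leq_trans a2; rewrite ltnS -addnn leq_addr.
rewrite /= chi_opp // mulNr -mulrBr.
have -> : om ^+ ((d - a) * k) = (om ^+ (a * k))^*%C.
  rewrite conj_croot_exp //; apply: om_mod; rewrite -modnMml mulnA -[RHS]modnMml.
  congr (_ * _ %% _)%N; apply/eqP; rewrite -(eqn_modDr a) subnK ?(ltnW ad) //.
  by rewrite -mulSnr prednK // modnn modnMr.
by rewrite subcJ Im_om_exp; ring.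
Qed.

Lemma one_halfunits : 1%N \in halfunits d.
Proof.
rewrite halfunitsP // coprime1n andbT /= -addnn addn1.
by rewrite ltn_neqAle d_gt1 andbT; apply: contraTneq d_odd => <-.
Qed.

(** Expanding [chi^-1] through its Gauss sum, the partial sum is a constant times the sum of the
    [chi a * sqwave N (xa a)] over the half units. As the half sum of [chi] vanishes, the value of
    the wave at [xa 1] can be subtracted throughout, and the differences are [O(1 / N)]. *)
Lemma sum_inv_chi_odd : exists2 c : C, 0 <= c & forall N, (0 < N)%N ->
  `|\sum_(k < N) (chi k.*2.+1)^-1 * (k.*2.+1)%:R^-1| <= c / N%:R.
Proof.
have dR : 0 < d%:R :> R by rewrite ltr0n.
have dl0 : 0 < pi / d%:R :> R by rewrite divr_gt0 // pi_gt0.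
have [c c0 hc] := sqwave_almost_cst dl0.
have g0 := gauss1_neq0.
exists (`|2 * 'i%C / gauss 1| * ((size (halfunits d))%:R * c%:C)).
  by rewrite !mulr_ge0 // lecR.
(* The sample points [2 pi a / d], with [2 a + 1 <= d], stay at distance at least [pi / d] from 0
   and from [pi]. *)
have xI a : a \in halfunits d -> xa a \in `[pi / d%:R, pi - pi / d%:R]%R.
  rewrite halfunitsP // => /and3P[a0 a2 _]; rewrite in_itv /= /xa.
  have a1' : 1 <= a%:R :> R by rewrite ler1n.
  have a2' : 2 * a%:R + 1 <= d%:R :> R by rewrite -natrM natr1 ler_nat mul2n.
  have -> : pi *+ 2 / d%:R * a%:R = pi / d%:R * (2 * a%:R) :> R by rewrite mulr2n; ring.
  apply/andP; split.
    by rewrite ler_peMr ?ltW //; lra.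
  rewrite lerBrDr -[X in _ + X]mulr1 -mulrDr; apply: le_trans (_ : pi / d%:R * d%:R <= _).
    by rewrite ler_wpM2l // ltW.
  by rewrite divfK // gt_eqF.
move=> N N0; set S := \sum_(k < N) _.
have e : \sum_(a <- halfunits d) chi a * (sqwave N (xa a) - sqwave N (xa 1))%:C = (2 * 'i%C)^-1 * gauss 1 * S.
  transitivity (\sum_(a <- halfunits d) chi a * (sqwave N (xa a))%:C).
    under eq_bigr => a _ do rewrite rmorphB mulrBr.
    by rewrite big_split /= sumrN -mulr_suml chi_half mul0r subr0.
  under eq_bigr => a _ do rewrite /sqwave rmorph_sum mulr_sumr.
  rewrite exchange_big /= /S mulr_sumr; apply: eq_bigr => k _.
  have := gauss_halfsum k.*2.+1; rewrite gauss_inv => h.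
  have i2 : 2 * 'i%C != 0 :> C by rewrite mulf_neq0 // eq_complex /= oner_eq0 andbF.
  have -> : (2 * 'i%C)^-1 * gauss 1 * ((chi k.*2.+1)^-1 / (k.*2.+1)%:R) =
     (2 * 'i%C)^-1 * ((chi k.*2.+1)^-1 * gauss 1) / (k.*2.+1)%:R by ring.
  rewrite h mulKf // mulr_suml; apply: eq_bigr => a _.
  by rewrite rmorphM fmorphV rmorph_nat mulrA.
have -> : S = (2 * 'i%C / gauss 1) * ((2 * 'i%C)^-1 * gauss 1 * S).
  have : 2 * 'i%C != 0 :> C by rewrite mulf_neq0 // eq_complex /= oner_eq0 andbF.
  by move: (2 * 'i%C) => w w0; field; rewrite g0 w0.
rewrite -e normrM -[leRHS]mulrA; apply: ler_wpM2l => //.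
apply: le_trans (ler_norm_sum _ _ _) _.
have -> : (size (halfunits d))%:R * c%:C / N%:R = \sum_(a <- halfunits d) (c / N%:R)%:C.
  by rewrite big_const_seq count_predT iter_addr_0 rmorphM fmorphV rmorph_nat -mulrA mulr_natl.
rewrite big_seq [leRHS]big_seq; apply: ler_sum => a ha.
have ap : coprime a p by move: ha; rewrite halfunitsP // coprime_d => /and3P[].
rewrite normrM chi_norm // mul1r.
have -> (t : R) : `|t%:C| = `|t|%:C by rewrite normc_def /= expr0n addr0 sqrtr_sqr.
by rewrite lecR; apply: hc => //; apply: xI => //; exact: one_halfunits.
Qed.

(** The powers of [chi] on the odd integers, the only frequencies of the square wave; hence the
    period [d.*2]. For [j = 0] this is the principal character modulo [2 p]. *)
Definition psi j m : C := if odd m && coprime m p then chi m ^+ j else 0.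

Lemma psiM j a b : psi j (a * b) = psi j a * psi j b.
Proof.
rewrite /psi oddM coprimeMl.
case: (odd a); case: (odd b); case: (coprime a p); case: (coprime b p); rewrite /= ?mul0r ?mulr0 //.
by rewrite chiM exprMn.
Qed.

Lemma psi1 j : psi j 1 = 1.
Proof. by rewrite /psi coprime1n chi1 expr1n. Qed.

Lemma psi_norm j m : `|psi j m| <= 1.
Proof.
rewrite /psi; case: ifP => [/andP[_ /chi_norm h]|_]; last by rewrite normr0.
by rewrite normrX h expr1n.
Qed.

Lemma psi_mod j a b : a = b %[mod d.*2] -> psi j a = psi j b.
Proof.
move=> ab; have abd : a = b %[mod d].
  by move/(congr1 (modn^~ d)): ab; rewrite !modn_dvdm // -muln2 dvdn_mulr.
have -> : psi j a = if odd a && coprime a d then chi a ^+ j else 0 by rewrite /psi coprime_d.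
have -> : psi j b = if odd b && coprime b d then chi b ^+ j else 0 by rewrite /psi coprime_d.
rewrite (chi_mod abd) -(coprime_modl a) abd coprime_modl.
have -> // : odd a = odd b.
by rewrite -(@odd_mod a d.*2) ?odd_double // ab odd_mod ?odd_double.
Qed.

Definition kills_chi f := `[< (0 < f)%N /\ forall a, coprime a p -> chi a ^+ f = 1 >].

Lemma exists_order : exists f, [/\ (0 < f)%N, forall a, coprime a p -> chi a ^+ f = 1
  & forall j, (0 < j)%N -> (j < f)%N -> exists2 u, coprime u p & chi u ^+ j != 1].
Proof.
have ex : exists f, kills_chi f.
  by exists (totient d); apply/asboolP; split; [exact: totient_d_gt0 | exact: chi_totient].
case: (ex_minnP ex) => f /asboolP[f0 hf] fmin; exists f; split => // j j0 jf.
apply: contrapT => h; have : kills_chi j.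
  apply/asboolP; split => // a ap; apply: contrapT => ha; apply: h.
  by exists a => //; apply/eqP.
by move=> /fmin; rewrite leqNgt jf.
Qed.

(* If all values are signs, then the conductor is [p] and Wilson's theorem shows
   that the number of terms of the half sum is odd. *)
Lemma chi_not_quadratic : ~ (forall a, coprime a p -> chi a ^+ 2 = 1).
Proof.
move=> chi2.
have i0 : i = 0%N.
  apply/eqP; rewrite -leqn0 leqNgt; apply/negP => i_gt0.
  have [u [up u1 chiu]] := chi_prim.
  have pi1 : (1 < p ^ i)%N by rewrite -(exp1n i) ltn_exp2r // prime_gt1.
  have u0 : (0 < u)%N by case: (posnP u) up => // ->; rewrite /coprime gcd0n gtn_eqF // prime_gt1.
  have pu : (p ^ i %| u.-1)%N by rewrite -subn1 -eqn_mod_dvd // u1.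
  have pdvd : (p %| p ^ i)%N by rewrite dvdn_exp.
  (* The cofactor of [u - 1] in [u ^ p - 1] is a sum of [p] terms congruent to 1 modulo [p], which
     gains one power of [p]. *)
  have up1 : (u ^ p = 1 %[mod d])%N.
    apply/eqP; rewrite eqn_mod_dvd ?expn_gt0 ?u0 // subn1 predn_exp expnS mulnC dvdn_mul //.
    rewrite /dvdn -modn_summ.
    under eq_bigr => j _.
      rewrite -modnXm (_ : u %% p = 1)%N ?exp1n; last first.
        rewrite -(@modn_dvdm (p ^ i)) // u1 modn_dvdm // modn_small // prime_gt1 //.
      over.
    by rewrite /= (modn_small (prime_gt1 p_prime)) sum_nat_const card_ord muln1 modnn.
  have : chi u ^+ p = 1 by rewrite -chiX (chi_mod up1).
  rewrite -(odd_double_half p) p_odd add1n exprS -muln2 mulnC exprM chi2 // expr1n mulr1 => e.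
  by rewrite e eqxx in chiu.
have dp : d = p by rewrite i0 expn1.
pose h := halfunits d.
have sgn a : coprime a p -> chi a = 1 - 2 * (chi a == -1)%:R.
  move=> /chi2 /eqP; rewrite sqrf_eq1 => /orP[] /eqP ->.
    by rewrite eq_sym eqNr oner_eq0 mulr0 subr0.
  by rewrite eqxx mulr1; ring.
have hcop a : a \in h -> coprime a p by rewrite halfunitsP // coprime_d => /and3P[].
have hsize : ~~ odd (size h).
  have : (size h)%:R = (2 * count (fun a => chi a == -1) h)%:R :> C.
    have : \sum_(a <- h) (1 - 2 * (chi a == -1)%:R) = 0 :> C.
      rewrite -[RHS]chi_half; apply: eq_big_seq => a /hcop ap.
      by rewrite -sgn.
    rewrite big_split /= sumrN -mulr_sumr -natr_sum big_const_seq count_predT iter_addr_0.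
    have -> : (\sum_(a <- h) (chi a == -1)%R)%N = count (fun a => chi a == -1) h.
      by rewrite -sum1_count [RHS]big_mkcond; apply: eq_bigr => a _; case: (_ == _).
    by move/eqP; rewrite subr_eq0 => /eqP ->; rewrite natrM.
  move/eqP; rewrite eqr_nat => /eqP ->.
  by rewrite mul2n odd_double.
(* Each pair [a], [d - a] contributes [- chi a ^+ 2 = -1], and the number of pairs is even; Wilson's
   theorem gives [chi d.-1 = -1] for the same product. *)
have prod1 : \prod_(a < d) (if coprime a d then chi a else 1) = 1.
  rewrite (@big_half _ _ _ d (fun a => if coprime a d then chi a else 1)) //; last first.
    by move=> a /negbTE ->.
  rewrite big_seq (eq_bigr (fun _ => -1)).
    rewrite -big_seq big_const_seq count_predT /= -/h -[size h]odd_double_half (negbTE hsize) add0n.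
    by elim: (size h)./2 => // k IH; rewrite doubleS /= IH; ring.
  move=> a; rewrite halfunitsP // => /and3P[a0 a2 ac].
  have ad : (a < d)%N by apply: leq_trans a2; rewrite ltnS -addnn leq_addr.
  rewrite /= coprime_sub ?(ltnW ad) // ac chi_opp // mulrN -expr2 chi2 //.
  by rewrite -coprime_d.
have : chi (p.-1)`! = -1.
  rewrite -chi_odd; apply: chi_mod; rewrite dp; apply/eqP.
  have := Wilson (prime_gt1 p_prime); rewrite p_prime => /esym hW.
  rewrite -(eqn_modDr 1) !addn1 prednK // modnn.
  by move: hW; rewrite /dvdn.
have -> : chi (p.-1)`! = \prod_(a < d) (if coprime a d then chi a else 1).
  rewrite dp -(big_mkord xpredT (fun a => if coprime a p then chi a else 1)).
  rewrite -[p in index_iota 0 p]prednK // big_nat_recl //.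
  rewrite {1}/coprime gcd0n gtn_eqF ?prime_gt1 // mul1r.
  rewrite fact_prod big_add1 (big_morph chi chiM chi1).
  rewrite big_nat [RHS]big_nat; apply: eq_bigr => a /andP[_ ap].
  rewrite ifT // coprime_sym prime_coprime //; apply/negP => /dvdn_leq -/(_ isT).
  by rewrite leqNgt -[p in (_ < p)%N]prednK // ltnS ap.
by rewrite prod1 => /eqP; rewrite eq_sym eqNr oner_eq0.
Qed.

(** The sum over a period is unchanged when multiplied by some [chi u ^+ j != 1], hence zero; fewer
    than [d.*2] terms remain. *)
Lemma psi_partial_sum j n : (exists2 u, coprime u p & chi u ^+ j != 1) ->
  `|\sum_(1 <= m < n.+1) psi j m| <= (d.*2)%:R.
Proof.
move=> [u0 u0p hu0].
have [u [up uo hu]] : exists u, [/\ coprime u p, odd u & chi u ^+ j != 1].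
  case: (boolP (odd u0)) => ou; first by exists u0.
  (* As [d] is odd, adding it makes the unit odd without changing [chi]. *)
  exists (u0 + d)%N; split.
  - by rewrite -coprime_d /coprime gcdnC gcdnDr gcdnC -/(coprime u0 d) coprime_d.
  - by rewrite oddD (negbTE ou) d_odd.
  - by rewrite (@chi_mod _ u0) // modnDr.
have D0 : (0 < d.*2)%N by rewrite double_gt0.
have uD : coprime u d.*2 by rewrite -mul2n coprimeMr coprimen2 uo coprime_d.
have z : \sum_(a < d.*2) psi j a = 0.
  have e := sum_mod_mul D0 uD (@psi_mod j).
  have : psi j u * (\sum_(a < d.*2) psi j a) = \sum_(a < d.*2) psi j a.
    by rewrite -[RHS]e mulr_sumr; apply: eq_bigr => a _; rewrite psiM.
  move/eqP; rewrite -subr_eq0 -[X in _ - X]mul1r -mulrBl mulf_eq0 subr_eq0 {1}/psi uo up (negbTE hu) /=.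
  by move/eqP.
have -> : \sum_(1 <= m < n.+1) psi j m = \sum_(0 <= m < n.+1) psi j m.
  by rewrite [RHS]big_ltn // {2}/psi /= add0r.
rewrite (sum_periodic D0 (@psi_mod j) z); apply: le_trans (ler_norm_sum _ _ _) _.
apply: le_trans (_ : \sum_(0 <= a < n.+1 %% d.*2) 1 <= _); first by apply: ler_sum => a _; exact: psi_norm.
by rewrite big_mkord sumr_const card_ord ler_nat ltnW // ltn_pmod.
Qed.

Lemma wt_decr (e : R) n : 0 < e -> (0 < n)%N -> wt e n.+1 <= wt e n.
Proof.
move=> e0 n0; rewrite !wtE //.
have := wt_le_vwt_diff e0 n0; have := wt_ge0 e n.+1 => w0 h.
have v : vwt e n.+1 <= vwt e n by rewrite -subr_ge0; apply: le_trans h; rewrite mulr_ge0 // ltW.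
apply: ler_pM => //; first exact: ltW (vwt_gt0 _ _).
by rewrite lef_pV2 ?posrE ?ltr0n // ler_nat.
Qed.

(* The series [L(s, chi ^ j)], restricted to odd integers, have an Euler product over
   [j < f] bounded below as [s] tends to 1. If the half sum vanishes, then so do
   [L(1, chi)] and [L(1, chi ^- 1)], two zeros against the single simple pole of
   [j = 0]; these characters are distinct since [2 < f]. *)
Lemma odd_character_absurd : False.
Proof.
have [f [f0 hf fmin]] := exists_order.
have f2 : (2 < f)%N.
  rewrite ltnNge; apply/negP => fle; case: f f0 hf fmin fle => [|[|[|]]] // _ hf _ _.
    have c1 : coprime d.-1 p by rewrite -coprime_d coprimePn ?d_gt0.
    by have := hf _ c1; rewrite expr1 chi_odd => /eqP; rewrite eqNr oner_eq0.
  exact: chi_not_quadratic.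
have fm : (f.-1 < f)%N by rewrite prednK.
have [c c0 hc] := sum_inv_chi_odd.
have T_small n : (0 < n)%N -> `|\sum_(1 <= m < n.+1) psi f.-1 m * m%:R^-1| <= 2 * c / n%:R.
  move=> n0; have -> : \sum_(1 <= m < n.+1) psi f.-1 m * m%:R^-1 =
      \sum_(1 <= m < n.+1) (if odd m then (chi m)^-1 * m%:R^-1 else 0).
    apply: eq_bigr => m _; rewrite /psi; case: (odd m); rewrite /= ?mul0r //.
    case: ifP => [mp|/negbT/chi0 ->]; last by rewrite invr0.
    congr (_ * _); apply: (mulfI (chi_neq0 mp)).
    by rewrite -exprS prednK // hf // divff // chi_neq0.
  rewrite sum_odd_terms; have u0 : (0 < uphalf n)%N by rewrite uphalf_gt0.
  apply: le_trans (hc _ u0) _; rewrite (_ : 2 * c / n%:R = c * (2 / n%:R)); last by ring.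
  rewrite ler_wpM2l //.
  rewrite ler_pdivlMr ?ltr0n // mulrC ler_pdivrMr ?ltr0n // -natrM ler_nat mul2n.
  by rewrite uphalf_half -{1}(odd_double_half n) doubleD leq_add2r; case: (odd n).
pose L e j M : C := \sum_(1 <= m < M.+1) psi j m * (wt e m)%:C.
have wtC0 (e : R) n : 0 <= (wt e n)%:C by rewrite lecR wt_ge0.
have L0 (e : R) M : 0 < e -> `|L e 0 M| <= (1 + e^-1)%:C.
  move=> e0; apply: le_trans (ler_norm_sum _ _ _) _.
  apply: le_trans (_ : (\sum_(1 <= m < M.+1) wt e m)%:C <= _); last by rewrite lecR wt_sum_total.
  rewrite rmorph_sum; apply: ler_sum => m _; rewrite normrM (ger0_norm (wtC0 _ _)).
  by rewrite ler_piMl // psi_norm.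
have Lj (e : R) j M : 0 < e -> (0 < j)%N -> (j < f)%N -> `|L e j M| <= (d.*2)%:R.
  move=> e0 j0 jf.
  have := @abel_bound_decr C (psi j) (fun m => (wt e m)%:C) (d.*2)%:R M.
  rewrite wt1 mulr1; apply => // [n|n n0]; first exact/psi_partial_sum/fmin.
  by rewrite lecR wt_decr.
have Llast (e : R) M : 0 < e -> (0 < M)%N -> `|L e f.-1 M| <= 2 * c / M%:R + 2 * (2 * c) * e%:C.
  move=> e0 M0.
  have := @abel_bound_smallsum C (fun m => psi f.-1 m * m%:R^-1) (fun m => (vwt e m)%:C) (2 * c) e%:C M.
  have -> : \sum_(1 <= m < M.+1) psi f.-1 m * m%:R^-1 * (vwt e m)%:C = L e f.-1 M.
    apply: eq_big_nat => m /andP[m0 _]; rewrite wtE // rmorphM fmorphV rmorph_nat; ring.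
  apply => //.
  - by rewrite mulr_ge0.
  - by rewrite lecR ltW.
  - move=> n; rewrite !lecR ltW ?vwt_gt0 //= -expR0 ler_expR oppr_le0 mulr_ge0 ?(ltW e0) ?ln_ge0 ?ler1n //.
  - move=> n n0; rewrite -rmorphB -(rmorph_nat (real_complex R)) -fmorphV -rmorphM !lecR vwt_diff_le // andbT.
    by apply: le_trans (wt_le_vwt_diff e0 n0); rewrite mulr_ge0 ?wt_ge0 // ltW.
(* Complex conjugation exchanges [chi] and its inverse, which is [chi ^ (f - 1)]. *)
have L1 e M : `|L e 1 M| = `|L e f.-1 M|.
  rewrite -[RHS]normcJ; congr (`|_|); rewrite /L (rmorph_sum (@conjc R)); apply: eq_bigr => m _.
  rewrite (rmorphM (@conjc R)); congr (_ * _); last by apply/eqP; rewrite eq_complex /= oppr0 !eqxx.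
  rewrite /psi; case: ifP => [/andP[_ mp]|_]; last by rewrite (rmorph0 (@conjc R)).
  rewrite (rmorphXn (@conjc R)) expr1.
  have cJ : conjc (chi m) = (chi m)^-1.
    by apply: (mulfI (chi_neq0 mp)); rewrite -sqr_normc chi_norm // expr1n divff // chi_neq0.
  rewrite /= cJ exprVn; have cn := expf_neq0 f.-1 (chi_neq0 mp).
  by apply: (mulfI cn); rewrite mulfV // -exprSr prednK // hf.
pose D : C := (d.*2)%:R.
have D1 : 1 <= D by rewrite ler1n double_gt0.
(* As [72 = 2 * 6 ^ 2], the upper bound for the product of the series becomes
   [k * (e * (e + 1) / 2)], and [e] is chosen to bring it below the lower bound 1/2. *)
pose K : C := 72 * c ^+ 2 * D ^+ f.
have K0 : 0 <= K by rewrite !mulr_ge0 ?exprn_ge0 // (le_trans ler01).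
pose k : R := Re K.
have KE : K = k%:C by rewrite [LHS]complexE (ger0_Im K0) mulr0 addr0.
have k0 : 0 <= k by rewrite -lecR -KE.
pose e : R := (1 + 2 * k)^-1.
have e0 : 0 < e by rewrite invr_gt0 ltr_pwDl // mulr_ge0.
have e1 : e <= 1 by rewrite invf_le1 ?ltr_pwDl ?mulr_ge0 // lerDl mulr_ge0.
have [|||||q qp|M0 hM0] := @euler_family_lower C f (fun j m => psi j m * (wt e m)%:C) (fun m => (wt e m)%:C).
- by move=> j a b; rewrite psiM wtM rmorphM mulrACA.
- by move=> j; rewrite psi1 wt1 mulr1.
- by move=> j n _; rewrite normrM (ger0_norm (wtC0 _ _)) ler_piMl // psi_norm.
- by move=> n; exact: wtC0.
- move=> d' d0; have dE : d' = (Re d')%:C by rewrite [LHS]complexE (ger0_Im (ltW d0)) mulr0 addr0.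
  have [|N hN] := @wt_tail R e e0 (Re d'); first by rewrite -ltcR -dE.
  by exists N => M; rewrite dE -rmorph_sum lecR.
- case: (boolP (odd q && coprime q p)) => hq; last first.
    by rewrite big1 // => j _; rewrite /psi (negbTE hq) mul0r subr0 normr1.
  have /andP[qo qcp] := hq.
  have := @prod_unity_factors C f (chi q) (wt e q)%:C f0 (hf q qcp).
  rewrite (_ : \prod_(j < f) _ = \prod_(j < f) `|1 - psi j q * (wt e q)%:C|); last first.
    by apply: eq_bigr => j _; rewrite /psi hq.
  have q0 := prime_gt0 qp.
  apply; first by rewrite ltcR wtE // divr_gt0 ?vwt_gt0 // ltr0n.
  rewrite lecR wtE // ler_pdivrMr ?ltr0n // mul1r.
  apply: le_trans (_ : 1 <= _); last by rewrite ler1n.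
  by rewrite -expR0 ler_expR oppr_le0 mulr_ge0 ?(ltW e0) ?ln_ge0 ?ler1n.
(* Beyond the threshold of the lower bound, and large enough that [1 / M <= e], which makes both
   terms of [Llast] of order [e]. *)
pose M := maxn M0 (Num.Def.truncn e^-1).+1.
have MM : (M0 <= M)%N by exact: leq_maxl.
have M1 : (0 < M)%N by apply: leq_trans (leq_maxr _ _).
have Me : e^-1 <= M%:R.
  by apply: le_trans (ltW (truncnS_gt _)) _; rewrite ler_nat leq_maxr.
have := hM0 M MM; rewrite -/(L e _ M).
have o1 : (1 < f)%N by exact: ltnW.
rewrite (bigD1 (Ordinal f0)) // (bigD1 (Ordinal o1)) // (bigD1 (Ordinal fm)) /=; last first.
  by rewrite -!(inj_eq val_inj) /=; case: (f) f2 => [|[|[|f']]].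
set rest := \prod_(_ < f | _) _ => hlow.
have hrest : rest <= D ^+ f.
  apply: prodr_le_exp => // j /andP[/andP[j0 _] _]; rewrite normr_ge0 /=.
  by apply: Lj => //; rewrite lt0n; apply: contra j0 => /eqP jj; apply/eqP/val_inj.
have ll : `|L e f.-1 M| <= 6 * c * e%:C.
  apply: le_trans (Llast e M e0 M1) _.
  have : 2 * c / M%:R <= 2 * c * e%:C.
    rewrite ler_wpM2l ?mulr_ge0 // -(rmorph_nat (real_complex R)) -fmorphV lecR.
    have Mp : 0 < M%:R :> R by rewrite ltr0n.
    by rewrite invf_ple ?posrE.
  move=> h; apply: le_trans (lerD h (lexx _)) _.
  by rewrite le_eqVlt; apply/orP; left; apply/eqP; ring.
have : 2^-1 <= (1 + e^-1)%:C * ((6 * c * e%:C) * ((6 * c * e%:C) * D ^+ f)).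
  apply: le_trans hlow _; rewrite -/(L e 0 M) -/(L e 1 M) -/(L e f.-1 M).
  apply: ler_pM => //; [by rewrite !mulr_ge0 // prodr_ge0 | exact: L0 |].
  apply: ler_pM => //; [by rewrite mulr_ge0 // prodr_ge0 | by rewrite L1 |].
  by apply: ler_pM => //; rewrite prodr_ge0.
have -> : (1 + e^-1)%:C * ((6 * c * e%:C) * ((6 * c * e%:C) * D ^+ f)) = (k * (e * (e + 1) / 2))%:C.
  have KE' : 72 * c ^+ 2 * D ^+ f = k%:C by exact: KE.
  move: (k) KE' (e) e0 => k' KE' e' e0'.
  have e0n : e'%:C != 0 by apply: contraTneq e0' => /(congr1 Re) /= ->; rewrite ltxx.
  have -> : (k' * (e' * (e' + 1) / 2))%:C = k'%:C * (e'%:C * (e'%:C + 1) / 2).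
    by rewrite !rmorphM fmorphV rmorphD rmorph1 rmorph_nat.
  have -> : (1 + e'^-1)%:C = 1 + e'%:C^-1 by rewrite rmorphD fmorphV rmorph1.
  by rewrite -KE'; field.
have -> : 2^-1 = (2^-1)%:C :> C by rewrite fmorphV rmorph_nat.
rewrite lecR => h.
have : k * e < 2^-1.
  rewrite /e ltr_pdivrMr ?ltr_pwDl ?mulr_ge0 //; lra.
have : k * (e * (e + 1) / 2) <= k * e * 1 by nra.
lra.
Qed.

End OddCharacter.

(** * Regularity of the sign matrix for prime powers *)

Section Regularity.
Variable R : realType.
Local Notation C := R[i].

(** Reduction to a primitive character: the conductor [p ^ k.+1] is found by minimality, and the
    half sum modulo [p ^ i] collapses to the one modulo the conductor. *)
Lemma half_sum_char p i (chi : nat -> C) : prime p -> odd p ->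
  (forall a b, chi (a * b)%N = chi a * chi b) -> chi 1%N = 1 ->
  (forall a, ~~ coprime a p -> chi a = 0) -> (forall a b, a = b %[mod p ^ i] -> chi a = chi b) ->
  chi (p ^ i).-1 = -1 -> \sum_(a <- halfunits (p ^ i)) chi a = 0 -> False.
Proof.
move=> pp op chiM chi1 chi0 chi_mod chi_odd chi_half.
pose trivial_on k := `[< forall u, coprime u p -> u = 1 %[mod p ^ k] -> chi u = 1 >].
have triv_i : trivial_on i by apply/asboolP => u _ u1; rewrite (chi_mod _ _ u1).
have ex : exists k, trivial_on k by exists i.
have p0 := prime_gt0 pp; have p1 := prime_gt1 pp.
have i_gt0 : (0 < i)%N.
  rewrite lt0n; apply/eqP => i0; move: chi_odd; rewrite i0 expn0 /= chi0 => [/eqP|].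
    by rewrite eq_sym oppr_eq0 oner_eq0.
  by rewrite /coprime gcd0n gtn_eqF.
pose q := (p ^ i)%N; have q0 : (0 < q)%N by rewrite expn_gt0 p0.
have copq a : coprime a q = coprime a p by rewrite coprime_pexpr.
case: (ex_minnP ex) => [[|k]] /asboolP htriv hmin.
  have c : coprime q.-1 p by rewrite -copq coprimePn.
  have := htriv _ c; rewrite expn0 !modn1 chi_odd => /(_ erefl) /eqP.
  by rewrite eqNr oner_eq0.
have ki : (k < i)%N by apply: hmin.
pose d := (p ^ k.+1)%N; pose r := (p ^ (i - k.+1))%N.
have d0 : (0 < d)%N by rewrite expn_gt0 p0.
have d1 : (1 < d)%N by rewrite -(exp1n k.+1) ltn_exp2r.
have dodd : odd d by rewrite oddX op orbT.
have qodd : odd q by rewrite oddX op orbT.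
have copd a : coprime a d = coprime a p by rewrite coprime_pexpr.
have qE : q = (r * d)%N by rewrite -expnD subnK.
have r0 : (0 < r)%N by rewrite expn_gt0 p0.
have chiX a n : chi (a ^ n)%N = chi a ^+ n.
  by elim: n => [|n IH]; rewrite ?expn0 ?expr0 // expnS chiM IH exprS.
have chi_modd a b : a = b %[mod d] -> chi a = chi b.
  move=> ab; case: (boolP (coprime b p)) => bp; last first.
    by rewrite !chi0 // -copd -coprime_modl ab coprime_modl copd.
  have ap : coprime a p by rewrite -copd -coprime_modl ab coprime_modl copd.
  have t0 : (0 < totient q)%N by rewrite totient_gt0.
  have bq : (b * b ^ (totient q).-1 = 1 %[mod q])%N.
    by rewrite -expnS prednK //; apply: Euler_exp_totient; rewrite copq.
  have dq : (d %| q)%N by rewrite qE dvdn_mull.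
  have aq : (a * b ^ (totient q).-1 = 1 %[mod d])%N.
    rewrite -modnMml ab modnMml; move/(congr1 (modn^~ d)): bq.
    by rewrite !modn_dvdm.
  have e1 : chi b * chi (b ^ (totient q).-1)%N = 1 by rewrite -chiM (chi_mod _ _ bq).
  have e2 : chi a * chi (b ^ (totient q).-1)%N = 1.
    by rewrite -chiM; apply: htriv => //; rewrite coprimeMl ap coprimeXl.
  have c0 : chi (b ^ (totient q).-1)%N != 0.
    by apply: contra_eq_neq e1 => ->; rewrite mulr0 eq_sym oner_eq0.
  by apply: (mulIf c0); rewrite e1 e2.
have chi_oddd : chi d.-1 = -1.
  rewrite -chi_odd; apply: chi_modd; apply/eqP.
  by rewrite -(eqn_modDr 1) !addn1 !prednK // -/q qE modnn modnMl.
have chi_opp a : (0 < a)%N -> (a < d)%N -> chi (d - a)%N = - chi a.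
  move=> a0 ad; rewrite -mulN1r -chi_oddd -chiM; apply: chi_modd; apply/eqP.
  rewrite -(eqn_modDr a) subnK; last exact: ltnW.
  by rewrite -mulSnr prednK // modnn modnMr.
have zsum : \sum_(a < d) chi a = 0.
  rewrite (@big_half _ _ _ d chi) //; last by move=> a; rewrite copd => /chi0.
  rewrite big_seq big1 // => a; rewrite halfunitsP // => /and3P[a0 a2 _].
  have ad : (a < d)%N by apply: leq_trans a2; rewrite ltnS -addnn leq_addr.
  by rewrite /= chi_opp // subrr.
have hsum n : odd n -> (forall a, coprime a n = coprime a p) ->
    \sum_(a <- halfunits n) chi a = \sum_(0 <= a < n./2.+1) chi a.
  move=> _ hc; rewrite /halfunits big_filter /index_iota subn0 big_mkcond.
  by apply: eq_bigr => a _; case: ifP => // /negbT; rewrite hc => /chi0.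
(* Since [q / d] is odd, half a period of length [q] consists of whole periods of length [d], over
   which [chi] sums to 0, followed by half a period. *)
have half_d : \sum_(a <- halfunits d) chi a = 0.
  rewrite hsum //; move: chi_half; rewrite -/q hsum // (sum_periodic d0 chi_modd zsum).
  have -> // : (q./2.+1 %% d = d./2.+1)%N.
  have rodd : odd r by rewrite oddX op orbT.
  have -> : q./2.+1 = (r./2 * d + d./2.+1)%N.
    move: qE (odd_double_half q) (odd_double_half r) (odd_double_half d); rewrite qodd rodd dodd; nia.
  rewrite modnMDl modn_small //.
  by move: (odd_double_half d); rewrite dodd; lia.
have [u [up u1 hu]] : exists u, [/\ coprime u p, u = 1 %[mod p ^ k] & chi u != 1].
  apply: contrapT => h; have : trivial_on k.
    apply/asboolP => u up u1; apply: contrapT => hu; apply: h; exists u; split => //.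
    exact/eqP.
  by move/hmin; rewrite ltnn.
apply: (@odd_character_absurd R p k pp op chi) => //.
by exists u.
Qed.

Section Eigencharacter.
Variable q : nat.
Hypothesis q_gt1 : (1 < q)%N.
Variable F : nat -> C.
Hypothesis F_mod : forall a b, a = b %[mod q] -> F a = F b.
Hypothesis F_nz : exists2 a, coprime a q & F a != 0.

Let q_gt0 : (0 < q)%N := ltnW q_gt1.
Let N : 'M[C]_q := \matrix_(u, a) (if coprime u q && coprime a q then F (u * a)%N else 0).
Let modI (a : nat) : 'I_q := Ordinal (ltn_pmod a q_gt0).
Let tr w : 'M[C]_q := \matrix_(i, a) (i == modI (w * a))%:R.

Let mul_tr m (A : 'M[C]_(m, q)) w i a : (A *m tr w) i a = A i (modI (w * a)).
Proof.
rewrite mxE (bigD1 (modI (w * a))) //= mxE eqxx mulr1 big1 ?addr0 // => j /negbTE h.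
by rewrite mxE h mulr0.
Qed.

Let N_mod u a : N (modI u) (modI a) = if coprime u q && coprime a q then F (u * a)%N else 0.
Proof.
rewrite mxE /= !coprime_modl; case: ifP => // _; apply: F_mod.
by rewrite modnMm.
Qed.

Let N_modr (u : 'I_q) a : N u (modI a) = if coprime u q && coprime a q then F (u * a)%N else 0.
Proof.
rewrite -N_mod; congr (N _ _); apply: val_inj; rewrite /= modn_small //.
Qed.

(* A common eigenvector of the translations, in the span of the translates of F. *)
Lemma exists_eigencharacter : exists (x : nat -> C) (G : nat -> C),
  [/\ forall a, G a = \sum_(u < q | coprime u q) x u * F (u * a)%N, G 1%N != 0
    & forall a b, coprime a q -> coprime b q -> G (a * b)%N * G 1%N = G a * G b].
Proof.
pose W := row_base N.
have Wfree : row_free W := row_base_free N.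
have [D WD] : exists D, W = D *m N by apply/submxP; rewrite eq_row_base.
have rk : (0 < \rank N)%N.
  rewrite lt0n mxrank_eq0; have [a ca Fa] := F_nz.
  apply: contraNneq Fa => N0; have := N_mod 1 a; rewrite N0 mxE coprime1n ca mul1n /= => <-.
  exact: eqxx.
have stab w : coprime w q -> (W *m tr w <= W)%MS.
  move=> cw; rewrite eq_row_base WD -mulmxA mulmx_sub //; apply/row_subP => u.
  have -> : row u (N *m tr w) = row (modI (u * w)) N.
    apply/rowP => a; rewrite !mxE -[LHS](_ : (N *m tr w) u a = _); last by rewrite mxE.
    rewrite mul_tr N_modr /= coprime_modl !coprimeMl cw andbT /=; case: ifP => // _.
    by apply: F_mod; rewrite modnMml mulnA.
  exact: row_sub.
pose A w := W *m tr w *m pinvmx W.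
have AW w : coprime w q -> A w *m W = W *m tr w by move=> cw; rewrite /A mulmxKpV // stab.
have Amod w : A (w %% q)%N = A w.
  rewrite /A; congr (_ *m _ *m _); apply/matrixP => i a; rewrite !mxE; congr ((_ == _)%:R).
  by apply: val_inj; rewrite /= modnMml.
clearbody A; clearbody W.
have AA w w' : coprime w q -> coprime w' q -> A w *m A w' *m W = W *m tr w *m tr w'.
  by move=> cw cw'; rewrite -[LHS]mulmxA (AW _ cw') [LHS]mulmxA (AW _ cw).
have NN w w' : coprime w q -> coprime w' q -> N *m tr w *m tr w' = N *m tr w' *m tr w.
  move=> cw cw'; apply/matrixP => u a; rewrite !mul_tr !N_modr /= !coprimeMl !coprime_modl !coprimeMl cw cw' /=.
  have key x y : (u * (x * ((y * a) %% q)) = u * (x * (y * a)) %[mod q])%N.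
    by rewrite mulnA modnMmr -mulnA.
  by case: ifP => // _; apply: F_mod; rewrite !key; congr (u * _ %% q)%N; rewrite mulnCA.
have comm w w' : coprime w q -> coprime w' q -> comm_mx (A w) (A w').
  move=> cw cw'; apply: (row_free_inj Wfree); rewrite !AA // WD -!(mulmxA D).
  by rewrite NN.
have [|v' v0 /allP hv] := @common_eigenvector _ _ [seq A w | w <- iota 0 q & coprime w q] rk.
  by move=> X Y /mapP[w + ->] /mapP[w' + ->]; rewrite !mem_filter => /andP[cw _] /andP[cw' _]; exact: comm.
have eig w : coprime w q -> exists l, v' *m A w = l *: v'.
  move=> cw.
  have : A (w %% q)%N \in [seq A w | w <- iota 0 q & coprime w q].
    by apply: map_f; rewrite mem_filter coprime_modl cw mem_iota add0n ltn_pmod.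
  by rewrite Amod => /hv /sub_rVP.
have /boolp.choice[lam hlam] : forall w, exists l, coprime w q -> v' *m A w = l *: v'.
  by move=> w; case: (boolP (coprime w q)) => [/eig[l hl]|_]; [exists l | exists 0].
pose x := v' *m D; pose v := v' *m W.
have vx : v = x *m N by rewrite /v WD mulmxA.
pose G a := \sum_(u < q | coprime u q) x 0 u * F (u * a)%N.
have vG a : v 0 (modI a) = if coprime a q then G a else 0.
  rewrite vx mxE; case: ifP => ca.
    rewrite [RHS]big_mkcond; apply: eq_bigr => u _; rewrite N_modr ca andbT.
    by case: ifP; rewrite ?mulr0.
  by rewrite big1 // => u _; rewrite N_modr ca andbF mulr0.
have Glam w a : coprime w q -> coprime a q -> G (w * a)%N = lam w * G a.
  move=> cw ca; have vtr : v *m tr w = lam w *: v by rewrite /v -[LHS]mulmxA -AW // [LHS]mulmxA hlam // scalemxAl.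
  have := congr1 (fun M : 'rV_q => M 0 (modI a)) vtr; rewrite /= mul_tr.
  have -> : (lam w *: v) 0 (modI a) = lam w * v 0 (modI a) by rewrite mxE.
  rewrite (vG a) ca => <-.
  have -> : modI (w * modI a) = modI (w * a) by apply: val_inj; rewrite /= modnMmr.
  by rewrite vG coprimeMl cw ca.
have G1 : G 1%N != 0.
  apply: contra_neq v0 => g0; apply: (row_free_inj Wfree); rewrite mul0mx -/v.
  apply/rowP => a; rewrite [RHS]mxE.
  have -> : a = modI a by apply: val_inj; rewrite /= modn_small.
  rewrite vG; case: ifP => // ca.
  by rewrite -[X in G X]muln1 Glam ?coprime1n // g0 mulr0.
exists (fun u => if insub u is Some u' then x 0 u' else 0), G; split => //.
  by move=> a; apply: eq_bigr => u _; rewrite valK.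
move=> a b ca cb; rewrite Glam // -[X in _ = G X * _]muln1 Glam ?coprime1n //; ring.
Qed.

End Eigencharacter.

(** The conditions on [F] are linear and stable under the translations [a |-> u a], so a
    counterexample yields a common eigenvector of the translations that satisfies them too;
    normalized at 1, it is an odd character. *)
Lemma half_sum_regular_prime_power p j : prime p -> odd p -> (0 < j)%N -> half_sum_regular R (p ^ j).
Proof.
move=> pp op j0 F F_mod F_odd F_half a ca; apply: contrapT => /eqP Fa.
set q := (p ^ j)%N in F_mod F_odd F_half ca.
have p0 := prime_gt0 pp; have p1 := prime_gt1 pp.
have q1 : (1 < q)%N by rewrite -(exp1n j) ltn_exp2r.
have q0 := ltnW q1.
have copq b : coprime b q = coprime b p by rewrite coprime_pexpr.
have [|x [G [GE G1 GM]]] := exists_eigencharacter q1 F_mod; first by exists a.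
have G_mod b c : b = c %[mod q] -> G b = G c.
  by move=> bc; rewrite !GE; apply: eq_bigr => u _; congr (_ * _); apply: F_mod; rewrite -modnMmr bc modnMmr.
pose chi b := if coprime b q then G b / G 1%N else 0.
apply: (@half_sum_char p j chi) => //.
- move=> b c; rewrite /chi coprimeMl; case: (boolP (coprime b q)) => cb; last by rewrite mul0r.
  case: (boolP (coprime c q)) => cc /=; last by rewrite mulr0.
  have := GM b c cb cc => /(canRL (mulfK G1)) ->.
  by field.
- by rewrite /chi coprime1n divff.
- by move=> b; rewrite /chi copq => /negbTE ->.
- by move=> b c bc; rewrite /chi -coprime_modl bc coprime_modl (G_mod _ _ bc).
- rewrite /chi coprimePn // (_ : G _ = - G 1%N) ?mulNr ?divff //.
  rewrite !GE -sumrN; apply: eq_bigr => u _; rewrite -mulrN muln1 -F_odd; congr (_ * F _).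
  by rewrite mulnC.
- rewrite -[RHS](mul0r (G 1%N)^-1); transitivity ((\sum_(b <- halfunits q) G b) / G 1%N).
    rewrite mulr_suml big_seq [RHS]big_seq; apply: eq_bigr => b.
    by rewrite mem_filter /chi => /andP[-> _].
  congr (_ / _); under eq_bigr => b _ do rewrite GE.
  rewrite exchange_big big1 // => u cu.
  by rewrite -mulr_sumr F_half // mulr0.
Qed.

End Regularity.

(** * The lattice of a simple factor *)

Section TorusData.
Variable R : realType.
Local Notation C := R[i].
Local Notation Re := (@complex.Re R).
Local Notation Im := (@complex.Im R).
Local Notation QC := (ratr : rat -> C).
Local Notation toC := (map_poly (ratr : rat -> C)).
Local Notation cj := (map_mx (@conjc R)).

Lemma conjc_ratr (a : rat) : (ratr a : C)^*%C = ratr a.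
Proof. exact: (fmorph_rat (@conjc R)). Qed.

Lemma ratr_real_complex (a : rat) : (ratr a : R)%:C = ratr a :> C.
Proof. exact: (fmorph_rat (real_complex R)). Qed.

Variables (n : nat) (B : 'M[C]_(n.*2, n)).
Hypothesis Bfree : forall c : 'rV[R]_(n.*2), map_mx (real_complex R) c *m B = 0 -> c = 0.

Lemma cjK m1 m2 (A : 'M[C]_(m1, m2)) : cj (cj A) = A.
Proof. by apply/matrixP => i j; rewrite !mxE conjcK. Qed.

(** If both [B] and its conjugate kill [x], then [B] kills the real and imaginary parts of [x]. In
    Hodge terms, complex homology embeds into the sum of the tangent space and its conjugate. *)
Lemma basis_conj_inj (x : 'rV[C]_(n.*2)) : x *m B = 0 -> x *m cj B = 0 -> x = 0.
Proof.
move=> h1 h2.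
have h3 : cj x *m B = 0 by rewrite -[B]cjK -map_mxM h2 map_mx0.
have hre : map_mx (real_complex R) (map_mx Re x) *m B = 0.
  have -> : map_mx (real_complex R) (map_mx Re x) = 2^-1 *: (x + cj x).
    by apply/matrixP => i j; rewrite !mxE addcJ mulrA mulVf ?mul1r //.
  by rewrite -scalemxAl mulmxDl h1 h3 addr0 scaler0.
have him : map_mx (real_complex R) (map_mx Im x) *m B = 0.
  have -> : map_mx (real_complex R) (map_mx Im x) = (- 'i / 2) *: (x - cj x).
    apply/matrixP => i j; rewrite !mxE subcJ.
    have -> : - 'i / 2 * (2 * (Im (x i j))%:C * 'i) = - ('i ^+ 2) * (Im (x i j))%:C :> C by field.
    by rewrite sqr_i opprK mul1r.
  by rewrite -scalemxAl mulmxBl h1 h3 subr0 scaler0.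
have := Bfree hre; have := Bfree him => e1 e2.
apply/matrixP => i j; rewrite [x i j]complexE mxE.
by move/matrixP/(_ i j): e1; move/matrixP/(_ i j): e2; rewrite !mxE => -> ->; rewrite mulr0 addr0.
Qed.

Variable q : nat.
Hypotheses (q_odd : odd q) (q_gt1 : (1 < q)%N).
Hypothesis q_reg : half_sum_regular R q.
Variables (t : nat -> 'rV[rat]_(n.*2)) (Z : nat -> 'rV[C]_n).
Local Notation om := (croot R q).
Hypothesis tB : forall i, map_mx QC (t i) *m B = \sum_(b <- halfunits q) om ^+ (b * i) *: Z b.
Hypothesis t_neq0 : t 0%N != 0.

Let q_gt0 : (0 < q)%N := ltnW q_gt1.
Let om_prim : q.-primitive_root om := croot_prim R q_gt0.

(** Stands for [H] evaluated at an operator [t i |-> t i.+1] and applied to [t 0], before such an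
    operator is known to exist; [theta] is the rational version. The operator is obtained in
    [exists_CM_by], once the kernel of [theta] is known. *)
Definition Psi (H : {poly C}) : 'rV[C]_(n.*2) := \sum_(i < size H) H`_i *: map_mx QC (t i).

Lemma Psi_widen (N : nat) (H : {poly C}) : (size H <= N)%N -> Psi H = \sum_(i < N) H`_i *: map_mx QC (t i).
Proof.
move=> sN; rewrite /Psi (big_ord_widen N (fun i => H`_i *: map_mx QC (t i)) sN).
rewrite big_mkcond; apply: eq_bigr => i _; case: ltnP => // h.
by rewrite nth_default // scale0r.
Qed.

Lemma PsiD G H : Psi (G + H) = Psi G + Psi H.
Proof.
pose N := maxn (size G) (size H).
have s1 : (size G <= N)%N by rewrite leq_max leqnn.
have s2 : (size H <= N)%N by rewrite leq_max leqnn orbT.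
rewrite (Psi_widen s1) (Psi_widen s2) (@Psi_widen N); last first.
  by apply: leq_trans (size_polyD _ _) _.
by rewrite -big_split; apply: eq_bigr => i _; rewrite coefD scalerDl.
Qed.

Lemma PsiZ a H : Psi (a *: H) = a *: Psi H.
Proof.
rewrite (Psi_widen (size_scale_leq a H)) /Psi scaler_sumr.
by apply: eq_bigr => i _; rewrite coefZ scalerA.
Qed.

Lemma Psi0 : Psi 0 = 0.
Proof. by rewrite /Psi size_poly0 big_ord0. Qed.

Lemma Psi_sum (I : Type) (r : seq I) (F : I -> {poly C}) :
  Psi (\sum_(i <- r) F i) = \sum_(i <- r) Psi (F i).
Proof. by elim: r => [|x r IH]; rewrite ?big_nil ?Psi0 // !big_cons PsiD IH. Qed.

Lemma PsiN H : Psi (- H) = - Psi H.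
Proof. by rewrite -scaleN1r PsiZ scaleN1r. Qed.

Lemma PsiXn i : Psi 'X^i = map_mx QC (t i).
Proof.
rewrite /Psi size_polyXn big_ord_recr /= big1 ?add0r => [|j _]; rewrite coefXn.
  by rewrite eqxx scale1r.
by rewrite ltn_eqF ?ltn_ord // scale0r.
Qed.

Lemma Psi_mulB H : Psi H *m B = \sum_(b <- halfunits q) H.[om ^+ b] *: Z b.
Proof.
rewrite /Psi mulmx_suml.
under eq_bigr => i _ do rewrite -scalemxAl tB scaler_sumr.
rewrite exchange_big /=; apply: eq_bigr => b _.
rewrite horner_coef scaler_suml; apply: eq_bigr => i _.
by rewrite scalerA exprM.
Qed.

Lemma Psi_mul_conjB H :
  Psi H *m cj B = \sum_(b <- halfunits q) H.[om ^+ (q.-1 * b)] *: cj (Z b).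
Proof.
have hc i : map_mx QC (t i) *m cj B = \sum_(b <- halfunits q) om ^+ (q.-1 * b * i) *: cj (Z b).
  have <- : cj (map_mx QC (t i) *m B) = map_mx QC (t i) *m cj B.
    rewrite map_mxM; congr (_ *m _); apply/matrixP => a b.
    by rewrite !mxE /= conjc_ratr.
  rewrite tB raddf_sum /=; apply: eq_bigr => b _.
  by rewrite map_mxZ /= conj_croot_exp // mulnA.
rewrite /Psi mulmx_suml.
under eq_bigr => i _ do rewrite -scalemxAl hc scaler_sumr.
rewrite exchange_big /=; apply: eq_bigr => b _.
rewrite horner_coef scaler_suml; apply: eq_bigr => i _.
by rewrite scalerA -[RHS]/(_ *: _) exprM.
Qed.

Definition theta (h : {poly rat}) : 'rV[rat]_(n.*2) := \sum_(i < size h) h`_i *: t i.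

Lemma Psi_rat h : Psi (toC h) = map_mx QC (theta h).
Proof.
rewrite /Psi /theta size_map_poly raddf_sum /=; apply: eq_bigr => i _.
by rewrite coef_map map_mxZ.
Qed.

Lemma rat_basis_inj (x : 'rV[rat]_(n.*2)) : map_mx QC x *m B = 0 -> x = 0.
Proof.
move=> h; have : map_mx (ratr : rat -> R) x = 0.
  apply: Bfree; rewrite -[RHS]h; congr (_ *m _).
  by apply/matrixP => i j; rewrite !mxE ratr_real_complex.
move=> /matrixP e; apply/matrixP => i j; move: (e i j); rewrite !mxE => /eqP.
by rewrite fmorph_eq0 => /eqP.
Qed.

Lemma halfunits_coprime b : b \in halfunits q -> coprime b q.
Proof. by rewrite halfunitsP // => /and3P[]. Qed.

Lemma halfunits_lt b : b \in halfunits q -> (b < q)%N.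
Proof. by rewrite halfunitsP // => /and3P[h1 h2 _]; lia. Qed.

Lemma om_exp_prim b : coprime b q -> q.-primitive_root (om ^+ b).
Proof. by rewrite -(prim_root_exp_coprime b om_prim). Qed.

Lemma theta_eq0 h : PhiQ q %| h -> theta h = 0.
Proof.
move=> hd; apply: rat_basis_inj; rewrite -Psi_rat Psi_mulB.
rewrite big_seq big1 // => b /halfunits_coprime/om_exp_prim hp.
have /rootP -> : root (toC h) (om ^+ b).
  by apply: root_map_dvdp hd _; exact: prim_root_PhiQ.
by rewrite scale0r.
Qed.

Lemma Z_neq0 : exists2 b, b \in halfunits q & Z b != 0.
Proof.
apply/hasP; apply: contraT => /hasPn hZ; case/negP: t_neq0; apply/eqP.
apply: rat_basis_inj; rewrite tB big_seq big1 // => b /hZ.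
by rewrite negbK => /eqP ->; rewrite scaler0.
Qed.

Lemma half_neg_mod a b : a \in halfunits q -> b \in halfunits q ->
  (a == q.-1 * b %[mod q]) = false.
Proof.
rewrite !halfunitsP // => /and3P[a0 a1 _] /and3P[b0 b1 _].
rewrite -(eqn_modDr b) -mulSnr prednK // modnMr.
by apply/negbTE; rewrite -/(dvdn _ _) gtnNdvd //; lia.
Qed.

Lemma half_eq_mod a b : a \in halfunits q -> b \in halfunits q ->
  (a == b %[mod q]) = (a == b).
Proof. by move=> /halfunits_lt ha /halfunits_lt hb; rewrite !modn_small. Qed.

(** For [u = 1] the values are 1 on the CM type and -1 on its opposite: this is the complex
    structure up to the factor [i]. The other [u] give its Galois conjugates. *)
Definition twist u : {poly C} :=
  \sum_(a <- halfunits q) (delta R q (u * a) - delta R q (u * (q.-1 * a))).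

Lemma twist1_half b : b \in halfunits q -> (twist 1).[om ^+ b] = 1.
Proof.
move=> hb; rewrite /twist horner_sum (bigD1_seq b) ?halfunits_uniq //=.
rewrite !mul1n hornerD hornerN !horner_delta // eqxx half_neg_mod // subr0.
rewrite big_seq_cond big1 ?addr0 // => a /andP[ha nab].
rewrite !mul1n hornerD hornerN !horner_delta // half_neg_mod // half_eq_mod //.
by rewrite eq_sym (negbTE nab) subrr.
Qed.

Lemma negmod_neg a b : (q.-1 * a == q.-1 * b %[mod q]) = (a == b %[mod q]).
Proof.
rewrite -(eqn_modDr (a + b)) addnA -mulSnr (addnC a b) addnA -mulSnr prednK //.
by rewrite ![(q * _)%N]mulnC !modnMDl eq_sym.
Qed.

Lemma twist1_neg b : b \in halfunits q -> (twist 1).[om ^+ (q.-1 * b)] = - 1.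
Proof.
move=> hb; rewrite /twist horner_sum (bigD1_seq b) ?halfunits_uniq //=.
have hf a : a \in halfunits q -> (q.-1 * b == a %[mod q]) = false.
  by move=> ha; rewrite eq_sym half_neg_mod.
rewrite !mul1n hornerD hornerN !horner_delta // eqxx hf // sub0r.
rewrite big_seq_cond big1 ?addr0 // => a /andP[ha nab].
rewrite !mul1n hornerD hornerN !horner_delta // hf // negmod_neg half_eq_mod //.
by rewrite eq_sym (negbTE nab) subrr.
Qed.

(** Multiplication by [twist 1] fixes the image under [B] and negates the image under the conjugate
    of [B], so it preserves zero. Each coordinate being a rational polynomial in [om ^+ u], the
    vanishing passes from 1 to all units [u]. *)
Lemma theta_mul_twist h u : theta h = 0 -> coprime u q -> Psi (toC h * twist u) = 0.
Proof.
move=> h0 cu.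
pose e i : {poly rat} := q%:R^-1 *: \sum_(a <- halfunits q)
   ('X^(q.-1 * a * i) - 'X^(q.-1 * (q.-1 * a) * i)).
have he v i : (i < q)%N -> (twist v)`_i = (toC (e i)).[om ^+ v].
  move=> iq; rewrite /twist coef_sum /e map_polyZ hornerZ fmorphV /= ratr_nat.
  rewrite raddf_sum horner_sum mulr_sumr; apply: eq_bigr => a _.
  rewrite coefB !coef_poly iq raddfB /= !map_polyXn hornerD hornerN !hornerXn -!exprM mulrBr.
  by congr (_ * om ^+ _ - _ * om ^+ _); ring.
have sE v : (size (twist v) <= q)%N.
  apply: (big_ind (fun p : {poly C} => size p <= q)%N).
  - by rewrite size_poly0.
  - by move=> p1 p2 h1 h2; apply: leq_trans (size_polyD _ _) _; rewrite geq_max h1.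
  - move=> a _; apply: leq_trans (size_polyD _ _) _.
    by rewrite size_polyN geq_max !size_poly.
pose T j : {poly rat} := \sum_(i < q) (theta (h * 'X^i)) 0 j *: e i.
have hT v j : (Psi (toC h * twist v)) 0 j = (toC (T j)).[om ^+ v].
  have -> : toC h * twist v = \sum_(i < q) (twist v)`_i *: toC (h * 'X^i).
    rewrite {1}[twist v](_ : _ = \sum_(i < q) (twist v)`_i *: 'X^i).
      rewrite mulr_sumr; apply: eq_bigr => i _.
      by rewrite rmorphM /= map_polyXn scalerAr.
    rewrite -(poly_def q (fun i => (twist v)`_i)); apply/polyP => k.
    by rewrite coef_poly; case: ltnP => // qk; rewrite nth_default // (leq_trans (sE v) qk).
  rewrite Psi_sum summxE /T raddf_sum horner_sum; apply: eq_bigr => i _.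
  by rewrite PsiZ Psi_rat mxE [X in _ * X]mxE he //= [in RHS]map_polyZ [in RHS]hornerZ [LHS]mulrC.
have J : Psi (toC h * twist 1) = 0.
  have hB : Psi (toC h) = 0 by rewrite Psi_rat h0 map_mx0.
  apply: basis_conj_inj.
    rewrite Psi_mulB -[RHS](mul0mx _ B) -hB Psi_mulB.
    rewrite [LHS]big_seq [RHS]big_seq; apply: eq_bigr => b hb.
    by rewrite hornerM twist1_half // mulr1.
  rewrite Psi_mul_conjB -[RHS]oppr0 -[in RHS](mul0mx _ (cj B)) -hB Psi_mul_conjB -sumrN.
  rewrite [LHS]big_seq [RHS]big_seq; apply: eq_bigr => b hb.
  by rewrite hornerM twist1_neg // mulrN1 scaleNr.
apply/matrixP => i j; rewrite ord1 hT mxE.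
apply: (prim_root_galois (om_exp_prim (coprime1n q))); last by rewrite -hT J mxE.
exact: om_exp_prim.
Qed.

(** Regularity separates the vanishing for all twists into one for each pair [b], [- b]. Applying
    [B] then isolates the value of [h] at [om ^+ b] times [Z b], and some [Z b] is nonzero. *)
Lemma theta_inj h : theta h = 0 -> PhiQ q %| h.
Proof.
move=> h0; apply: contraT => nd.
have hn b : coprime b q -> (toC h).[om ^+ b] != 0.
  move=> cb; apply: contra nd => /eqP hb.
  exact: prim_root_min (om_exp_prim cb) hb.
pose F j b : C := (Psi (toC h * delta R q b) - Psi (toC h * delta R q (q.-1 * b))) 0 j.
have hF j b : coprime b q -> F j b = 0.
  apply: q_reg.
  - move=> a c ac; rewrite /F (delta_mod R q_gt0 ac) (@delta_mod R q (q.-1 * a) (q.-1 * c)) //.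
    by rewrite -modnMmr ac modnMmr.
  - move=> a; have dd : delta R q (q.-1 * (q.-1 * a)) = delta R q a.
      apply: (delta_mod R q_gt0); apply/eqP.
      rewrite -(eqn_modDr (q.-1 * a)) -mulSnr -[(a + _)%N]mulSn prednK //.
      by rewrite !modnMr.
    by rewrite /F dd -opprB [in LHS]mxE.
  - move=> u cu; have := theta_mul_twist h0 cu.
    move=> /matrixP/(_ 0 j); rewrite [in RHS]mxE => e0; rewrite -[RHS]e0.
    rewrite /twist mulr_sumr Psi_sum summxE; apply: eq_bigr => a _.
    by rewrite /F mulrBr PsiD PsiN !mxE mulnCA.
have [b hb Zb] := Z_neq0; case/negP: Zb; apply/eqP.
have cb := halfunits_coprime hb.
have : Psi (toC h * delta R q b) *m B = Psi (toC h * delta R q (q.-1 * b)) *m B.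
  congr (_ *m _); apply/matrixP => i j; rewrite ord1.
  by have := hF j b cb; rewrite /F mxE => /eqP; rewrite mxE subr_eq0 => /eqP.
rewrite !Psi_mulB (bigD1_seq b) ?halfunits_uniq //= hornerM horner_delta // eqxx mulr1.
rewrite big_seq_cond big1 => [|a /andP[ha ab]]; last first.
  by rewrite hornerM horner_delta // half_eq_mod // (negbTE ab) mulr0 scale0r.
rewrite addr0 big_seq big1 => [|a ha]; last first.
  by rewrite hornerM horner_delta // half_neg_mod // mulr0 scale0r.
by move=> /eqP; rewrite scaler_eq0 (negbTE (hn b cb)) => /eqP.
Qed.

Variable L : set 'rV[C]_n.
Hypothesis LB : L = span_over (fun a : int => a%:~R : C) (range (fun i => row i B)).
Hypothesis L_simple : forall W : 'M[C]_n, subtorus L W -> \rank W = 0 \/ \rank W = n.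

Lemma common_denominator N (y : 'rV[rat]_N) : exists2 D : nat, (0 < D)%N &
  exists z : 'rV[int]_N, map_mx intr z = D%:R *: y.
Proof.
pose d (j : 'I_N) : nat := absz (denq (y 0 j)).
have dE j : (d j)%:R = (denq (y 0 j))%:~R :> rat.
  by rewrite -[in RHS](gez0_abs (denq_ge0 _)) pmulrn.
exists (\prod_(j < N) d j)%N.
  by apply: prodn_gt0 => j; rewrite absz_gt0 denq_neq0.
exists (\row_j (numq (y 0 j) * (\prod_(k < N | k != j) d k)%N%:Z)).
apply/matrixP => i j; rewrite !mxE ord1 rmorphM /= numqE [in RHS](bigD1 j) //= natrM dE.
by rewrite -pmulrn; ring.
Qed.

Lemma int_row_in_lattice (z : 'rV[int]_(n.*2)) : L (map_mx intr z *m B).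
Proof.
rewrite LB; exists (n.*2), (fun i => z 0 i), (fun i => row i B); split.
  by move=> i; exists i.
by rewrite mulmx_sum_row; apply: eq_bigr => i _; rewrite mxE.
Qed.

Definition t_mx : 'M[rat]_(q, n.*2) := \matrix_(i < q) t i.

Lemma Psi_row (c : 'rV[C]_q) : c *m map_mx QC t_mx = Psi (rVpoly c).
Proof.
rewrite (Psi_widen (size_poly _ _)) mulmx_sum_row; apply: eq_bigr => i _.
rewrite coef_rVpoly_ord; congr (_ *: _).
by apply/matrixP => a b; rewrite !mxE ord1.
Qed.

(** No two exponents of the CM type are opposite, so values at the [om ^+ b] are taken by a real
    polynomial: it suffices to prescribe the conjugate values at the conjugate points. *)
Lemma real_interpolation (c : 'rV[C]_q) : exists r : 'rV[R]_q,
  c *m map_mx QC t_mx *m B = map_mx (real_complex R) r *m map_mx QC t_mx *m B.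
Proof.
pose H b := (rVpoly c).[om ^+ b].
pose x i := q%:R^-1 * \sum_(b <- halfunits q) H b * om ^+ (q.-1 * b * i).
exists (\row_i (2 * Re (x i))).
rewrite !Psi_row !Psi_mulB [LHS]big_seq [RHS]big_seq; apply: eq_bigr => a ha.
congr (_ *: _); rewrite -/(H a).
have -> : rVpoly (map_mx (real_complex R) (\row_(i < q) (2 * Re (x i)))) =
    \sum_(b <- halfunits q) (H b *: delta R q b + (H b)^*%C *: delta R q (q.-1 * b)).
  apply/polyP => k; rewrite coef_sum.
  have [kq|qk] := ltnP k q; last first.
    rewrite nth_default ?(leq_trans (size_poly _ _) qk) // big1 // => b _.
    by rewrite coefD !coefZ !coef_poly ltnNge qk /= !mulr0 addr0.
  rewrite (coef_rVpoly_ord _ (Ordinal kq)) !mxE rmorphM /= -[2%:C]/(_) (rmorph_nat (real_complex R)) -addcJ.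
  rewrite /x rmorphM /= fmorphV /= conjc_nat (raddf_sum (@conjc R)) !mulr_sumr -big_split /=.
  apply: eq_bigr => b _; rewrite coefD !coefZ !coef_poly kq rmorphM /= conj_croot_exp //.
  by rewrite -!mulnA; ring.
rewrite horner_sum (bigD1_seq a) ?halfunits_uniq //= hornerD !hornerZ !horner_delta // eqxx.
rewrite half_neg_mod // mulr1 mulr0 addr0 big_seq_cond big1 ?addr0 // => b /andP[hb nb].
rewrite hornerD !hornerZ !horner_delta // half_neg_mod // half_eq_mod // eq_sym (negbTE nb).
by rewrite !mulr0 addr0.
Qed.

(** By [real_interpolation], the complex span of the images of the [t i] is already a real span of
    lattice vectors, hence a subtorus; simplicity leaves only the whole space. *)
Lemma rank_span : \rank (map_mx QC t_mx *m B) = n.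
Proof.
set A := map_mx QC t_mx *m B.
have hs : subtorus L <<A>>%MS.
  move=> w; rewrite genmxE => /submxP[c ->].
  have [r] := real_interpolation c; rewrite -!mulmxA -/A => ->.
  have hD (i : 'I_q) : exists Dz : nat * 'rV[int]_(n.*2),
     (0 < Dz.1)%N /\ map_mx intr Dz.2 = Dz.1%:R *: t i.
    by have [D D0 [z hz]] := common_denominator (t i); exists (D, z).
  have [Dz hDz] := boolp.choice hD.
  exists q, (fun i => r 0 i / (Dz i).1%:R), (fun i => map_mx intr (Dz i).2 *m B); split.
    move=> i; split; first exact: int_row_in_lattice.
    have [D0 hz] := hDz i; rewrite genmxE.
    have -> : map_mx intr (Dz i).2 *m B = (Dz i).1%:R *: row i A :> 'rV[C]_n.
      have -> : map_mx intr (Dz i).2 = map_mx QC (map_mx intr (Dz i).2).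
        by apply/matrixP => a b; rewrite !mxE ratr_int.
      rewrite hz map_mxZ /= ratr_nat -scalemxAl; congr (_ *: _).
      rewrite row_mul; congr (_ *m _).
      by apply/matrixP => a b; rewrite !mxE ord1.
    by apply: scalemx_sub; exact: row_sub.
  rewrite mulmx_sum_row; apply: eq_bigr => i _.
  have [D0 hz] := hDz i.
  have -> : map_mx intr (Dz i).2 *m B = (Dz i).1%:R *: row i A :> 'rV[C]_n.
    have -> : map_mx intr (Dz i).2 = map_mx QC (map_mx intr (Dz i).2).
      by apply/matrixP => a b; rewrite !mxE ratr_int.
    rewrite hz map_mxZ /= ratr_nat -scalemxAl; congr (_ *: _).
    rewrite row_mul; congr (_ *m _).
    by apply/matrixP => a b; rewrite !mxE ord1.
  rewrite scalerA mxE; congr (_ *: _).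
  rewrite rmorphM /= fmorphV /= (rmorph_nat (real_complex R)) divfK //.
  by rewrite pnatr_eq0 -lt0n.
have [] := L_simple hs; rewrite !mxrank_gen // => /eqP; rewrite mxrank_eq0 => /eqP A0.
case/negP: t_neq0; apply/eqP; apply: rat_basis_inj.
have <- : row (Ordinal q_gt0) A = map_mx QC (t 0) *m B.
  by rewrite row_mul; congr (_ *m _); apply/matrixP => a b; rewrite !mxE ord1.
by rewrite A0 row0.
Qed.

Lemma t_mx_row_full : row_full t_mx.
Proof.
rewrite -(row_full_map (ratr : {rmorphism rat -> R})).
rewrite -sub1mx; apply/row_subP => i.
pose x : 'rV[R]_(n.*2) := row i 1%:M.
have full : row_full (map_mx QC t_mx *m B) by rewrite /row_full rank_span.
have /submxP[c hc] := submx_full (map_mx (real_complex R) x *m B) full.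
have [r hr] := real_interpolation c.
have : map_mx (real_complex R) (x - r *m map_mx (ratr : rat -> R) t_mx) *m B = 0.
  rewrite map_mxB mulmxBl hc mulmxA hr map_mxM.
  rewrite (_ : map_mx (real_complex R) (map_mx _ t_mx) = map_mx QC t_mx) ?subrr //.
  by apply/matrixP => a b; rewrite !mxE ratr_real_complex.
move=> /Bfree/eqP; rewrite subr_eq0 => /eqP xE.
by rewrite -/x xE submxMl.
Qed.

Lemma theta_widen (N : nat) (h : {poly rat}) : (size h <= N)%N -> theta h = \sum_(i < N) h`_i *: t i.
Proof.
move=> sN; rewrite /theta (big_ord_widen N (fun i => h`_i *: t i) sN).
rewrite big_mkcond; apply: eq_bigr => i _; case: ltnP => // hi.
by rewrite nth_default // scale0r.
Qed.

Lemma thetaD g h : theta (g + h) = theta g + theta h.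
Proof.
have : map_mx QC (theta (g + h)) = map_mx QC (theta g + theta h).
  by rewrite map_mxD -!Psi_rat rmorphD /=; exact: PsiD.
move=> /matrixP e; apply/matrixP => i j; apply: (fmorph_inj (ratr : {rmorphism rat -> C})).
by have := e i j; rewrite !mxE.
Qed.

Lemma theta_mod h : theta (h %% PhiQ q) = theta h.
Proof. by rewrite [in RHS](divp_eq h (PhiQ q)) thetaD [theta (_ * _)]theta_eq0 ?add0r // dvdp_mull. Qed.

Lemma thetaXn i : theta 'X^i = t i.
Proof.
rewrite /theta size_polyXn big_ord_recr /= big1 ?add0r => [|j _]; rewrite coefXn.
  by rewrite eqxx scale1r.
by rewrite ltn_eqF ?ltn_ord // scale0r.
Qed.

Lemma thetaMXn (h : {poly rat}) i : theta (h * 'X^i) = \sum_(l < size h) h`_l *: t (i + l)%N.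
Proof.
rewrite (@theta_widen (i + size h)); last first.
  by rewrite (leq_trans (size_polyMleq _ _)) // size_polyXn addnS addnC.
rewrite big_split_ord /= big1 ?add0r => [|k _]; last by rewrite coefMXn ltn_ord scale0r.
by apply: eq_bigr => k _; rewrite coefMXn ltnNge leq_addr /= addKn.
Qed.

Lemma size_mod_PhiQ h : (size (h %% PhiQ q)%R <= totient q)%N.
Proof.
by rewrite -ltnS -size_PhiQ ltn_modp -size_poly_gt0 size_PhiQ.
Qed.

(** Both sides are the dimension of Q[X] / (Phi_q): [theta] is injective on it by regularity and
    onto by simplicity. *)
Lemma dim_eq_totient : n.*2 = totient q.
Proof.
pose Y : 'M[rat]_(totient q, n.*2) := \matrix_(i < totient q) t i.
have Yrow (x : 'rV[rat]_(totient q)) : x *m Y = theta (rVpoly x).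
  rewrite (theta_widen (size_poly _ _)) mulmx_sum_row; apply: eq_bigr => i _.
  by rewrite coef_rVpoly_ord rowK.
have free : row_free Y.
  apply/row_freeP; exists (pinvmx Y).
  have : kermx Y = 0.
    apply/eqP; rewrite -submx0; apply/row_subP => i.
    have : row i (kermx Y) *m Y = 0 by rewrite -row_mul mulmx_ker row0.
    rewrite Yrow => /theta_inj hd; rewrite submx0; apply/eqP.
    have : rVpoly (row i (kermx Y)) = 0.
      apply/eqP; apply: contraTT hd => n0; apply/negP => /(dvdp_leq n0).
      by rewrite size_PhiQ ltnNge size_poly.
    by move=> e; rewrite -[LHS]rVpolyK e linear0.
  by move/eqP; rewrite kermx_eq0; exact: mulmxVp.
have full : row_full Y.
  rewrite /row_full eqn_leq rank_leq_col -{1}(eqP t_mx_row_full) mxrankS //.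
  apply/row_subP => i; rewrite rowK -thetaXn -theta_mod.
  rewrite (theta_widen (size_mod_PhiQ _)).
  apply: summx_sub => k _; apply: scalemx_sub.
  by rewrite -[t k](rowK (fun k : 'I_(totient q) => t k)) row_sub.
by rewrite -(eqP full) (eqP free).
Qed.

(** Multiplication by X on Q[X] / (Phi_q), transported through [theta]. The matrix is defined by the
    first [n.*2] vectors [t i]; reduction modulo [PhiQ q] extends the shift to all of them. *)
Lemma exists_CM_by : exists T : 'M[rat]_(n.*2), CM_by q T B.
Proof.
have e := dim_eq_totient.
pose Y : 'M[rat]_(n.*2) := \matrix_(i < n.*2) t i.
pose Y' : 'M[rat]_(n.*2) := \matrix_(i < n.*2) t i.+1.
have Yrow (x : 'rV[rat]_(n.*2)) : x *m Y = theta (rVpoly x).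
  rewrite (theta_widen (size_poly _ _)) mulmx_sum_row; apply: eq_bigr => i _.
  by rewrite coef_rVpoly_ord rowK.
have Yu : Y \in unitmx.
  rewrite -row_free_unit -kermx_eq0 -submx0; apply/row_subP => i.
  have : row i (kermx Y) *m Y = 0 by rewrite -row_mul mulmx_ker row0.
  rewrite Yrow => /theta_inj hd; rewrite submx0; apply/eqP.
  have : rVpoly (row i (kermx Y)) = 0.
    apply/eqP; apply: contraTT hd => n0; apply/negP => /(dvdp_leq n0).
    by rewrite size_PhiQ -e ltnNge size_poly.
  by move=> e0; rewrite -[LHS]rVpolyK e0 linear0.
pose T := invmx Y *m Y'.
have tT0 i : (i < n.*2)%N -> t i *m T = t i.+1.
  move=> hi; have -> : t i = row (Ordinal hi) Y by rewrite rowK.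
  by rewrite -row_mul mulKVmx // rowK.
have thT (h : {poly rat}) : (size h <= n.*2)%N -> theta h *m T = theta (h * 'X).
  move=> sh; rewrite (theta_widen sh) mulmx_suml.
  rewrite (@theta_widen n.*2.+1) ?(leq_trans (size_polyMleq _ _)) ?size_polyX ?addn2 //.
  rewrite big_ord_recl coefMX /= scale0r add0r; apply: eq_bigr => i _.
  by rewrite -scalemxAl tT0 // coefMX.
have tT i : t i *m T = t i.+1.
  rewrite -[in LHS]thetaXn -theta_mod thT; last by rewrite e size_mod_PhiQ.
  by rewrite -theta_mod [_ * 'X]mulrC modp_mul theta_mod -exprS thetaXn.
have tTn k i : t i *m T ^+ k = t (i + k)%N.
  elim: k i => [|k IH] i; first by rewrite expr0 mulmx1 addn0.
  by rewrite exprS [T * _]/(T *m _) mulmxA tT IH addSnnS.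
have span (A : 'M[C]_(n.*2, n)) : (forall i, map_mx QC (t i) *m A = 0) -> A = 0.
  move=> hA; have Yc : map_mx QC Y \in unitmx by rewrite map_unitmx.
  rewrite -[A](mulKmx Yc) (_ : map_mx QC Y *m A = 0) ?mulmx0 //.
  apply/row_matrixP => i; rewrite row0 row_mul -[RHS](hA i).
  by congr (_ *m _); apply/matrixP => a b; rewrite !mxE ord1.
have spanQ (A : 'M[rat]_(n.*2)) : (forall i, t i *m A = 0) -> A = 0.
  move=> hA; rewrite -[A](mulKmx Yu) (_ : Y *m A = 0) ?mulmx0 //.
  apply/row_matrixP => i; rewrite row0 row_mul -[RHS](hA i).
  by rewrite rowK.
exists T; split => //.
- apply/eqP; rewrite -subr_eq0; apply/eqP; apply: spanQ => i.
  rewrite mulmxBr tTn mulmx1; apply/eqP; rewrite subr_eq0; apply/eqP.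
  apply/eqP; rewrite -subr_eq0; apply/eqP; apply: rat_basis_inj.
  rewrite map_mxB mulmxBl !tB -sumrB big1 // => b _.
  by rewrite mulnDr exprD [(b * q)%N]mulnC [om ^+ (q * b)]exprM croot_unity // expr1n mulr1 subrr.
- apply: spanQ => i; rewrite /poly_mx mulmx_sumr -[RHS](theta_eq0 (dvdp_mulr 'X^i (dvdpp (PhiQ q)))).
  by rewrite thetaMXn; apply: eq_bigr => k _; rewrite -scalemxAr tTn.
- move=> b hb; apply: span => i.
  have -> : map_mx QC (t i) *m (eigenproj R q T (q.-1 * b) *m B) = Psi ('X^i * delta R q (q.-1 * b)) *m B.
    rewrite mulmxA; congr (_ *m _); rewrite /eigenproj /delta poly_def mulr_sumr Psi_sum.
    rewrite -scalemxAr mulmx_sumr scaler_sumr; apply: eq_bigr => k _.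
    rewrite -scalerAr -exprD PsiZ PsiXn -scalemxAr scalerA; congr (_ *: _).
    by rewrite -map_mxM tTn.
  rewrite Psi_mulB big_seq big1 // => a ha.
  by rewrite hornerM horner_delta // half_neg_mod // mulr0 scale0r.
Qed.

End TorusData.

(** * From the periods of the Jacobian to a simple factor *)

Section Decomposition.
Variable R : realType.
Local Notation C := R[i].
Local Notation QC := (ratr : rat -> C).
Local Notation toC := (map_poly (ratr : rat -> C)).

Lemma croot_dvd q r : (0 < q)%N -> (0 < r)%N -> croot R (q * r) ^+ r = croot R q.
Proof.
move=> q0 r0; rewrite crootX /croot; congr (cexp (0 +i* _)).
have q1 : q%:R != 0 :> R by rewrite pnatr_eq0 -lt0n.
have r1 : r%:R != 0 :> R by rewrite pnatr_eq0 -lt0n.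
by rewrite natrM -mulr_natr invfM mulrA divfK.
Qed.

Definition geom m : {poly rat} := \sum_(i < m) 'X^i.

Lemma geomE m : (0 < m)%N -> geom m = \prod_(d <- rem 1%N (divisors m)) PhiQ d.
Proof.
move=> m0; have P1 : PhiQ 1 = 'X - 1 by rewrite -(expr1 'X) -prod_PhiQ // big_seq1.
have n0 : 'X - 1 != 0 :> {poly rat} by rewrite polyXsubC_eq0.
by apply: (mulfI n0); rewrite /geom -subrX1 -P1 -prod_PhiQ // (big_rem 1%N (divisor1 m)).
Qed.

Lemma size_geom m : (0 < m)%N -> size (geom m) = m.
Proof.
move=> m0; have n0 : 'X - 1 != 0 :> {poly rat} by rewrite polyXsubC_eq0.
have g0 : geom m != 0.
  apply: contraTneq (monicXnsubC (1 : rat) m0) => e; rewrite polyC1 subrX1 -/(geom m) e mulr0.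
  by rewrite monicE lead_coef0 eq_sym oner_eq0.
have := size_mul n0 g0; rewrite -subrX1 -polyC1 size_XnsubC // size_XsubC.
by move=> [].
Qed.

Lemma geom_root m a : (0 < a)%N -> (a < m)%N -> (toC (geom m)).[croot R m ^+ a] = 0.
Proof.
move=> a0 am; have m0 : (0 < m)%N by exact: leq_trans am.
have hz := croot_prim R m0.
have z1 : croot R m ^+ a - 1 != 0.
  rewrite subr_eq0 -(prim_order_dvd hz); apply/negP => /(dvdn_leq a0).
  by rewrite leqNgt am.
apply: (mulfI z1); rewrite mulr0.
rewrite /geom raddf_sum horner_sum.
under eq_bigr => i _ do rewrite /= map_polyXn hornerXn.
by rewrite -subrX1 -exprM mulnC exprM croot_unity // expr1n subrr.
Qed.

(* Bezout: a vector killed by a product of pairwise coprime polynomials has a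
   component killed by one of them. *)
Lemma primary_component (V : zmodType) (psi : {poly rat} -> V) (D : {poly rat}) (s : seq nat) f :
  (forall f g, psi (f + g) = psi f + psi g) -> (forall f, D %| f -> psi f = 0) ->
  uniq s -> all (fun d => 0 < d)%N s -> D %| f * \prod_(d <- s) PhiQ d -> psi f <> 0 ->
  exists2 d, d \in s & exists2 h, D %| h * PhiQ d & psi h <> 0.
Proof.
move=> psiD psi0; elim: s f => [|d s IH] f /=.
  by move=> _ _; rewrite big_nil mulr1 => /psi0.
move=> /andP[ds us] /andP[d0 s0]; rewrite big_cons => hD hf.
set P := \prod_(d <- s) PhiQ d in hD.
have cP : coprimep (PhiQ d) P.
  rewrite /P big_seq; apply: (big_ind (fun x => coprimep (PhiQ d) x)).
  - exact: coprimep1.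
  - by move=> x y hx hy; rewrite coprimepMr hx.
  - move=> e es; apply: coprimep_PhiQ => //; first by apply: (allP s0).
    by apply: contraNneq ds => ->.
have [[u v] /=] := Bezout_eq1_coprimepP _ _ cP => uv.
have fE : f = f * (u * PhiQ d) + f * (v * P) by rewrite -mulrDr uv mulr1.
have [h1|h1] := pselect (psi (f * (v * P)) = 0).
  have [||e es he] := IH (f * (u * PhiQ d)) us s0.
  - rewrite -/P (_ : _ * P = u * (f * (PhiQ d * P))); last by ring.
    exact: dvdp_mull.
  - by move=> h2; apply: hf; rewrite fE psiD h1 h2 addr0.
  by exists e => //; rewrite inE es orbT.
exists d; first by rewrite inE eqxx.
exists (f * (v * P)) => //.
rewrite (_ : _ * PhiQ d = v * (f * (PhiQ d * P))); last by ring.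
exact: dvdp_mull.
Qed.

Lemma span_over0 n (S : set 'rV[C]_n) : span_over (fun a : int => a%:~R : C) S 0.
Proof.
exists 0%N, (fun=> 0), (fun=> 0); split; first by case.
by rewrite big_ord0.
Qed.

Lemma span_over_sub n (S : set 'rV[C]_n) v : S v -> span_over (fun a : int => a%:~R : C) S v.
Proof.
move=> Sv; exists 1%N, (fun=> 1), (fun=> v); split => //.
by rewrite big_ord1 scale1r.
Qed.

Variables (g n n' : nat).
Local Notation m := g.*2.+1.
Local Notation gg := (genus m).
Variables (L : set 'rV[C]_n) (L' : set 'rV[C]_n') (J : set 'rV[C]_gg).
Variables (B : 'M[C]_(n.*2, n)) (B' : 'M[C]_(n'.*2, n')).
Hypotheses (LB : lattice_basis B L) (LB' : lattice_basis B' L').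
Hypothesis n_gt0 : (0 < n)%N.
Hypothesis iso : isogenous (prod_torus L L') J.
Variable kappa : nat -> C.
Local Notation zeta := (croot R m).
Hypothesis J_form : forall v, J v -> exists P : {poly rat}, forall i,
  v 0 i = kappa i * (toC P).[zeta ^+ i.+1].

Let genusE : gg = g. Proof. by rewrite /genus /= doubleK. Qed.

Definition evr (P : {poly rat}) : 'rV[C]_gg := \row_i (kappa i * (toC P).[zeta ^+ i.+1]).

Lemma evrD P Q : evr (P + Q) = evr P + evr Q.
Proof. by apply/matrixP => i j; rewrite !mxE rmorphD hornerD mulrDr. Qed.

Lemma evrZ a P : evr (a *: P) = QC a *: evr P.
Proof. by apply/matrixP => i j; rewrite !mxE map_polyZ hornerZ /=; ring. Qed.

Lemma evr_dvd P : geom m %| P -> evr P = 0.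
Proof.
move=> hP; apply/matrixP => i j; rewrite !mxE.
have /rootP -> : root (toC P) (zeta ^+ j.+1); last by rewrite mulr0.
apply: root_map_dvdp hP _; apply/rootP; apply: geom_root => //.
by rewrite ltnS (leq_trans (ltn_ord j)) // genusE -addnn leq_addr.
Qed.

Lemma evr_mod P : evr (P %% geom m) = evr P.
Proof. by rewrite [in RHS](divp_eq P (geom m)) evrD [evr (_ * _)]evr_dvd ?add0r // dvdp_mull. Qed.

Lemma evr_sum (I : finType) (c : I -> rat) (P : I -> {poly rat}) :
  evr (\sum_i c i *: P i) = \sum_i QC (c i) *: evr (P i).
Proof.
elim/big_ind2: _ => [|x1 x2 y1 y2 <- <-|i _].
- by apply: evr_dvd; exact: dvdp0.
- exact: evrD.
- exact: evrZ.
Qed.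

(** The form of the periods embeds the rational vectors of the two lattices into polynomials modulo
    [geom m]. Both spaces have dimension [2 g], so every class comes from a unique pair of rational
    vectors; [psi] is the component in the factor [L], and [M'] the corresponding projection of
    tangent spaces. *)
Lemma exists_psi : exists (M' : 'M[C]_(gg, n)) (psi : {poly rat} -> 'rV[rat]_(n.*2)),
  (forall f, map_mx QC (psi f) *m B = evr f *m M') /\ exists f, psi f <> 0.
Proof.
have [M [Mfree Mfull MJ]] := iso.
have [LBs Bfree] := LB; have [LBs' Bfree'] := LB'.
have dimE : (n + n' = gg)%N by rewrite -(eqP Mfree) (eqP Mfull).
have H1 (j : 'I_(n.*2)) : exists P, row_mx (row j B) 0 *m M = evr P.
  have [|P hP] := J_form (MJ (row_mx (row j B) 0) _).
    exists (row j B), 0; split => //; rewrite ?LBs ?LBs'; last exact: span_over0.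
    by apply: span_over_sub; exists j.
  by exists P; apply/matrixP => a b; rewrite ord1 hP mxE.
have H2 (j : 'I_(n'.*2)) : exists P, row_mx 0 (row j B') *m M = evr P.
  have [|P hP] := J_form (MJ (row_mx 0 (row j B')) _).
    exists 0, (row j B'); split => //; rewrite ?LBs ?LBs'; first exact: span_over0.
    by apply: span_over_sub; exists j.
  by exists P; apply/matrixP => a b; rewrite ord1 hP mxE.
have [P1 hP1] := boolp.choice H1; have [P2 hP2] := boolp.choice H2.
pose X1 : 'M[rat]_(n.*2, g.*2) := \matrix_(j < n.*2) poly_rV (P1 j %% geom m).
pose X2 : 'M[rat]_(n'.*2, g.*2) := \matrix_(j < n'.*2) poly_rV (P2 j %% geom m).
pose X := col_mx X1 X2.
have szmod P : (size (P %% geom m)%R <= g.*2)%N.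
  have gm0 : geom m != 0 by rewrite -size_poly_gt0 size_geom.
  by have := ltn_modpN0 P gm0; rewrite size_geom.
have evX (x1 : 'rV[rat]_(n.*2)) (x2 : 'rV[rat]_(n'.*2)) :
    evr (rVpoly (row_mx x1 x2 *m X)) = row_mx (map_mx QC x1 *m B) (map_mx QC x2 *m B') *m M.
  have e1 : rVpoly (x1 *m X1) = \sum_j x1 0 j *: (P1 j %% geom m).
    rewrite mulmx_sum_row linear_sum; apply: eq_bigr => j _.
    by rewrite linearZ /= rowK poly_rV_K.
  have e2 : rVpoly (x2 *m X2) = \sum_j x2 0 j *: (P2 j %% geom m).
    rewrite mulmx_sum_row linear_sum; apply: eq_bigr => j _.
    by rewrite linearZ /= rowK poly_rV_K.
  rewrite mul_row_col linearD /= evrD e1 e2 !evr_sum.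
  rewrite -[row_mx _ _]addr0 -[X in row_mx X _ + _]addr0.
  have -> : row_mx (map_mx QC x1 *m B + 0) (map_mx QC x2 *m B') + 0 =
     row_mx (map_mx QC x1 *m B) 0 + row_mx 0 (map_mx QC x2 *m B') :> 'rV[C]_(n + n').
    by rewrite add_row_mx !addr0 add0r.
  rewrite mulmxDl; congr (_ + _).
    rewrite [map_mx QC x1 *m B]mulmx_sum_row.
    have -> : row_mx (\sum_i map_mx QC x1 0 i *: row i B) (0 : 'rV[C]_n') =
       \sum_i QC (x1 0 i) *: row_mx (row i B) 0.
      rewrite (big_morph (fun y => row_mx y (0 : 'rV[C]_n')) (id1 := 0) (op1 := +%R)).
      - by apply: eq_bigr => i _; rewrite scale_row_mx scaler0 mxE.
      - by move=> y y'; rewrite add_row_mx addr0.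
      - exact: row_mx0.
    rewrite mulmx_suml; apply: eq_bigr => j _.
    by rewrite -scalemxAl hP1 evr_mod.
  rewrite [map_mx QC x2 *m B']mulmx_sum_row.
  have -> : row_mx (0 : 'rV[C]_n) (\sum_i map_mx QC x2 0 i *: row i B') =
     \sum_i QC (x2 0 i) *: row_mx 0 (row i B').
    rewrite (big_morph (fun y => row_mx (0 : 'rV[C]_n) y) (id1 := 0) (op1 := +%R)).
    - by apply: eq_bigr => i _; rewrite scale_row_mx scaler0 mxE.
    - by move=> y y'; rewrite add_row_mx addr0.
    - exact: row_mx0.
  rewrite mulmx_suml; apply: eq_bigr => j _.
  by rewrite -scalemxAl hP2 evr_mod.
have Xfree : row_free X.
  rewrite -kermx_eq0 -submx0; apply/row_subP => i; rewrite submx0.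
  set x := row i (kermx X).
  have : x *m X = 0 by rewrite -row_mul mulmx_ker row0.
  rewrite -[x]hsubmxK => hx.
  have := evX (lsubmx x) (rsubmx x); rewrite hx linear0 evr_dvd ?dvdp0 // => /esym/eqP.
  rewrite -[X in _ == X](mul0mx _ M) => /eqP/(row_free_inj Mfree).
  rewrite -row_mx0 => /eq_row_mx[h1 h2].
  by rewrite (rat_basis_inj Bfree h1) (rat_basis_inj Bfree' h2) row_mx0.
have Xfull : row_full X.
  by rewrite /row_full (eqP Xfree) -doubleD dimE genusE.
pose M' := lsubmx (pinvmx M).
have Hpsi f : exists x : 'rV[rat]_(n.*2), map_mx QC x *m B = evr f *m M'.
  have /submxP[x hx] := submx_full (poly_rV (f %% geom m)) Xfull.
  exists (lsubmx x).
  have := evX (lsubmx x) (rsubmx x); rewrite hsubmxK -hx poly_rV_K // evr_mod => ->.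
  by rewrite /M' mulmx_lsub -mulmxA mulmxVp // mulmx1 row_mxKl.
have [psi hpsi] := boolp.choice Hpsi.
exists M', psi; split => //.
have n2 : (0 < n.*2)%N by rewrite double_gt0.
exists (P1 (Ordinal n2)) => e0.
have := hpsi (P1 (Ordinal n2)); rewrite e0 map_mx0 mul0mx -hP1 /M' mulmx_lsub -mulmxA mulmxVp //.
rewrite mulmx1 row_mxKl => /esym rB0.
have hB : map_mx (real_complex R) (delta_mx (0 : 'I_1) (Ordinal n2)) *m B = 0.
  rewrite (_ : map_mx _ _ = delta_mx (0 : 'I_1) (Ordinal n2)) -?rowE //.
  by apply/matrixP => a b; rewrite !mxE rmorph_nat.
have := congr1 (fun A : 'rV_(n.*2) => A 0 (Ordinal n2)) (Bfree _ hB).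
by rewrite !mxE !eqxx => /eqP; rewrite oner_eq0.
Qed.

(** A component of [psi] killed by a single [PhiQ q] only sees the differentials on which the
    rotation of the curve has order exactly [q], i.e. [j.+1 = r * b] with [r = m / q] and [b] prime
    to [q]; the bound [j < g] puts [b] below [q / 2]. *)
Lemma exists_torus_data : exists (q : nat) (t : nat -> 'rV[rat]_(n.*2)) (Z : nat -> 'rV[C]_n),
  [/\ (q %| m)%N, (1 < q)%N, t 0%N != 0
    & forall i, map_mx QC (t i) *m B = \sum_(b <- halfunits q) croot R q ^+ (b * i) *: Z b].
Proof.
have [M' [psi [hpsi [f0 hf0]]]] := exists_psi.
have inj := rat_basis_inj LB.2.
have psiD f h : psi (f + h) = psi f + psi h.
  apply/eqP; rewrite -subr_eq0; apply/eqP; apply: inj.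
  by rewrite map_mxB map_mxD mulmxBl mulmxDl !hpsi evrD mulmxDl subrr.
have psi0 f : geom m %| f -> psi f = 0.
  by move=> hf; apply: inj; rewrite hpsi evr_dvd // mul0mx.
have m0 : (0 < m)%N by [].
have [||||q qs [h hD hh]] := primary_component psiD psi0 (s := rem 1%N (divisors m)) (f := f0).
- exact/rem_uniq/divisors_uniq.
- by apply/allP => d /mem_rem; rewrite -dvdn_divisors // => /dvdn_gt0 ->.
- by rewrite -geomE // dvdp_mull.
- exact: hf0.
have := qs; rewrite mem_rem_uniq ?divisors_uniq // !inE -dvdn_divisors // => /andP[q1 qm].
have q0 : (0 < q)%N by apply: dvdn_gt0 qm.
have qgt1 : (1 < q)%N by rewrite ltn_neqAle eq_sym q1.
have oq : odd q by apply: (dvdn_odd qm); rewrite /= odd_double.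
pose r := (m %/ q)%N.
have mE : m = (q * r)%N by rewrite mulnC divnK.
have r0 : (0 < r)%N by rewrite divn_gt0 // dvdn_leq.
have zr : croot R m ^+ r = croot R q by rewrite [in LHS]mE croot_dvd.
have zm := croot_prim R m0.
pose c (j : 'I_gg) := kappa j * (toC h).[croot R m ^+ j.+1].
(* At most one [j] contributes; the sum supplies the default 0 when [a] is not of the form
   [j.+1]. *)
pose w a := \sum_(j < gg | j.+1 == a :> nat) c j *: row j M'.
exists q, (fun i => psi (h * 'X^i)), (fun b => w (r * b)%N); split => //.
  by rewrite expr0 mulr1; apply/eqP.
move=> i; rewrite hpsi mulmx_sum_row.
under [RHS]eq_bigr => b _ do rewrite scaler_sumr.
rewrite (exchange_big_dep xpredT) //=; apply: eq_bigr => j _.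
rewrite mxE rmorphM /= map_polyXn hornerM hornerXn mulrA -/(c j).
have [c0|cn0] := eqVneq (c j) 0.
  by rewrite c0 mul0r scale0r big1 // => b _; rewrite scaler0.
have hz : q.-primitive_root (croot R m ^+ j.+1).
  apply: (root_PhiQ q0); have jm : (j.+1 < m)%N.
    by rewrite ltnS (leq_trans (ltn_ord j)) // genusE -addnn leq_addr.
  have /(root_map_dvdp hD) : root (toC (geom m)) (croot R m ^+ j.+1) by apply/rootP/geom_root.
  rewrite rmorphM rootM => /orP[/rootP e|//].
  by move: cn0; rewrite /c e mulr0 eqxx.
have rj : (r %| j.+1)%N.
  have := prim_expr_order hz; rewrite -exprM => /eqP.
  by rewrite -(prim_order_dvd zm) [X in (X %| _)%N]mE mulnC dvdn_pmul2r.
have [b jE] : exists b, j.+1 = (r * b)%N by exists (j.+1 %/ r)%N; rewrite mulnC divnK.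
have hb : b \in halfunits q.
  rewrite halfunitsP //; apply/and3P; split.
  - by case: b jE => //; rewrite muln0.
  - have : (r * b <= g)%N by rewrite -jE -[g in (_ <= g)%N]genusE.
    by move: mE r0; nia.
  - move: hz; rewrite jE exprM zr => hz.
    have qz := croot_prim R q0.
    have := prim_root_exp_coprime b qz.
    by rewrite hz coprime_sym.
have -> : \sum_(b0 <- halfunits q | j.+1 == (r * b0)%N) croot R q ^+ (b0 * i) *: (c j *: row j M') =
  \sum_(b0 <- halfunits q | b0 == b) croot R q ^+ (b0 * i) *: (c j *: row j M').
  by apply: eq_bigl => b0; rewrite jE eqn_pmul2l // eq_sym.
rewrite big_mkcond (bigD1_seq b) ?halfunits_uniq //= eqxx big1 ?addr0; last by move=> b' /negbTE ->.
by rewrite scalerA mulrC -zr -!exprM jE mulnA.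
Qed.

End Decomposition.

(** * Complex multiplication by roots of unity *)

Section Eigenprojections.
Variable R : realType.
Local Notation C := R[i].
Local Notation QC := (ratr : rat -> C).
Local Notation toC := (map_poly (ratr : rat -> C)).
Variables (q N : nat) (T : 'M[rat]_N).
Hypotheses (q_gt1 : (1 < q)%N) (Tq : T ^+ q = 1) (TPhi : poly_mx T (PhiQ q) = 0).
Hypothesis dimE : N = totient q.
Local Notation om := (croot R q).
Local Notation pi b := (eigenproj R q T b).
Local Notation P k := (map_mx QC (T ^+ k)).

Let q_gt0 : (0 < q)%N := ltnW q_gt1.
Let om_prim : q.-primitive_root om := croot_prim R q_gt0.

Let N_gt0 : (0 < N)%N. Proof. by rewrite dimE totient_gt0. Qed.

Lemma powmxD j k : P (j + k) = P j *m P k.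
Proof. by rewrite exprD [T ^+ j * _]/(_ *m _) map_mxM. Qed.

Lemma powmx0 : P 0 = 1%:M.
Proof. by rewrite expr0 [1]/(1%:M) map_mx1. Qed.

Lemma om_mod a b : a = b %[mod q] -> om ^+ a = om ^+ b.
Proof. by move=> e; apply/eqP; rewrite (eq_prim_root_expr om_prim) e. Qed.

Lemma om_predM a : om ^+ a * om ^+ (q.-1 * a) = 1.
Proof.
rewrite -exprD -mulSn prednK // exprM croot_unity // expr1n //.
Qed.

Lemma eigenproj_mod b c : b = c %[mod q] -> pi b = pi c.
Proof.
move=> bc; rewrite /eigenproj; congr (_ *: _); apply: eq_bigr => i _; congr (_ *: _).
by apply: om_mod; rewrite -!mulnA -modnMmr -(modnMml b) bc modnMml modnMmr.
Qed.

Lemma eigenproj_powmx k b : pi b *m P k = om ^+ (b * k) *: pi b.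
Proof.
elim: k => [|k IH]; first by rewrite powmx0 mulmx1 muln0 expr0 scale1r.
rewrite -addn1 powmxD mulmxA IH -scalemxAl mulnDr exprD -scalerA muln1; congr (_ *: _).
rewrite /eigenproj -scalemxAl scalerA mulrC -scalerA; congr (_ *: _).
rewrite mulmx_suml scaler_sumr.
pose f i := om ^+ (q.-1 * b * i) *: P i.
have e i : om ^+ (q.-1 * b * i) *: P i *m P 1 = om ^+ b *: f i.+1.
  rewrite /f -scalemxAl -powmxD addn1 scalerA; congr (_ *: _).
  by rewrite mulnSr exprD mulrCA om_predM mulr1.
under eq_bigr => i _ do rewrite e.
rewrite -!scaler_sumr; congr (_ *: _).
have f0 : f 0%N = f q.
  by rewrite /f muln0 expr0 mulnC exprM croot_unity // expr1n Tq expr0.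
have := @big_ord_recl _ 0 +%R q (fun i : 'I_q.+1 => f i); rewrite big_ord_recr /= -f0 addrC => /addrI.
by move=> <-.
Qed.

Lemma powmx_eigenproj k b : P k *m pi b = om ^+ (b * k) *: pi b.
Proof.
rewrite -eigenproj_powmx /eigenproj -scalemxAl -scalemxAr; congr (_ *: _).
rewrite mulmx_suml mulmx_sumr; apply: eq_bigr => i _.
by rewrite -scalemxAl -scalemxAr -!powmxD addnC.
Qed.

Lemma eigenprojM b c : pi b *m pi c = (c == b %[mod q])%:R *: pi c.
Proof.
rewrite {1}/eigenproj -scalemxAl mulmx_suml.
under eq_bigr => i _ do rewrite -scalemxAl powmx_eigenproj scalerA.
rewrite -scaler_suml scalerA; congr (_ *: _).
rewrite -horner_delta // horner_poly mulr_sumr; apply: eq_bigr => i _.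
by rewrite mulrA -exprM.
Qed.

Lemma sum_eigenproj : \sum_(b < q) pi b = 1%:M.
Proof.
rewrite /eigenproj -scaler_sumr exchange_big /=.
have e (i : 'I_q) : q%:R^-1 *: \sum_(b < q) om ^+ (q.-1 * b * i) *: P i = (i == 0 :> nat)%:R *: P i.
  rewrite -scaler_suml scalerA; congr (_ *: _).
  have -> : (i == 0 :> nat) = (0 == i %[mod q])%N by rewrite mod0n modn_small // eq_sym.
  rewrite -horner_delta // horner_poly mulr_sumr; apply: eq_bigr => b _.
  by rewrite expr0 expr1n mulr1 -!mulnA [(b * i)%N]mulnC.
rewrite scaler_sumr; under eq_bigr => i _ do rewrite e.
rewrite (bigD1 (Ordinal q_gt0)) //= scale1r powmx0 big1 ?addr0 // => i i0.
rewrite (_ : (i == 0 :> nat) = false) ?scale0r //.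
by apply: contra_neqF i0 => /eqP e0; apply: val_inj.
Qed.

Lemma poly_eigenproj (h : {poly rat}) b :
  map_mx QC (poly_mx T h) *m pi b = (toC h).[om ^+ b] *: pi b.
Proof.
rewrite /poly_mx map_mx_sum mulmx_suml horner_coef size_map_poly scaler_suml.
apply: eq_bigr => i _.
by rewrite map_mxZ -scalemxAl powmx_eigenproj scalerA coef_map exprM.
Qed.

Lemma eigenproj_eq0 b : ~~ coprime b q -> pi b = 0.
Proof.
move=> cb; have := poly_eigenproj (PhiQ q) b; rewrite TPhi map_mx0 mul0mx => /esym/eqP.
rewrite scaler_eq0 => /orP[h|/eqP //]; case/negP: cb.
have := root_PhiQ q_gt0 h; rewrite -(prim_root_exp_coprime b om_prim).
by [].
Qed.

Lemma eigenproj_galois_eq0 b c : coprime b q -> coprime c q -> pi b = 0 -> pi c = 0.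
Proof.
move=> cb cc pb.
have pred_prim a : coprime a q -> q.-primitive_root (om ^+ (q.-1 * a)).
  by move=> ca; rewrite prim_root_exp_coprime // coprimeMl coprimePn.
pose f i j : {poly rat} := \poly_(k < q) (T ^+ k) i j.
have fE a i j : pi a i j = q%:R^-1 * (toC (f i j)).[om ^+ (q.-1 * a)].
  rewrite /eigenproj mxE summxE; congr (_ * _).
  rewrite (@horner_coef_wide _ q) ?(leq_trans (size_map_poly_leq _ _)) ?size_poly //; last first.
    by rewrite size_map_poly size_poly.
  by apply: eq_bigr => k _; rewrite !mxE coef_map coef_poly ltn_ord mulrC exprM.
apply/matrixP => i j; rewrite fE [RHS]mxE.
have qn0 : q%:R^-1 != 0 :> C by rewrite invr_eq0 pnatr_eq0 -lt0n.
rewrite (prim_root_galois (pred_prim b cb) (pred_prim c cc)) ?mulr0 //.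
by apply: (mulfI qn0); rewrite -fE pb mxE mulr0.
Qed.

(** The projections sum to 1, and those at non-units vanish. The entries at units are rational
    polynomials in primitive roots, so one vanishing projection would make all of them vanish. *)
Lemma eigenproj_neq0 b : coprime b q -> pi b != 0.
Proof.
move=> cb; apply/eqP => pb.
have : (1%:M : 'M[C]_N) = 0.
  rewrite -sum_eigenproj big1 // => c _.
  case: (boolP (coprime c q)) => cc; last exact: eigenproj_eq0.
  exact: eigenproj_galois_eq0 pb.
move/matrixP/(_ (Ordinal N_gt0) (Ordinal N_gt0)); rewrite !mxE eqxx => /eqP.
by rewrite oner_eq0.
Qed.

(* The matrix with the eigenvalue [x b] on the eigenspace of [om ^+ b]. *)
Definition diag_op (x : nat -> C) : 'M[C]_N := \sum_(b < q | coprime b q) x b *: pi b.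
Local Notation Dg := diag_op.

Lemma DgE x : Dg x = \sum_(b < q) x b *: pi b.
Proof.
rewrite [RHS](bigID (fun b : 'I_q => coprime b q)) /= [X in _ + X]big1 ?addr0 // => b cb.
by rewrite eigenproj_eq0 // scaler0.
Qed.

Lemma eq_Dg x y : (forall b, coprime b q -> x b = y b) -> Dg x = Dg y.
Proof. by move=> h; apply: eq_bigr => b /h ->. Qed.

Lemma Dg_eigenproj x b : (forall c d, c = d %[mod q] -> x c = x d) -> Dg x *m pi b = x b *: pi b.
Proof.
move=> xm; rewrite DgE mulmx_suml (bigD1 (Ordinal (ltn_pmod b q_gt0))) //=.
rewrite -scalemxAl eigenprojM modn_mod eqxx scale1r big1 ?addr0.
  by congr (_ *: _); apply: xm; rewrite modn_mod.
move=> c cb; rewrite -scalemxAl eigenprojM; case: eqP => [e|_]; last by rewrite scale0r scaler0.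
by case/eqP: cb; apply: val_inj; rewrite /= e modn_small.
Qed.

Lemma eigenproj_Dg x (b : 'I_q) : pi b *m Dg x = x b *: pi b.
Proof.
rewrite DgE mulmx_sumr (bigD1 b) //= -scalemxAr eigenprojM eqxx scale1r big1 ?addr0 // => c cb.
rewrite -scalemxAr eigenprojM !modn_small //; case: eqP => [e|_]; last by rewrite scale0r scaler0.
by case/eqP: cb; apply: val_inj.
Qed.

Lemma DgM x y : Dg x *m Dg y = Dg (fun b => x b * y b).
Proof.
rewrite {1}DgE mulmx_suml [RHS]DgE; apply: eq_bigr => b _.
by rewrite -scalemxAl eigenproj_Dg scalerA.
Qed.

Lemma DgD x y : Dg x + Dg y = Dg (fun b => x b + y b).
Proof. by rewrite -big_split; apply: eq_bigr => b _; rewrite scalerDl. Qed.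

Lemma DgZ a x : a *: Dg x = Dg (fun b => a * x b).
Proof. by rewrite scaler_sumr; apply: eq_bigr => b _; rewrite scalerA. Qed.

Lemma Dg1 : Dg (fun=> 1) = 1%:M.
Proof. by rewrite DgE -[RHS]sum_eigenproj; apply: eq_bigr => b _; rewrite scale1r. Qed.

Lemma powmx_Dg k : P k = Dg (fun b => om ^+ (b * k)).
Proof.
rewrite -[LHS]mulmx1 -sum_eigenproj mulmx_sumr DgE; apply: eq_bigr => b _.
exact: powmx_eigenproj.
Qed.

Lemma poly_mx_Dg h : map_mx QC (poly_mx T h) = Dg (fun b => (toC h).[om ^+ b]).
Proof.
rewrite -[LHS]mulmx1 -sum_eigenproj mulmx_sumr DgE; apply: eq_bigr => b _.
exact: poly_eigenproj.
Qed.

Lemma Dg_inj x y b : Dg x = Dg y -> (b < q)%N -> coprime b q -> x b = y b.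
Proof.
move=> h bq cb; have := eigenproj_Dg x (Ordinal bq); rewrite h eigenproj_Dg /= => /eqP.
rewrite -subr_eq0 -scalerBl scaler_eq0 (negbTE (eigenproj_neq0 cb)) orbF subr_eq0 => /eqP.
by move=> ->.
Qed.

Lemma Dg_unitmx x : (forall b, coprime b q -> x b != 0) -> Dg x \in unitmx.
Proof.
move=> x0; have h : Dg x *m Dg (fun b => (x b)^-1) = 1%:M.
  by rewrite DgM -Dg1; apply: eq_Dg => b cb; rewrite divff // x0.
by case: (mulmx1_unit h).
Qed.

(* The residues prime to [q] index a basis of eigenvectors. *)
Definition unit_res (i : 'I_N) : nat := nth 0%N [seq a <- iota 0 q | coprime a q] i.

Lemma size_units : size [seq a <- iota 0 q | coprime a q] = N.
Proof.
rewrite dimE totient_count_coprime size_filter -sum1_count big_mkcond /= /index_iota subn0.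
by apply: eq_bigr => a _; rewrite coprime_sym; case: coprime.
Qed.

Lemma unit_res_mem i : (unit_res i < q)%N /\ coprime (unit_res i) q.
Proof.
have : unit_res i \in [seq a <- iota 0 q | coprime a q] by rewrite mem_nth // size_units.
by rewrite mem_filter mem_iota => /and3P[].
Qed.

Lemma unit_res_inj : injective unit_res.
Proof.
move=> i j /eqP; rewrite nth_uniq ?size_units ?filter_uniq ?iota_uniq // => /eqP.
exact: val_inj.
Qed.

Lemma unit_res_surj b : coprime b q -> exists i, unit_res i = (b %% q)%N.
Proof.
move=> cb; have : (b %% q)%N \in [seq a <- iota 0 q | coprime a q].
  by rewrite mem_filter coprime_modl cb mem_iota add0n ltn_pmod.
by case/(nthP 0%N) => i; rewrite size_units => iN e; exists (Ordinal iN).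
Qed.

Lemma exists_eigenbasis : exists V : 'M[C]_N, V \in unitmx /\
  forall i c, row i V *m pi c = (unit_res i == c %[mod q])%:R *: row i V.
Proof.
have h i : exists v : 'rV[C]_N, v != 0 /\ v *m pi (unit_res i) = v.
  have [_ cb] := unit_res_mem i.
  have /rowV0Pn[v /submxP[D vE] v0] : pi (unit_res i) != 0 by exact: eigenproj_neq0.
  by exists v; split => //; rewrite vE -mulmxA eigenprojM eqxx scale1r.
have /boolp.choice[v hv] := h.
pose V : 'M[C]_N := \matrix_i v i; exists V.
have Vpi i c : row i V *m pi c = (unit_res i == c %[mod q])%:R *: row i V.
  rewrite rowK -{1}(hv i).2 -mulmxA eigenprojM -scalemxAr eq_sym.
  case: eqP => [e|_]; last by rewrite !scale0r.
  by rewrite -(eigenproj_mod e) (hv i).2.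
split=> //; rewrite -row_free_unit -kermx_eq0 -submx0; apply/row_subP => k.
set x := row k (kermx V); have xV : x *m V = 0 by rewrite -row_mul mulmx_ker row0.
rewrite submx0; apply/eqP/rowP => i; rewrite [RHS]mxE.
have : x *m V *m pi (unit_res i) = x 0 i *: v i.
  rewrite [x *m V]mulmx_sum_row mulmx_suml (bigD1 i) //= -scalemxAl Vpi eqxx scale1r rowK.
  rewrite big1 ?addr0 // => j ji; rewrite -scalemxAl Vpi !modn_small ?(unit_res_mem _).1 //.
  by case: eqP => [/unit_res_inj e|_]; [rewrite e eqxx in ji | rewrite scale0r scaler0].
rewrite xV mul0mx => /esym/eqP; rewrite scaler_eq0 => /orP[/eqP //|].
by rewrite (negbTE (hv i).1).
Qed.

End Eigenprojections.

(** * Signs of residues modulo an odd number *)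

Section Signs.
Variable q : nat.
Hypotheses (q_odd : odd q) (q_gt1 : (1 < q)%N).
Let q_gt0 : (0 < q)%N := ltnW q_gt1.

(* The sign of the residue of [b] in [-q / 2, q / 2], and 0 if [b] is not prime to [q]. *)
Definition eps (b : nat) : int :=
  ((b %% q)%N \in halfunits q)%:Z - ((q.-1 * b %% q)%N \in halfunits q)%:Z.

Lemma eps_mod b c : b = c %[mod q] -> eps b = eps c.
Proof. by move=> bc; rewrite /eps bc -(modnMmr q.-1 b) bc modnMmr. Qed.

Lemma predpred_mod b : q.-1 * (q.-1 * b) = b %[mod q].
Proof.
rewrite mulnA -modnMml; have -> : (q.-1 * q.-1 %% q = 1)%N; last by rewrite mul1n.
case: (q) q_gt1 => // [[//|r]] _ /=.
have -> : (r.+1 * r.+1 = r * r.+2 + 1)%N by lia.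
by rewrite modnMDl modn_small.
Qed.

Lemma epsN b : eps (q.-1 * b) = - eps b.
Proof. by rewrite /eps predpred_mod opprB. Qed.

Lemma neg_mod b : (b %% q != 0)%N -> (q.-1 * b %% q = q - b %% q)%N.
Proof.
move=> b0; rewrite -[RHS](@modn_small _ q); last by rewrite ltn_subrL lt0n b0.
apply/eqP; rewrite -(eqn_modDr (b %% q)%N) subnK ?modnn; last by rewrite ltnW ?ltn_pmod.
by rewrite modnDmr -mulSnr prednK // modnMr.
Qed.

Lemma coprime_mod_neq0 b : coprime b q -> (b %% q != 0)%N.
Proof.
move=> cb; apply: contraTneq cb => e; rewrite -coprime_modl e /coprime gcd0n.
by rewrite neq_ltn q_gt1 orbT.
Qed.

Lemma half_or b : coprime b q ->
  ((q.-1 * b %% q)%N \in halfunits q) = ((b %% q)%N \notin halfunits q).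
Proof.
move=> cb; have b0 := coprime_mod_neq0 cb; rewrite !halfunitsP // !coprime_modl coprimeMl cb coprimePn //=.
have bq : (b %% q < q)%N by rewrite ltn_pmod.
rewrite !andbT neg_mod // subn_gt0 bq lt0n b0 /=.
by move: (odd_double_half q); rewrite q_odd; lia.
Qed.

Lemma eps_half b : coprime b q -> eps b = if (b %% q)%N \in halfunits q then 1 else -1.
Proof. by move=> cb; rewrite /eps half_or //; case: (_ \in _). Qed.

End Signs.

(** * The Hodge circle and a unitary group containing it *)

Section CMStructure.
Variable R : realType.
Local Notation C := R[i].
Local Notation Re := (@complex.Re R).
Local Notation QC := (ratr : rat -> C).
Local Notation cj := (map_mx (@conjc R)).
Variables (q n : nat) (T : 'M[rat]_(n.*2)) (B : 'M[C]_(n.*2, n)).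
Hypotheses (q_odd : odd q) (q_gt1 : (1 < q)%N) (hCM : CM_by q T B).
Hypothesis Bfree : forall c : 'rV[R]_(n.*2), map_mx (real_complex R) c *m B = 0 -> c = 0.
Local Notation om := (croot R q).
Local Notation pi b := (eigenproj R q T b).
Local Notation P k := (map_mx QC (T ^+ k)).
Local Notation Dg := (@diag_op R q _ T).
Local Notation eps := (eps q).

Let q_gt0 : (0 < q)%N := ltnW q_gt1.
Let dimE : n.*2 = totient q. Proof. by case: hCM. Qed.
Let Tq : T ^+ q = 1. Proof. by case: hCM. Qed.
Let TPhi : poly_mx T (PhiQ q) = 0. Proof. by case: hCM. Qed.

Lemma eigenproj_neg_B b : b \in halfunits q -> pi (q.-1 * b) *m B = 0.
Proof. by case: hCM => _ _ _; apply. Qed.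

Lemma Dg_B x y : (forall b, coprime b q -> eps b = 1 -> x b = y b) -> Dg x *m B = Dg y *m B.
Proof.
move=> xy; rewrite /diag_op !mulmx_suml; apply: eq_bigr => b cb.
case: (boolP ((b %% q)%N \in halfunits q)) => hb.
  by rewrite xy // eps_half // hb.
rewrite -half_or // in hb.
have e : pi b = pi (q.-1 * (q.-1 * b %% q)).
  by apply: eigenproj_mod => //; rewrite modnMmr predpred_mod.
by rewrite e -scalemxAl eigenproj_neg_B // scaler0 -scalemxAl eigenproj_neg_B // scaler0.
Qed.

Lemma Dg_const z : Dg (fun=> z) = z%:M.
Proof.
rewrite -[RHS]scalemx1 -(Dg1 R q_gt1 Tq TPhi) DgZ; apply: eq_Dg => b _.
by rewrite mulr1.
Qed.

Lemma Dg_scale_B x z : (forall b, coprime b q -> eps b = 1 -> x b = z) -> Dg x *m B = z *: B.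
Proof. by move=> h; rewrite (@Dg_B x (fun=> z)) // Dg_const mul_scalar_mx. Qed.

Lemma conj_eigenproj b : cj (pi b) = pi (q.-1 * b).
Proof.
rewrite /eigenproj map_mxZ /= fmorphV rmorph_nat; congr (_ *: _).
rewrite map_mx_sum; apply: eq_bigr => i _; rewrite map_mxZ /=; congr (_ *: _).
  by rewrite conj_croot_exp // !mulnA.
by apply/matrixP => j k; rewrite !mxE conjc_ratr.
Qed.

Lemma eq_eigenproj (X Y : 'M[C]_(n.*2)) : (forall b, X *m pi b = Y *m pi b) -> X = Y.
Proof.
move=> h; rewrite -[X]mulmx1 -[Y]mulmx1 -(sum_eigenproj R T q_gt1) !mulmx_sumr.
by apply: eq_bigr => b _.
Qed.

(** For [|z| = 1], the action of the Hodge circle: [z] on the CM type and its conjugate [z^-1] on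
    the opposite exponents. Writing [z^-1] for the conjugate extends it to the complexified
    circle. *)
Definition circ (z : C) := Dg (fun b => z ^ eps b).

Lemma circ_B z : circ z *m B = z *: B.
Proof. by apply: Dg_scale_B => b _ ->; rewrite expr1z. Qed.

(** Conjugation exchanges the projections for [b] and [- b] and inverts [z]; as [eps] is odd, the
    two effects cancel. *)
Lemma circ_real z : `|z| = 1 -> cj (circ z) = circ z.
Proof.
move=> z1; have z0 : z != 0 by rewrite -normr_eq0 z1 oner_eq0.
have zJ : z^*%C = z^-1.
  by apply: (mulfI z0); rewrite -sqr_normc z1 expr1n divff.
have epm b c : b = c %[mod q] -> z ^ eps b = z ^ eps c by move=> /(eps_mod (q := q)) ->.
apply: eq_eigenproj => b.
have e : pi b = cj (pi (q.-1 * b)).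
  by rewrite conj_eigenproj; apply: eigenproj_mod => //; rewrite predpred_mod.
rewrite [in LHS]e -map_mxM /circ (Dg_eigenproj q_gt1 Tq TPhi) // map_mxZ /= -e (Dg_eigenproj q_gt1 Tq TPhi) //.
congr (_ *: _); rewrite epsN // -exprz_inv -zJ.
by case: (eps b) => k; [rewrite -!exprnP (rmorphXn (@conjc R)) | rewrite !NegzE -!invr_expz -!exprnP fmorphV (rmorphXn (@conjc R))];
   rewrite /= conjcK.
Qed.

Lemma hodge_circle_circ z : `|z| = 1 -> exists A, hodge_circle B A /\ map_mx (real_complex R) A = circ z.
Proof.
move=> z1; exists (map_mx Re (circ z)).
have e : map_mx (real_complex R) (map_mx Re (circ z)) = circ z.
  apply/matrixP => i j; have := congr1 (fun M : 'M[C]_(n.*2) => M i j) (circ_real z1).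
  by rewrite !mxE; case: (circ z i j) => a b /= [] /eqP; rewrite eqNr => /eqP ->.
by split => //; exists z; rewrite e circ_B.
Qed.

Lemma hodge_circleE A : hodge_circle B A -> exists z, `|z| = 1 /\ map_mx (real_complex R) A = circ z.
Proof.
move=> [z [z1 AB]]; exists z; split => //.
set AC := map_mx _ A in AB *.
have cA : cj AC = AC by apply/matrixP => i j; rewrite !mxE /= oppr0.
have h1 : (AC - circ z) *m B = 0 by rewrite mulmxBl AB circ_B subrr.
have h2 : (AC - circ z) *m cj B = 0.
  have -> : AC - circ z = cj (AC - circ z) by rewrite map_mxB cA circ_real.
  by rewrite -map_mxM h1 map_mx0.
apply/eqP; rewrite -subr_eq0; apply/eqP/row_matrixP => i; rewrite row0.
by apply: (basis_conj_inj Bfree); rewrite -row_mul ?h1 ?h2 row0.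
Qed.

Lemma Dg_powmx_comm x k : Dg x *m P k = P k *m Dg x.
Proof.
by rewrite (powmx_Dg R q_gt1 Tq TPhi) !(DgM q_gt1 Tq TPhi); apply: eq_Dg => b _; rewrite mulrC.
Qed.

(* The sum of the Gram matrices of the powers of [T]: a positive definite
   rational form for which [T] is orthogonal. *)
Definition gram : 'M[rat]_(n.*2) := \sum_(i < q) T ^+ i *m (T ^+ i)^T.

Lemma gram_unitmx : gram \in unitmx.
Proof.
rewrite -row_free_unit -kermx_eq0 -submx0; apply/row_subP => k; rewrite submx0.
set x := row k (kermx gram); have xG : x *m gram = 0 by rewrite -row_mul mulmx_ker row0.
have sq (y : 'rV[rat]_(n.*2)) : (y *m y^T) 0 0 = \sum_j y 0 j ^+ 2.
  by rewrite mxE; apply: eq_bigr => j _; rewrite mxE expr2.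
have : (x *m gram *m x^T) 0 0 = \sum_(i < q) \sum_j (x *m T ^+ i) 0 j ^+ 2.
  rewrite /gram mulmx_sumr mulmx_suml summxE; apply: eq_bigr => i _.
  by rewrite -sq trmx_mul !mulmxA.
rewrite xG mul0mx mxE => /esym/eqP; rewrite psumr_eq0; last first.
  by move=> i _; apply: sumr_ge0 => j _; exact: sqr_ge0.
move=> /allP/(_ (Ordinal q_gt0)); rewrite mem_index_enum => /(_ isT) /=.
rewrite expr0 mulmx1 psumr_eq0 => [/allP h|j _]; last exact: sqr_ge0.
apply/eqP/rowP => j; rewrite [RHS]mxE; have := h j; rewrite mem_index_enum => /(_ isT) /=.
by rewrite sqrf_eq0 => /eqP.
Qed.

Lemma gram_T : T *m gram *m T^T = gram.
Proof.
rewrite /gram mulmx_sumr mulmx_suml.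
pose f i := T ^+ i *m (T ^+ i)^T.
have e i : T *m (T ^+ i *m (T ^+ i)^T) *m T^T = f i.+1.
  by rewrite /f !exprS trmx_mul !mulmxA.
under eq_bigr => i _ do rewrite e.
have f0 : f 0%N = f q by rewrite /f Tq expr0.
have := @big_ord_recl _ 0 +%R q (fun i : 'I_q.+1 => f i); rewrite big_ord_recr /= -f0 addrC => /addrI.
by move=> <-.
Qed.

(** The transpose, and not the conjugate transpose, keeps the equations polynomial over Q. Together
    with commutation with [T] this is the unitary group of the field of q-th roots of unity. *)
Definition unitary_gp : set 'M[C]_(n.*2) := [set M |
  [/\ M \in unitmx, M *m map_mx QC T = map_mx QC T *m M
    & M *m map_mx QC gram *m M^T = map_mx QC gram]].

Let gramC_T : map_mx QC T *m map_mx QC gram *m (map_mx QC T)^T = map_mx QC gram.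
Proof.
have -> : (map_mx QC T)^T = map_mx QC T^T by apply/matrixP => i j; rewrite !mxE.
by rewrite -!map_mxM gram_T.
Qed.

Let P1 : P 1 = map_mx QC T. Proof. by rewrite expr1. Qed.

Section Basis.
Variable V : 'M[C]_(n.*2).
Hypotheses (V_unit : V \in unitmx)
  (Vpi : forall i c, row i V *m pi c = (unit_res q i == c %[mod q])%:R *: row i V).
Local Notation unit_res := (@unit_res q n.*2).

Lemma row_V_Dg x i : row i V *m Dg x = x (unit_res i) *: row i V.
Proof.
have [uq uc] := unit_res_mem dimE i.
rewrite (DgE q_gt1 Tq TPhi) mulmx_sumr (bigD1 (Ordinal uq)) //= -scalemxAr Vpi eqxx scale1r.
rewrite big1 ?addr0 // => b bi; rewrite -scalemxAr Vpi !modn_small //.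
case: eqP => [e|_]; last by rewrite scale0r scaler0.
by case/eqP: bi; apply: val_inj.
Qed.

Lemma row_V_T i : row i V *m map_mx QC T = om ^+ unit_res i *: row i V.
Proof. by rewrite -P1 (powmx_Dg R q_gt1 Tq TPhi) row_V_Dg muln1. Qed.

Definition gramV := V *m map_mx QC gram *m V^T.

Lemma gramV_unit : gramV \in unitmx.
Proof. by rewrite !unitmx_mul V_unit unitmx_tr V_unit map_unitmx gram_unitmx. Qed.

Lemma basis_change_entry (X : 'M[C]_(n.*2)) i j :
  (V *m X *m V^T) i j = (row i V *m X *m (row j V)^T) 0 0.
Proof.
rewrite mxE [RHS]mxE; apply: eq_bigr => k _; congr (_ * _); last by rewrite !mxE.
by rewrite -row_mul [RHS]mxE.
Qed.

Lemma gramV_scale (M : 'M[C]_(n.*2)) (x y : C) i j :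
  row i V *m M = x *: row i V -> row j V *m M = y *: row j V ->
  (V *m (M *m map_mx QC gram *m M^T) *m V^T) i j = x * y * gramV i j.
Proof.
move=> hx hy; rewrite /gramV !basis_change_entry.
have -> : row i V *m (M *m map_mx QC gram *m M^T) *m (row j V)^T =
    (row i V *m M) *m map_mx QC gram *m (row j V *m M)^T by rewrite trmx_mul !mulmxA.
by rewrite hx hy linearZ /= -!scalemxAl -scalemxAr scalerA mxE.
Qed.

(** [T] is an isometry, so two eigenvectors pair to 0 unless the product of their eigenvalues is
    1. *)
Lemma gramV_orth i j : gramV i j != 0 -> (unit_res i + unit_res j = 0 %[mod q])%N.
Proof.
move=> h; have := gramV_scale (row_V_T i) (row_V_T j); rewrite gramC_T -/gramV => /eqP.
rewrite eq_sym -subr_eq0 -[X in _ - X]mul1r -mulrBl mulf_eq0 (negbTE h) orbF subr_eq0 -exprD -[1](expr0 om) => /eqP/eqP.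
by rewrite (eq_prim_root_expr (croot_prim R q_gt0)) => /eqP.
Qed.

Lemma Dg_unitary x : (forall b, coprime b q -> x b != 0) ->
  (forall b c, coprime b q -> (b + c = 0 %[mod q])%N -> x b * x c = 1) -> unitary_gp (Dg x).
Proof.
move=> x0 xx; split.
- exact: (Dg_unitmx q_gt1 Tq TPhi).
- by rewrite -P1 Dg_powmx_comm.
- have VuT : V^T \in unitmx by rewrite unitmx_tr.
  apply: (can_inj (mulKmx V_unit)); apply: (can_inj (mulmxK VuT)); apply/matrixP => i j.
  transitivity (x (unit_res i) * x (unit_res j) * gramV i j).
    exact: gramV_scale (row_V_Dg x i) (row_V_Dg x j).
  change (x (unit_res i) * x (unit_res j) * gramV i j = gramV i j).
  have [-> |h] := eqVneq (gramV i j) 0; first by rewrite mulr0.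
  by rewrite xx ?mul1r //; [exact: (unit_res_mem dimE i).2 | exact: gramV_orth].
Qed.

(** Commuting with [T], whose eigenvalues are simple, makes [M] diagonal in the eigenbasis. The Gram
    matrix is nondegenerate, so each [i] pairs nontrivially with its opposite, and invariance gives
    the relation. *)
Lemma unitary_diag (M : 'M[C]_(n.*2)) : unitary_gp M ->
  exists x : 'I_(n.*2) -> C, (forall i, row i V *m M = x i *: row i V) /\
    forall i j, (unit_res i + unit_res j = 0 %[mod q])%N -> x i * x j = 1.
Proof.
move=> [Mu MT Mg].
have MP k : M *m P k = P k *m M.
  elim: k => [|k IH]; first by rewrite !powmx0 mulmx1 mul1mx.
  by rewrite -addn1 powmxD mulmxA IH -mulmxA P1 MT mulmxA.
have Mpi b : M *m pi b = pi b *m M.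
  rewrite /eigenproj -scalemxAr -scalemxAl mulmx_sumr mulmx_suml; congr (_ *: _).
  by apply: eq_bigr => k _; rewrite -scalemxAr -scalemxAl MP.
have h i : exists x, row i V *m M = x *: row i V.
  pose y := row i V *m M *m invmx V; exists (y 0 i).
  have e : row i V *m M = y *m V by rewrite /y mulmxKV.
  have pv : row i V *m M *m pi (unit_res i) = row i V *m M.
    by rewrite -mulmxA Mpi mulmxA Vpi eqxx scale1r.
  clearbody y; rewrite -[LHS]pv e [y *m V]mulmx_sum_row mulmx_suml (bigD1 i) //= -scalemxAl Vpi eqxx scale1r.
  rewrite big1 ?addr0 // => j ji; rewrite -scalemxAl Vpi !modn_small ?(unit_res_mem dimE _).1 //.
  by case: eqP => [/(unit_res_inj dimE) e2|_]; [rewrite e2 eqxx in ji | rewrite scale0r scaler0].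
have /boolp.choice[x hx] := h; exists x; split => // i j ij.
have [k hk] : exists k, gramV i k != 0.
  apply: contrapT => hn; have : row i gramV = 0.
    apply/rowP => k; rewrite [LHS]mxE [RHS]mxE; apply: contrapT => /eqP hk; apply: hn.
    by exists k.
  move/(congr1 (mulmx^~ (invmx gramV))); rewrite mul0mx -row_mul mulmxV ?gramV_unit //.
  by move/rowP/(_ i); rewrite !mxE eqxx => /eqP; rewrite oner_eq0.
have ik := gramV_orth hk.
have jk : j = k.
  apply: (unit_res_inj dimE); apply/eqP; have := unit_res_mem dimE j; have := unit_res_mem dimE k.
  move=> [kq _] [jq _]; rewrite -(modn_small kq) -(modn_small jq) -(eqn_modDl (unit_res i)).
  by rewrite ij ik.
have := gramV_scale (hx i) (hx k); rewrite Mg -/gramV jk => /eqP.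
rewrite eq_sym -subr_eq0 -[X in _ - X]mul1r -mulrBl mulf_eq0 (negbTE hk) orbF subr_eq0.
by move/eqP.
Qed.

End Basis.

Lemma circ_unitary z : z != 0 -> unitary_gp (circ z).
Proof.
move=> z0; have [V [Vu Vpi]] := exists_eigenbasis R q_gt1 Tq TPhi dimE.
apply: (Dg_unitary Vu Vpi) => [b _|b c cb bc]; first by rewrite expfz_neq0.
have -> : eps c = - eps b.
  rewrite -epsN //; apply: eps_mod; apply/eqP.
  by rewrite -(eqn_modDl b) bc -mulSn prednK // mod0n modnMr.
by rewrite -expfzDr // subrr expr0z.
Qed.

End CMStructure.

(** * The rank of the Hodge group *)

Lemma size_halfunits q : odd q -> (1 < q)%N -> ((size (halfunits q)).*2 = totient q)%N.
Proof.
move=> oq q1; rewrite totient_count_coprime big_mkord.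
under [RHS]eq_bigr => a _ do rewrite coprime_sym.
rewrite (@big_half _ _ _ q (fun a => coprime a q : nat)) //; last by move=> a /negbTE ->.
rewrite -muln2 -sum1_size big_distrl /=; apply: eq_big_seq => a; rewrite halfunitsP // => /and3P[a0 a2 ca].
have aq : (a <= q)%N by rewrite (leq_trans _ (ltnW a2)) // -addnn leq_addr.
by rewrite coprime_sub // ca.
Qed.

(** * Upper bound for the rank *)

Section Upper.
Variable R : realType.
Local Notation C := R[i].
Local Notation QC := (ratr : rat -> C).
Variables (q n : nat) (T : 'M[rat]_(n.*2)) (B : 'M[C]_(n.*2, n)).
Hypotheses (q_odd : odd q) (q_gt1 : (1 < q)%N) (hCM : CM_by q T B).
Hypothesis Bfree : forall c : 'rV[R]_(n.*2), map_mx (real_complex R) c *m B = 0 -> c = 0.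

Let q_gt0 : (0 < q)%N := ltnW q_gt1.
Let dimE : n.*2 = totient q. Proof. by case: hCM. Qed.
Let Tq : T ^+ q = 1. Proof. by case: hCM. Qed.
Let TPhi : poly_mx T (PhiQ q) = 0. Proof. by case: hCM. Qed.

Lemma size_half : size (halfunits q) = n.
Proof. by apply: double_inj; rewrite size_halfunits. Qed.

Definition half_unit (j : 'I_n) : nat := nth 0%N (halfunits q) j.

Lemma half_unit_mem j : half_unit j \in halfunits q.
Proof. by rewrite mem_nth // size_half. Qed.

Lemma half_unit_inj : injective half_unit.
Proof.
move=> i j /eqP; rewrite nth_uniq ?size_half ?halfunits_uniq // => /eqP.
exact: val_inj.
Qed.

Lemma half_unit_surj b : b \in halfunits q -> exists j, half_unit j = b.
Proof. by case/(nthP 0%N) => i; rewrite size_half => iN e; exists (Ordinal iN). Qed.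

Lemma half_unit_props j : [/\ (0 < half_unit j)%N, (half_unit j < q)%N & coprime (half_unit j) q].
Proof.
have := half_unit_mem j; rewrite halfunitsP // => /and3P[h0 h2 hc]; split => //.
by apply: leq_trans h2; rewrite ltnS -addnn leq_addr.
Qed.

Definition mx_eval (M : 'M[C]_(n.*2)) (P : mpoly.mpoly (n.*2 * n.*2) rat) : C :=
  mpoly.meval (fun i => mxvec M 0 i) (mpoly.map_mpoly QC P).
Local Notation Xv i j := (mpoly.mpolyX rat (mpoly.mnm1 (mxvec_index i j))).

Lemma mx_eval_var (M : 'M[C]_(n.*2)) (i j : 'I_(n.*2)) : mx_eval M (Xv i j) = M i j.
Proof. by rewrite /mx_eval mpoly.map_mpolyX mpoly.mevalXU mxvecE. Qed.

Lemma mx_evalD (M : 'M[C]_(n.*2)) (P Q : mpoly.mpoly (n.*2 * n.*2) rat) : mx_eval M (P + Q) = mx_eval M P + mx_eval M Q.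
Proof. by rewrite /mx_eval (rmorphD (mpoly.map_mpoly QC)) mpoly.mevalD. Qed.

Lemma mx_evalB (M : 'M[C]_(n.*2)) (P Q : mpoly.mpoly (n.*2 * n.*2) rat) : mx_eval M (P - Q) = mx_eval M P - mx_eval M Q.
Proof. by rewrite /mx_eval (rmorphB (mpoly.map_mpoly QC)) mpoly.mevalB. Qed.

Lemma mx_eval_sum (M : 'M[C]_(n.*2)) (I : finType) (F : I -> mpoly.mpoly (n.*2 * n.*2) rat) :
  mx_eval M (\sum_i F i) = \sum_i mx_eval M (F i).
Proof.
apply: (big_morph (mx_eval M) (mx_evalD M)).
by rewrite /mx_eval (rmorph0 (mpoly.map_mpoly QC)) mpoly.meval0.
Qed.

Lemma mx_eval_scale (M : 'M[C]_(n.*2)) a (P : mpoly.mpoly (n.*2 * n.*2) rat) : mx_eval M (a *: P) = QC a * mx_eval M P.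
Proof. by rewrite /mx_eval mpoly.map_mpolyZ mpoly.mevalZ. Qed.

Lemma mx_eval_mul (M : 'M[C]_(n.*2)) (P Q : mpoly.mpoly (n.*2 * n.*2) rat) : mx_eval M (P * Q) = mx_eval M P * mx_eval M Q.
Proof. by rewrite /mx_eval (rmorphM (mpoly.map_mpoly QC)) mpoly.mevalM. Qed.

Lemma mx_eval_const (M : 'M[C]_(n.*2)) a : mx_eval M (mpoly.mpolyC _ a) = QC a.
Proof. by rewrite /mx_eval mpoly.map_mpolyC mpoly.mevalC. Qed.

Lemma unitary_algebraic : algebraic_Q_subgroup (@unitary_gp R q n T).
Proof.
pose G := gram q T.
pose P1 (i j : 'I_(n.*2)) : mpoly.mpoly (n.*2 * n.*2) rat := \sum_k T k j *: Xv i k - \sum_k T i k *: Xv k j.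
pose P2 (i j : 'I_(n.*2)) : mpoly.mpoly (n.*2 * n.*2) rat :=
  \sum_k \sum_l G k l *: (Xv i k * Xv j l) - mpoly.mpolyC _ (G i j).
have evP1 M i j : mx_eval M (P1 i j) = (M *m map_mx QC T) i j - (map_mx QC T *m M) i j.
  rewrite /P1 mx_evalB; congr (_ - _); rewrite mx_eval_sum mxE; apply: eq_bigr => k _.
    by rewrite mx_eval_scale mx_eval_var mxE mulrC.
  by rewrite mx_eval_scale mx_eval_var mxE.
have evP2 M i j : mx_eval M (P2 i j) = (M *m map_mx QC G *m M^T) i j - (map_mx QC G) i j.
  rewrite /P2 mx_evalB mx_eval_const mxE; congr (_ - _); last by rewrite mxE.
  transitivity (\sum_l \sum_k M i k * map_mx QC G k l * M^T l j).
    rewrite mx_eval_sum exchange_big; apply: eq_bigr => k _; rewrite mx_eval_sum; apply: eq_bigr => l _.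
    by rewrite mx_eval_scale mx_eval_mul !mx_eval_var !mxE; ring.
  by apply: eq_bigr => l _; rewrite [(M *m map_mx QC G) i l]mxE mulr_suml.
split.
- exists [set P | exists i j, P = P1 i j \/ P = P2 i j]; apply/seteqP; split => M /=.
    move=> [Mu MT MG]; split => // P [i [j [->|->]]].
      by have := evP1 M i j; rewrite MT subrr.
    by have := evP2 M i j; rewrite MG subrr.
  move=> [Mu h]; split => //; apply/matrixP => i j; apply/eqP; rewrite -subr_eq0.
    by rewrite -evP1; apply/eqP; apply: h; exists i, j; left.
  by rewrite -evP2; apply/eqP; apply: h; exists i, j; right.
- by split; [exact: unitmx1 | rewrite mulmx1 mul1mx | rewrite trmx1 mulmx1 mul1mx].
- move=> M M' [Mu MT MG] [Mu' MT' MG']; split.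
  + by rewrite unitmx_mul Mu.
  + by rewrite -[LHS]mulmxA MT' [LHS]mulmxA MT -[LHS]mulmxA.
  + have -> : M *m M' *m map_mx QC (gram q T) *m (M *m M')^T =
        M *m (M' *m map_mx QC (gram q T) *m M'^T) *m M^T by rewrite trmx_mul !mulmxA.
    by rewrite MG' MG.
- move=> M [Mu MT MG]; split.
  + by rewrite unitmx_inv.
  + by apply: (can_inj (mulKmx Mu)); rewrite mulKVmx // mulmxA MT mulmxK.
  + rewrite -[in LHS]MG !mulmxA mulVmx // mul1mx -[LHS]mulmxA -trmx_mul mulVmx // trmx1.
    by rewrite mulmx1.
Qed.

Lemma hodge_group_unitary M : hodge_group B M -> @unitary_gp R q n T M.
Proof.
move=> h; apply: h; first exact: unitary_algebraic.
move=> A /(hodge_circleE q_odd q_gt1 hCM Bfree) [z [z1 ->]].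
by apply: (circ_unitary q_odd q_gt1 hCM); rewrite -normr_eq0 z1 oner_eq0.
Qed.

(* An s-dimensional torus contains 2^s points of order dividing 2, and the
   unitary group only 2^n. *)
Lemma hodge_torus_rank s (phi : ('I_s -> C) -> 'M[C]_(n.*2)) :
  torus_embedding (hodge_group B) phi -> (s <= n)%N.
Proof.
move=> [phiG phiM phi_inj _].
have [V [Vu Vpi]] := exists_eigenbasis R q_gt1 Tq TPhi dimE.
pose sg (b : {ffun 'I_s -> bool}) (i : 'I_s) : C := (-1) ^+ b i.
have sg0 b i : sg b i != 0 by rewrite signr_eq0.
have one0 (i : 'I_s) : (fun=> 1 : C) i != 0 by rewrite oner_eq0.
have phi1 : phi (fun=> 1) = 1%:M.
  have [u _ _] := hodge_group_unitary (phiG _ one0).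
  have := phiM _ _ one0 one0; rewrite (_ : (fun i => _) = (fun=> 1)); last by apply/funext => i; rewrite mulr1.
  by move=> e; rewrite -[LHS](mulKmx u) -e mulVmx.
have phi2 b : phi (sg b) *m phi (sg b) = 1%:M.
  rewrite -phiM // -phi1; congr phi; apply/funext => i.
  by rewrite -signr_addb addbb.
have /boolp.choice[x hx] b := unitary_diag q_gt1 hCM Vu Vpi (hodge_group_unitary (phiG _ (sg0 b))).
have x2 b i : x b i = 1 \/ x b i = -1.
  have [h _] := hx b; have : row i V *m (phi (sg b) *m phi (sg b)) = (x b i ^+ 2) *: row i V.
    by rewrite mulmxA h -scalemxAl h scalerA expr2.
  rewrite phi2 mulmx1 => /eqP; rewrite eq_sym -subr_eq0 -[X in _ - X]scale1r -scalerBl scaler_eq0.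
  have V0 : (row i V == 0) = false.
    apply/negP => /eqP r0; have := mulmxV Vu; move/(congr1 (row i)).
    rewrite row_mul r0 mul0mx => /rowP/(_ i); rewrite !mxE eqxx => /eqP.
    by rewrite eq_sym oner_eq0.
  by rewrite V0 orbF subr_eq0 sqrf_eq1 => /orP[] /eqP; [left | right].
have idx_ex j : exists i : 'I_(n.*2), unit_res q i = half_unit j.
  have [_ hq hc] := half_unit_props j; have [i hi] := unit_res_surj q_gt1 dimE hc.
  by exists i; rewrite hi modn_small.
have /boolp.choice[idx hidx] := idx_ex.
(* An element of order dividing 2 acts by signs, and the signs on the CM type determine the opposite
   ones through [x i * x j = 1]. *)
pose c b : {ffun 'I_n -> bool} := [ffun j => x b (idx j) == 1].
have c_inj : injective c.
  move=> b b' cc.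
  have xh j : x b (idx j) = x b' (idx j).
    have := congr1 (fun f : {ffun 'I_n -> bool} => f j) cc; rewrite !ffunE.
    have n1 : (-1 == 1 :> C) = false by rewrite eqNr oner_eq0.
    by case: (x2 b (idx j)) => ->; case: (x2 b' (idx j)) => ->; rewrite ?eqxx ?n1.
  have xx i : x b i = x b' i.
    have [uq uc] := unit_res_mem dimE i.
    case: (boolP (unit_res q i \in halfunits q)) => hi.
      have [j hj] := half_unit_surj hi; rewrite -(_ : idx j = i) //.
      by apply: (unit_res_inj dimE); rewrite hidx.
    have : (q.-1 * unit_res q i %% q)%N \in halfunits q by rewrite half_or // modn_small.
    case/half_unit_surj => j hj.
    have e : (unit_res q i + unit_res q (idx j) = 0 %[mod q])%N.
      by rewrite hidx hj modnDmr -mulSn prednK // mod0n modnMr.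
    have := (hx b).2 _ _ e; have := (hx b').2 _ _ e; rewrite -xh => <- /mulIf; apply.
    by case: (x2 b (idx j)) => ->; rewrite ?oppr_eq0 oner_eq0.
  have : phi (sg b) = phi (sg b').
    apply: (can_inj (mulKmx Vu)); apply/row_matrixP => i.
    by rewrite !row_mul (hx b).1 (hx b').1 xx.
  move/(phi_inj _ _ (sg0 b) (sg0 b')) => e; apply/ffunP => i.
  have := congr1 (fun f => f i) e; rewrite /sg => /eqP.
  case: (b i) (b' i) => [] [] //=; rewrite expr0 expr1; first by rewrite eqNr oner_eq0.
  by rewrite eq_sym eqNr oner_eq0.
have := leq_card c c_inj; rewrite !card_ffun !card_ord card_bool.
by rewrite leq_exp2l.
Qed.

End Upper.

(** * Laurent polynomials in one variable *)

Section Laurent.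
Variable C : fieldType.

Definition laurent (f : C -> C) :=
  exists (N : nat) (Q : {poly C}), forall z, z != 0 -> z ^+ N * f z = Q.[z].

Lemma laurent_cst a : laurent (fun=> a).
Proof. by exists 0%N, a%:P => z _; rewrite expr0 mul1r hornerC. Qed.

Lemma laurentD f g : laurent f -> laurent g -> laurent (fun z => f z + g z).
Proof.
move=> [N [Q hQ]] [M [P hP]]; exists (N + M)%N, ('X^M * Q + 'X^N * P) => z z0.
by rewrite hornerD !hornerM !hornerXn -hQ // -hP // exprD; ring.
Qed.

Lemma laurentM f g : laurent f -> laurent g -> laurent (fun z => f z * g z).
Proof.
move=> [N [Q hQ]] [M [P hP]]; exists (N + M)%N, (Q * P) => z z0.
by rewrite hornerM -hQ // -hP // exprD mulrACA.
Qed.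

Lemma laurent_expz (k : int) : laurent (fun z => z ^ k).
Proof.
case: k => k; first by exists 0%N, 'X^k => z _; rewrite expr0 mul1r hornerXn.
by exists k.+1, 1 => z z0; rewrite NegzE -exprnN mulfV ?expf_neq0 // hornerC.
Qed.

Lemma laurent_sum (I : Type) (r : seq I) (P : pred I) (F : I -> C -> C) :
  (forall i, laurent (F i)) -> laurent (fun z => \sum_(i <- r | P i) F i z).
Proof.
move=> hF; elim: r => [|i r IH].
  by have [N [Q h]] := laurent_cst 0; exists N, Q => z z0; rewrite big_nil h.
case: (boolP (P i)) => Pi.
  have [N [Q h]] := laurentD (hF i) IH; exists N, Q => z z0.
  by rewrite big_cons Pi h.
by have [N [Q h]] := IH; exists N, Q => z z0; rewrite big_cons (negbTE Pi) h.
Qed.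

Lemma laurent_prod (I : Type) (r : seq I) (F : I -> C -> C) :
  (forall i, laurent (F i)) -> laurent (fun z => \prod_(i <- r) F i z).
Proof.
move=> hF; elim: r => [|i r IH].
  by have [N [Q h]] := laurent_cst 1; exists N, Q => z z0; rewrite big_nil h.
have [N [Q h]] := laurentM (hF i) IH; exists N, Q => z z0.
by rewrite big_cons h.
Qed.

Lemma laurentX f k : laurent f -> laurent (fun z => f z ^+ k).
Proof.
move=> hf; elim: k => [|k IH].
  by have [N [Q h]] := laurent_cst 1; exists N, Q => z z0; rewrite expr0 h.
by have [N [Q h]] := laurentM hf IH; exists N, Q => z z0; rewrite exprS h.
Qed.

Lemma laurent_eq0 f (w : nat -> C) : laurent f -> injective w -> (forall k, w k != 0) ->
  (forall k, f (w k) = 0) -> forall z, z != 0 -> f z = 0.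
Proof.
move=> [N [Q hQ]] w_inj w0 fw z z0.
have Q0 : Q = 0.
  apply/eqP/negPn/negP => Qn0.
  have := @max_poly_roots _ Q [seq w k | k <- iota 0 (size Q)] Qn0.
  rewrite size_map size_iota ltnn map_inj_uniq // iota_uniq => h.
  have : false by apply: h => //; apply/allP => x /mapP[k _ ->]; apply/rootP; rewrite -hQ // fw mulr0.
  by [].
have := hQ z z0; rewrite Q0 horner0 => /eqP; rewrite mulf_eq0 expf_eq0 (negbTE z0) andbF /=.
by move/eqP.
Qed.

End Laurent.

(** * Rational equations under conjugation and along Laurent families *)

Section MpolyEval.
Variable R : realType.
Local Notation C := R[i].
Local Notation QC := (ratr : rat -> C).
Local Notation toC := (map_poly (ratr : rat -> C)).

Lemma meval_ratE k (v : 'I_k -> C) (P : mpoly.mpoly k rat) :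
  mpoly.meval v (mpoly.map_mpoly QC P) =
  \sum_(m <- mpoly.msupp P) QC (mpoly.mcoeff m P) * \prod_i v i ^+ (m i).
Proof.
rewrite {1}(mpoly.mpolyE P) (rmorph_sum (mpoly.map_mpoly QC)) (raddf_sum (mpoly.meval v)).
by apply: eq_bigr => m _; rewrite /= mpoly.map_mpolyZ mpoly.mevalZ mpoly.map_mpolyX mpoly.mevalX.
Qed.

Lemma meval_galois k (P : mpoly.mpoly k rat) (f : 'I_k -> {poly rat}) q (z w : C) :
  q.-primitive_root z -> q.-primitive_root w ->
  mpoly.meval (fun i => (toC (f i)).[z]) (mpoly.map_mpoly QC P) = 0 ->
  mpoly.meval (fun i => (toC (f i)).[w]) (mpoly.map_mpoly QC P) = 0.
Proof.
move=> hz hw; pose H : {poly rat} :=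
  \sum_(m <- mpoly.msupp P) mpoly.mcoeff m P *: \prod_i f i ^+ (m i).
have HE x : mpoly.meval (fun i => (toC (f i)).[x]) (mpoly.map_mpoly QC P) = (toC H).[x].
  rewrite meval_ratE /H rmorph_sum horner_sum; apply: eq_bigr => m _.
  rewrite /= map_polyZ hornerZ /= rmorph_prod horner_prod; congr (_ * _).
  by apply: eq_bigr => i _; rewrite rmorphXn horner_exp.
by rewrite !HE => /(prim_root_galois hz hw).
Qed.

Lemma meval_laurent k (P : mpoly.mpoly k rat) (v : C -> 'I_k -> C) :
  (forall i, laurent (fun z => v z i)) ->
  laurent (fun z => mpoly.meval (v z) (mpoly.map_mpoly QC P)).
Proof.
move=> hv; have : laurent (fun z => \sum_(m <- mpoly.msupp P) QC (mpoly.mcoeff m P) * \prod_i v z i ^+ (m i)).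
  apply: laurent_sum => m; apply: laurentM; first exact: laurent_cst.
  by apply: laurent_prod => i; exact: laurentX.
by move=> [N [Q h]]; exists N, Q => z z0; rewrite meval_ratE h.
Qed.

End MpolyEval.

(** * Lower bound: a torus of dimension n in the Hodge group *)

Section Lower.
Variable R : realType.
Local Notation C := R[i].
Local Notation QC := (ratr : rat -> C).
Local Notation toC := (map_poly (ratr : rat -> C)).
Variables (q n : nat) (T : 'M[rat]_(n.*2)) (B : 'M[C]_(n.*2, n)).
Hypotheses (q_odd : odd q) (q_gt1 : (1 < q)%N) (hCM : CM_by q T B).
Hypothesis Bfree : forall c : 'rV[R]_(n.*2), map_mx (real_complex R) c *m B = 0 -> c = 0.
Hypothesis q_reg : half_sum_regular R q.
Local Notation om := (croot R q).
Local Notation pi b := (eigenproj R q T b).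
Local Notation Dg := (@diag_op R q _ T).
Local Notation eps := (eps q).
Local Notation half_unit := (@half_unit q n).

Let q_gt0 : (0 < q)%N := ltnW q_gt1.
Let dimE : n.*2 = totient q. Proof. by case: hCM. Qed.
Let Tq : T ^+ q = 1. Proof. by case: hCM. Qed.
Let TPhi : poly_mx T (PhiQ q) = 0. Proof. by case: hCM. Qed.
Let om_prim : q.-primitive_root om := croot_prim R q_gt0.

(* The Galois conjugates of [circ]. *)
Definition circ_conj u (z : C) := Dg (fun b => z ^ eps (u * b)).

Lemma inv_mod u : coprime u q -> exists2 w, coprime w q & u * w = 1 %[mod q].
Proof.
move=> cu; exists (u ^ (totient q).-1)%N; first by rewrite coprimeXl.
by rewrite -expnS prednK ?totient_gt0 //; apply: Euler_exp_totient.
Qed.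

(** Reindexing by [c = u b] moves the conjugation to the projections: [pi (w * c)] comes from [pi c]
    by [om |-> om ^+ w], while the powers of [z] stay fixed. *)
Lemma circ_conjE u w z : coprime u q -> u * w = 1 %[mod q] ->
  circ_conj u z = \sum_(c < q) z ^ eps c *: pi (w * c).
Proof.
move=> cu uw; rewrite /circ_conj (DgE q_gt1 Tq TPhi).
pose F c : 'M[C]_(n.*2) := z ^ eps c *: pi (w * c).
have F_mod a b : a = b %[mod q] -> F a = F b.
  move=> ab; rewrite /F (eps_mod ab); congr (_ *: _); apply: eigenproj_mod => //.
  by rewrite -modnMmr ab modnMmr.
transitivity (\sum_(b < q) F (u * b)%N); last exact: sum_mod_mul q_gt0 cu F_mod.
apply: eq_bigr => b _; congr (_ *: _); apply: eigenproj_mod => //.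
by rewrite mulnA [(w * u)%N]mulnC -modnMml uw modnMml mul1n.
Qed.

Lemma circ_conj_entry_laurent u i j : laurent (fun z : C => circ_conj u z i j).
Proof.
have h : laurent (fun z : C => \sum_(b < q | coprime b q) z ^ eps (u * b) * (pi b) i j).
  by apply: laurent_sum => b; apply: laurentM; [exact: laurent_expz | exact: laurent_cst].
have [N [Q hQ]] := h; exists N, Q => z z0; rewrite -hQ // /circ_conj /diag_op summxE.
by congr (_ * _); apply: eq_bigr => b _; rewrite [in LHS]mxE.
Qed.

Section Closed.
Variable P : mpoly.mpoly (n.*2 * n.*2) rat.
Local Notation ev M := (mpoly.meval (fun i => mxvec M 0 i) (mpoly.map_mpoly QC P)).

Lemma ev_circ_laurent u : laurent (fun z : C => ev (circ_conj u z)).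
Proof.
apply: (@meval_laurent R _ P (fun z i => mxvec (circ_conj u z) 0 i)) => i.
case/mxvec_indexP: i => i j; have [N [Q h]] := circ_conj_entry_laurent u i j.
by exists N, Q => z z0; rewrite mxvecE h.
Qed.

Hypothesis P_circle : forall A, hodge_circle B A -> ev (map_mx (real_complex R) A) = 0.

(** Zariski density of the unit circle, through its infinitely many points
    [(1 + k i) / (1 - k i)]. *)
Lemma ev_circ z : z != 0 -> ev (circ_conj 1 z) = 0.
Proof.
pose w (k : nat) : C := (1 +i* k%:R) / (1 +i* (- k%:R)).
have d0 k : (1 +i* (- k%:R) : C) != 0 by rewrite eq_complex /= oner_eq0.
have n0 k : (1 +i* k%:R : C) != 0 by rewrite eq_complex /= oner_eq0.
have nJ k : `|1 +i* k%:R : C| = `|1 +i* (- k%:R) : C| by rewrite !normc_def /= sqrrN.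
apply: (laurent_eq0 (w := w) (ev_circ_laurent 1)).
- move=> k l /eqP; rewrite /w eqr_div ?d0 // => /eqP /(congr1 (@complex.Im R)) /= h.
  have : (k%:R : R) = l%:R by lra.
  by move/eqP; rewrite eqr_nat => /eqP.
- by move=> k; rewrite mulf_neq0 ?invr_neq0.
- move=> k; have w1 : `|w k| = 1 by rewrite /w normrM normrV ?unitfE // nJ divff // normr_eq0.
  have [A [hA eA]] := hodge_circle_circ q_odd q_gt1 hCM w1.
  have -> : circ_conj 1 (w k) = circ q T (w k) by apply: eq_Dg => b _; rewrite mul1n.
  by rewrite -eA P_circle.
Qed.

(** At a positive integer [z] the entries of the circle are rational polynomials in [om], so the
    equation passes to the conjugates; positive integers are again Zariski dense. The circle itself
    has only the rational points 1 and -1, whence the prior extension to all nonzero [z]. *)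
Lemma ev_circ_conj u z : coprime u q -> z != 0 -> ev (circ_conj u z) = 0.
Proof.
move=> cu; have [w cw uw] := inv_mod cu.
apply: (laurent_eq0 (w := fun k => k.+1%:R) (ev_circ_laurent u)).
- by move=> k l /eqP; rewrite eqr_nat => /eqP[].
- by move=> k; rewrite pnatr_eq0.
move=> k; pose r : rat := k.+1%:R.
have r0 : r != 0 by rewrite pnatr_eq0.
have rE e : (k.+1%:R : C) ^ e = QC (r ^ e).
  have -> : (k.+1%:R : C) = QC r by rewrite ratr_nat.
  by rewrite fmorphXz.
pose g c i j : {poly rat} := q%:R^-1 *: \sum_(l < q) (T ^+ l) i j *: 'X^(q.-1 * c * l).
have gE c v i j : (toC (g c i j)).[om ^+ v] = pi (v * c) i j.
  rewrite /g map_polyZ hornerZ /= fmorphV rmorph_nat /eigenproj mxE; congr (_ * _).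
  rewrite rmorph_sum horner_sum summxE; apply: eq_bigr => l _.
  rewrite /= map_polyZ hornerZ /= map_polyXn hornerXn !mxE mulrC -exprM; congr (om ^+ _ * _).
  by rewrite mulnA [(v * _)%N]mulnCA !mulnA.
pose f i j : {poly rat} := \sum_(c < q) r ^ eps c *: g c i j.
have fE v i j : (toC (f i j)).[om ^+ v] = (\sum_(c < q) (k.+1%:R : C) ^ eps c *: pi (v * c)) i j.
  rewrite rmorph_sum horner_sum summxE; apply: eq_bigr => c _.
  by rewrite /= map_polyZ hornerZ /= gE [RHS]mxE rE.
have fv v : (fun i => (toC (mxvec (\matrix_(i, j) f i j) 0 i)).[om ^+ v]) =
    (fun i => mxvec (\sum_(c < q) (k.+1%:R : C) ^ eps c *: pi (v * c)) 0 i).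
  apply/funext => i; case/mxvec_indexP: i => i j; rewrite !mxvecE -fE mxE.
  by [].
rewrite (circ_conjE _ cu uw) -fv.
have om1 : q.-primitive_root (om ^+ 1) by rewrite expr1.
have omw : q.-primitive_root (om ^+ w) by rewrite prim_root_exp_coprime.
apply: (meval_galois om1 omw); rewrite fv.
rewrite -(@circ_conjE 1 1) ?coprime1n //; apply: ev_circ.
by rewrite pnatr_eq0.
Qed.

End Closed.

Lemma sum_half_indicator c : \sum_(a <- halfunits q) (a == c %[mod q])%:R = ((c %% q)%N \in halfunits q)%:R :> C.
Proof.
have e a : a \in halfunits q -> (a == c %[mod q])%N = (a == c %% q)%N.
  rewrite halfunitsP // => /and3P[_ a2 _]; rewrite modn_small //.
  by apply: leq_trans a2; rewrite ltnS -addnn leq_addr.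
rewrite (eq_big_seq (fun a => (a == c %% q)%N%:R)) => [|a /e ->] //.
case: (boolP (_ \in _)) => hc; last first.
  rewrite big_seq big1 // => a ha; case: eqP => // ac; by rewrite -ac ha in hc.
rewrite (bigD1_seq (c %% q)%N) ?halfunits_uniq //= eqxx big1 ?addr0 // => a.
by move=> /negbTE ->.
Qed.

Lemma neg_mod_swap a b : (q.-1 * a == b %[mod q])%N = (a == q.-1 * b %[mod q])%N.
Proof.
have c1 : coprime q.-1 q by rewrite coprimePn.
by rewrite -(eqn_modMl_coprime _ _ c1) predpred_mod.
Qed.

Lemma half_units_split b : coprime b q ->
  exists j, (b %% q)%N = half_unit j \/ (q.-1 * b %% q)%N = half_unit j.
Proof.
move=> cb; case: (boolP ((b %% q)%N \in halfunits q)) => hb.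
  by have [j hj] := half_unit_surj q_odd q_gt1 hCM hb; exists j; left.
rewrite -half_or // in hb; have [j hj] := half_unit_surj q_odd q_gt1 hCM hb.
by exists j; right.
Qed.

Let half_unitP j : [/\ (0 < half_unit j)%N, (half_unit j < q)%N & coprime (half_unit j) q] :=
  half_unit_props q_odd q_gt1 hCM j.
Let half_unit_half j : half_unit j \in halfunits q := half_unit_mem q_odd q_gt1 hCM j.

Lemma neg_half_unit_half j : (q.-1 * half_unit j %% q)%N \notin halfunits q.
Proof.
have [_ hq hc] := half_unitP j; rewrite -half_or ?coprimeMl ?coprimePn // predpred_mod //.
by rewrite modn_small.
Qed.

Lemma neg_half_unit_neq j l : (q.-1 * half_unit j %% q)%N != half_unit l.
Proof. by apply: contraNneq (neg_half_unit_half j) => ->. Qed.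

Definition sign_mx : 'M[int]_n := \matrix_(l, j) eps (half_unit l * half_unit j).

(** A row vector killed by [sign_mx] defines an odd function supported on the units, whose half sums
    over translates are up to sign the entries of the product; regularity makes the function
    zero. *)
Lemma det_sign_mx : \det sign_mx != 0.
Proof.
rewrite -(intr_eq0 C) -det_map_mx; apply/negP => /det0P[x x0 xE].
pose F c : C := \sum_l x 0 l * ((c == half_unit l %[mod q])%:R - (c == q.-1 * half_unit l %[mod q])%:R).
have xE' j : \sum_l x 0 l * (eps (half_unit l * half_unit j))%:~R = 0 :> C.
  have := congr1 (fun v : 'rV[C]_n => v 0 j) xE; rewrite mxE [RHS]mxE => e; rewrite -[RHS]e.
  by apply: eq_bigr => l _; rewrite !mxE.
have Feq0 a : coprime a q -> F a = 0.
  apply: q_reg => {a}.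
  - by move=> a b ab; apply: eq_bigr => l _; rewrite ab.
  - move=> a; rewrite /F -sumrN; apply: eq_bigr => l _.
    by rewrite !neg_mod_swap predpred_mod // -mulrN opprB.
  - move=> u cu; have [w cw uw] := inv_mod cu.
    have sw a b : (u * a == b %[mod q])%N = (a == w * b %[mod q])%N.
      rewrite -(eqn_modMl_coprime _ _ cw) mulnA [(w * u)%N]mulnC -modnMml uw modnMml.
      by rewrite mul1n.
    rewrite /F exchange_big /=.
    transitivity (\sum_l x 0 l * (eps (w * half_unit l))%:~R).
      apply: eq_bigr => l _; rewrite -mulr_sumr; congr (_ * _).
      under eq_bigr => a _ do rewrite !sw.
      rewrite big_split /= sumrN !sum_half_indicator /eps rmorphB /= -!pmulrn.
      by rewrite [(w * (_ * _))%N]mulnCA.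
    have [j [hj|hj]] := half_units_split cw.
      rewrite -[RHS](xE' j); apply: eq_bigr => l _; congr (_ * _%:~R); apply: eps_mod.
      by rewrite -modnMml hj mulnC.
    rewrite -[RHS](oppr0 C) -[X in - X](xE' j) -sumrN; apply: eq_bigr => l _.
    rewrite -mulrN -(rmorphN (intmul 1)); congr (_ * _%:~R).
    rewrite -[LHS]opprK -epsN //; congr (- _); apply: eps_mod.
    by rewrite mulnA -modnMml hj mulnC.
case/eqP: x0; apply/rowP => l; rewrite [RHS]mxE.
have [_ lq lc] := half_unitP l; rewrite -(Feq0 _ lc) /F (bigD1 l) //= eqxx.
have e1 : (half_unit l == q.-1 * half_unit l %[mod q])%N = false.
  by rewrite [X in X == _]modn_small //; apply/negbTE; rewrite eq_sym neg_half_unit_neq.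
rewrite e1 subr0 mulr1 big1 ?addr0 // => j jl.
have [_ jq _] := half_unitP j; rewrite !(modn_small lq) (modn_small jq).
have -> : (half_unit l == half_unit j) = false.
  by apply/eqP => /(half_unit_inj q_odd q_gt1 hCM) e; rewrite e eqxx in jl.
by rewrite eq_sym (negbTE (neg_half_unit_neq _ _)) subrr mulr0.
Qed.

Lemma root_expz (d : int) (t : C) : d != 0 -> t != 0 -> exists2 s : C, s != 0 & s ^ d = t.
Proof.
case: d => [[//|k]|k] _ t0.
  have e : (k.+1.-root t) ^+ k.+1 = t by rewrite rootCK.
  by exists (k.+1.-root t) => //; apply: contraNneq t0 => h; rewrite -e h expr0n.
have e : (k.+1.-root t^-1) ^+ k.+1 = t^-1 by rewrite rootCK.
exists (k.+1.-root t^-1); last by rewrite NegzE -exprnN e invrK.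
by apply: contraNneq t0 => h; rewrite -[t]invrK -e h expr0n invr0.
Qed.

(** Free values on the CM type, extended to the opposite exponents by inversion, as the unitary
    group demands. *)
Definition coord (t : 'I_n -> C) (b : nat) : C :=
  \prod_l t l ^ ((b %% q == half_unit l)%N%:Z - (q.-1 * b %% q == half_unit l)%N%:Z).

Lemma coord_half t b j : (b %% q)%N = half_unit j -> coord t b = t j.
Proof.
move=> bj; have bn : (q.-1 * b %% q = q.-1 * half_unit j %% q)%N by rewrite -modnMmr bj.
rewrite /coord (bigD1 j) //= bj bn eqxx (negbTE (neg_half_unit_neq j j)) subr0 expr1z big1 ?mulr1 // => l lj.
rewrite (negbTE (neg_half_unit_neq j l)).
have -> : (half_unit j == half_unit l) = false by apply/eqP => /(half_unit_inj q_odd q_gt1 hCM) e; rewrite e eqxx in lj.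
by rewrite subrr expr0z.
Qed.

Lemma coord_neg t b : coord t (q.-1 * b) = (coord t b)^-1.
Proof.
rewrite /coord -prodfV; apply: eq_bigr => l _.
by rewrite predpred_mod // invr_expz opprB.
Qed.

Lemma coord_neghalf t b j : (q.-1 * b %% q)%N = half_unit j -> coord t b = (t j)^-1.
Proof. by move=> h; rewrite -(coord_half t h) coord_neg invrK. Qed.

Definition torus t := Dg (coord t).

(** The product of the conjugate circles is a monomial map with exponent matrix [sign_mx]. It is
    onto because the determinant is nonzero: extract roots of that order and apply the adjugate. *)
Lemma torus_circ_conj (t : 'I_n -> C) : (forall l, t l != 0) ->
  exists2 z : 'I_n -> C, (forall l, z l != 0)
    & torus t = Dg (fun b => \prod_l z l ^ eps (half_unit l * b)).
Proof.
move=> t0; have /boolp.choice[s hs] j : exists s : C, s != 0 /\ s ^ \det sign_mx = t j.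
  by have [s s0 e] := root_expz det_sign_mx (t0 j); exists s.
have s0 j := (hs j).1.
pose z l := \prod_k s k ^ (\adj sign_mx) k l.
have zj j : \prod_l z l ^ eps (half_unit l * half_unit j) = t j.
  have -> : \prod_l z l ^ eps (half_unit l * half_unit j) = \prod_k s k ^ (\adj sign_mx *m sign_mx) k j.
    transitivity (\prod_l \prod_k s k ^ ((\adj sign_mx) k l * sign_mx l j)).
      apply: eq_bigr => l _; rewrite /z mxE -[LHS](_ : \prod_k (s k ^ (\adj sign_mx) k l) ^ eps (half_unit l * half_unit j) = _).
        by apply: eq_bigr => k _; rewrite exprz_exp.
      elim/big_rec2: _ => [|k y1 y2 _ ->]; first by rewrite exp1rz.
      by rewrite expfzMl.
    rewrite exchange_big; apply: eq_bigr => k _; rewrite mxE.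
    by elim/big_rec2: _ => [|l y1 y2 _ ->]; rewrite ?expr0z // expfzDr.
  rewrite mul_adj_mx (bigD1 j) //= mxE eqxx mulr1n (hs j).2 big1 ?mulr1 // => k kj.
  by rewrite mxE (negbTE kj) mulr0n expr0z.
exists z; first by move=> l; apply/prodf_neq0 => k _; rewrite expfz_neq0.
apply: eq_Dg => b cb; have [j [hj|hj]] := half_units_split cb.
  rewrite (coord_half t hj) -zj; apply: eq_bigr => l _; congr (_ ^ _).
  by apply: eps_mod; rewrite -[RHS]modnMmr hj.
rewrite (coord_neghalf t hj) -zj -prodfV; apply: eq_bigr => l _.
have bE : q.-1 * half_unit j = b %[mod q] by rewrite -hj modnMmr predpred_mod.
rewrite invr_expz -epsN //; congr (_ ^ _); apply: eps_mod.
by rewrite [in LHS]mulnCA -[LHS]modnMmr bE modnMmr.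
Qed.

Lemma torus_hodge t : (forall l, t l != 0) -> hodge_group B (torus t).
Proof.
move=> t0 G [[S GE] G1 GM _] hG.
have Gu l z : z != 0 -> G (circ_conj (half_unit l) z).
  move=> z0; rewrite GE; split => [|P SP].
    by apply: (Dg_unitmx q_gt1 Tq TPhi) => // b _; rewrite expfz_neq0.
  have [_ _ lc] := half_unitP l; apply: (@ev_circ_conj P) => // A hA.
  by have := hG A hA; rewrite GE => -[_]; apply.
have [z z0 ->] := torus_circ_conj t0.
elim: (index_enum _) => [|l r IH].
  rewrite (_ : Dg _ = 1%:M) // -(Dg1 R q_gt1 Tq TPhi); apply: eq_Dg => b _.
  by rewrite big_nil.
rewrite (_ : Dg _ = circ_conj (half_unit l) (z l) *m Dg (fun b => \prod_(i <- r) z i ^ eps (half_unit i * b))).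
  by apply: GM => //; apply: Gu.
by rewrite (DgM q_gt1 Tq TPhi); apply: eq_Dg => b _; rewrite big_cons.
Qed.

Lemma torus_torus_embedding : torus_embedding (hodge_group B) torus.
Proof.
split.
- exact: torus_hodge.
- move=> s t _ _; rewrite (DgM q_gt1 Tq TPhi); apply: eq_Dg => b _.
  by rewrite -big_split; apply: eq_bigr => l _; rewrite expfzMl.
- move=> s t _ _ st; apply/funext => j; have [_ jq jc] := half_unitP j.
  have := Dg_inj q_gt1 Tq TPhi dimE st jq jc.
  by rewrite !(@coord_half _ _ j) ?modn_small.
(* Exponents after multiplication by the product of all [t l]: 2, 0 or 1 according as [b] is
   [half_unit l], its opposite or neither. The subtraction in [nat] never truncates. *)
pose e b l := (1 + (b %% q == half_unit l) - (q.-1 * b %% q == half_unit l))%N.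
exists 1%N, (fun i j => \sum_(b < q | coprime b q)
  (pi b i j) *: \prod_l mpoly.mpolyX C (mpoly.mnm1 l) ^+ e b l) => t t0 i j.
rewrite expr1 /torus /diag_op summxE mulr_sumr (raddf_sum (mpoly.meval t)).
apply: eq_bigr => b _; rewrite [in LHS]mxE mulrA mulrC /= mpoly.mevalZ; congr (_ * _).
rewrite rmorph_prod -big_split; apply: eq_bigr => l _.
rewrite rmorphXn /= mpoly.mevalXU /e.
by case: (_ == _); case: (_ == _); rewrite ?subrr ?subr0 ?sub0r ?expr0z ?mulr1 // -invr_expz ?expr1z divff.
Qed.

Lemma hodge_group_rank : alg_rank (hodge_group B) n.
Proof.
split; first by exists torus; exact: torus_torus_embedding.
by move=> s phi /(hodge_torus_rank q_odd q_gt1 hCM Bfree).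
Qed.

End Lower.

(** * The endomorphism algebra *)

Section ComplexMultiplication.
Variable R : realType.
Local Notation C := R[i].
Local Notation QC := (ratr : rat -> C).
Local Notation toC := (map_poly (ratr : rat -> C)).
Local Notation cj := (map_mx (@conjc R)).
Variables (q n : nat) (T : 'M[rat]_(n.*2)) (B : 'M[C]_(n.*2, n)) (L : set 'rV[C]_n).
Hypotheses (q_odd : odd q) (q_gt1 : (1 < q)%N) (hCM : CM_by q T B) (LB : lattice_basis B L).
Local Notation om := (croot R q).
Local Notation Dg := (@diag_op R q _ T).
Local Notation eps := (eps q).

Let Bfree : forall c : 'rV[R]_(n.*2), map_mx (real_complex R) c *m B = 0 -> c = 0.
Proof. by case: LB. Qed.
Let q_gt0 : (0 < q)%N := ltnW q_gt1.
Let dimE : n.*2 = totient q. Proof. by case: hCM. Qed.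
Let Tq : T ^+ q = 1. Proof. by case: hCM. Qed.
Let TPhi : poly_mx T (PhiQ q) = 0. Proof. by case: hCM. Qed.
Let om_prim : q.-primitive_root om := croot_prim R q_gt0.

(** The kernels of [B] and of its conjugate have the same rank and meet in 0, so each has rank at
    most [n]. *)
Lemma rank_basis : \rank B = n.
Proof.
apply/eqP; rewrite eqn_leq rank_leq_col /=.
have rJ : \rank (kermx (cj B)) = (n.*2 - \rank B)%N by rewrite mxrank_ker mxrank_map.
have dis : (kermx B :&: kermx (cj B) = 0)%MS.
  apply/eqP; rewrite -submx0; apply/row_subP => i; rewrite submx0; apply/eqP.
  have := row_sub i (kermx B :&: kermx (cj B))%MS; rewrite sub_capmx => /andP[/sub_kermxP h1 /sub_kermxP h2].
  exact: (basis_conj_inj Bfree).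
have e : \rank (kermx B + kermx (cj B))%MS = ((n.*2 - \rank B) + (n.*2 - \rank B))%N.
  by rewrite -{1}mxrank_ker -rJ -mxrank_sum_cap dis mxrank0 addn0.
have := rank_leq_col (kermx B + kermx (cj B))%MS; rewrite e.
have := rank_leq_row B; lia.
Qed.

Let pinvB : pinvmx B *m B = 1%:M.
Proof. by rewrite mulVpmx // /row_full rank_basis. Qed.

(** Comparing ranks, the kernel of [B] is exactly the row space of the projection [Pm] onto the
    eigenspaces outside the CM type, and [Dg x] commutes with [Pm]. *)
Lemma kermx_Dg (m : nat) (Y : 'M[C]_(m, n.*2)) x : Y *m B = 0 -> Y *m Dg x *m B = 0.
Proof.
move=> YB; pose Pp := Dg (fun b => (eps b == 1)%:R); pose Pm := Dg (fun b => (eps b != 1)%:R).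
have Psum : Pp + Pm = 1%:M.
  rewrite DgD -(Dg1 R q_gt1 Tq TPhi); apply: eq_Dg => b _.
  by case: (_ == _); rewrite ?addr0 ?add0r.
have PmB : Pm *m B = 0.
  by rewrite (Dg_scale_B q_odd q_gt1 hCM (z := 0)) ?scale0r // => b _ ->; rewrite eqxx.
have rker : \rank (kermx B) = n by rewrite mxrank_ker rank_basis -addnn addnK.
have rp : (\rank Pp <= n)%N.
  rewrite -(mxrank_map (@conjc R)) -[X in (_ <= X)%N]rker; apply: mxrankS; apply/sub_kermxP.
  rewrite /Pp /diag_op map_mx_sum mulmx_suml big1 // => b cb.
  rewrite map_mxZ conj_eigenproj //= -scalemxAl; case: eqP => [e|_]; last by rewrite conjc0 scale0r.
  rewrite eigenproj_neg_B ?scaler0 //.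
  by move: e; rewrite eps_half // modn_small //; case: (_ \in _).
have rm : (n <= \rank Pm)%N.
  have : (\rank (1%:M : 'M[C]_(n.*2)) <= \rank Pp + \rank Pm)%N by rewrite -Psum mxrank_add.
  by rewrite mxrank1; move: rp; lia.
have PmK : (Pm <= kermx B)%MS by apply/sub_kermxP.
have KPm : (kermx B <= Pm)%MS by rewrite -(geq_leqif (mxrank_leqif_sup PmK)) rker.
have /submxP[D ->] : (Y <= Pm)%MS by apply: submx_trans KPm; apply/sub_kermxP.
have comm : Pm *m Dg x = Dg x *m Pm.
  by rewrite !(DgM q_gt1 Tq TPhi); apply: eq_Dg => b _; rewrite mulrC.
by rewrite -[D *m Pm *m _]mulmxA comm -!mulmxA PmB !mulmx0.
Qed.

(* The action of [h.[T]] on the complex vector space. *)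
Definition tangent_act (h : {poly rat}) : 'M[C]_n := pinvmx B *m Dg (fun b => (toC h).[om ^+ b]) *m B.

Lemma B_pinv x : B *m (pinvmx B *m Dg x *m B) = Dg x *m B.
Proof.
have h : (B *m pinvmx B - 1%:M) *m B = 0 by rewrite mulmxBl -mulmxA pinvB mulmx1 mul1mx subrr.
have := kermx_Dg x h; rewrite !mulmxBl mul1mx => /eqP; rewrite subr_eq0 => /eqP <-.
by rewrite !mulmxA.
Qed.

Lemma B_tangent_act h : B *m tangent_act h = map_mx QC (poly_mx T h) *m B.
Proof. by rewrite /tangent_act B_pinv (poly_mx_Dg R q_gt1 Tq TPhi). Qed.

Lemma tangent_actD g h : tangent_act (g + h) = tangent_act g + tangent_act h.
Proof.
rewrite /tangent_act -mulmxDl -mulmxDr DgD; congr (_ *m _ *m _); apply: eq_Dg => b _.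
by rewrite rmorphD hornerD.
Qed.

Lemma tangent_actZ a h : tangent_act (a *: h) = QC a *: tangent_act h.
Proof.
rewrite /tangent_act scalemxAl scalemxAr DgZ; congr (_ *m _ *m _); apply: eq_Dg => b _.
by rewrite map_polyZ hornerZ.
Qed.

Lemma tangent_actM g h : tangent_act (g * h) = tangent_act g *m tangent_act h.
Proof.
rewrite [tangent_act g]/tangent_act -[RHS]mulmxA [B *m tangent_act h]B_pinv [RHS]mulmxA.
rewrite -[_ *m Dg _ *m Dg _]mulmxA (DgM q_gt1 Tq TPhi).
by congr (_ *m _ *m _); apply: eq_Dg => b _; rewrite rmorphM hornerM.
Qed.

Lemma tangent_act1 : tangent_act 1 = 1%:M.
Proof.
rewrite /tangent_act (_ : Dg _ = 1%:M) ?mulmx1 // -(Dg1 R q_gt1 Tq TPhi); apply: eq_Dg => b _.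
by rewrite rmorph1 hornerC.
Qed.

Lemma tangent_act_eq0 h : tangent_act h = 0 <-> PhiQ q %| h.
Proof.
split=> [h0|hd].
  have P0 : poly_mx T h = 0.
    apply/row_matrixP => i; rewrite row0; apply: (rat_basis_inj Bfree).
    by rewrite map_row -row_mul -B_tangent_act h0 mulmx0 row0.
  have cc : coprime 1 q by rewrite coprime1n.
  have e : Dg (fun b => (toC h).[om ^+ b]) = Dg (fun=> 0).
    by rewrite -(poly_mx_Dg R q_gt1 Tq TPhi) P0 map_mx0 /diag_op big1 // => b _; rewrite scale0r.
  have := Dg_inj q_gt1 Tq TPhi dimE e q_gt1 cc; rewrite expr1.
  exact: prim_root_min.
rewrite /tangent_act (_ : Dg _ = 0) ?mulmx0 ?mul0mx // /diag_op big1 // => b cb.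
have /rootP -> : root (toC h) (om ^+ b); last by rewrite scale0r.
by apply: root_map_dvdp hd _; apply: prim_root_PhiQ; rewrite prim_root_exp_coprime.
Qed.

Lemma tangent_act_sum (I : Type) (r : seq I) (F : I -> {poly rat}) :
  tangent_act (\sum_(i <- r) F i) = \sum_(i <- r) tangent_act (F i).
Proof. by apply: (big_morph tangent_act tangent_actD); apply/tangent_act_eq0; rewrite dvdp0. Qed.

Lemma lattice_int_row v : L v -> exists z : 'rV[int]_(n.*2), v = map_mx intr z *m B.
Proof.
case: LB => -> _ [k [c [s [hs ->]]]].
have /boolp.choice[f hf] i : exists j, row j B = s i by have [j _ <-] := hs i; exists j.
exists (\sum_i c i *: delta_mx 0 (f i)); rewrite map_mx_sum mulmx_suml; apply: eq_bigr => i _.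
by rewrite map_mxZ -scalemxAl map_delta_mx -rowE hf.
Qed.

Lemma rational_endo_tangent_act h : rational_endo L (tangent_act h).
Proof.
have [D D0 [z hz]] := common_denominator (mxvec (poly_mx T h)).
exists D; split => // v /lattice_int_row[x ->].
rewrite (_ : _ *+ D = map_mx intr (x *m vec_mx z) *m B); first exact: (int_row_in_lattice LB.1).
have e : map_mx (intr : int -> C) (vec_mx z) = D%:R *: map_mx QC (poly_mx T h).
  have : map_mx (intr : int -> rat) (vec_mx z) = D%:R *: poly_mx T h.
    by rewrite map_vec_mx hz linearZ /= mxvecK.
  move/(congr1 (map_mx QC)); rewrite map_mxZ /= ratr_nat => <-.
  by apply/matrixP => i j; rewrite !mxE ratr_int.
by rewrite -[in LHS]mulmxA B_tangent_act map_mxM e -scalemxAr -!scalemxAl -mulmxA scaler_nat.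
Qed.

(** The algebra is Q[X] / (Phi_q), of dimension [totient q = 2 n], acting through [tangent_act]. It
    is reduced because a polynomial whose square vanishes at a primitive root vanishes there
    itself. *)
Lemma CM_has_CM : has_CM L.
Proof.
pose e (i : 'I_(n.*2)) := tangent_act 'X^i; exists e => /=.
have tangent_act_poly (c : 'I_(n.*2) -> rat) : \sum_i QC (c i) *: e i = tangent_act (\sum_i c i *: 'X^i).
  by rewrite tangent_act_sum; apply: eq_bigr => i _; rewrite tangent_actZ.
have EP M : span_over (ratr : rat -> C) (range e) M <-> exists h, M = tangent_act h.
  split=> [[k [c [s [hs ->]]]]|[h ->]].
    have /boolp.choice[f hf] i : exists j, e j = s i by have [j _ <-] := hs i; exists j.
    exists (\sum_i c i *: 'X^(f i)); rewrite tangent_act_sum; apply: eq_bigr => i _.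
    by rewrite tangent_actZ -hf.
  exists n.*2, (fun i => (h %% PhiQ q)`_i), e; split; first by move=> i; exists i.
  have r0 : tangent_act (h %/ PhiQ q * PhiQ q) = 0 by apply/tangent_act_eq0; rewrite dvdp_mulIr.
  rewrite tangent_act_poly {1}(divp_eq h (PhiQ q)) tangent_actD r0 add0r; congr tangent_act.
  rewrite -poly_def; apply/polyP => i; rewrite coef_poly; case: ltnP => // hi.
  rewrite nth_default // (leq_trans _ hi) // -ltnS dimE -size_PhiQ ltn_modp.
  by rewrite monic_neq0 ?PhiQ_monic.
split.
- move=> c; rewrite tangent_act_poly => /tangent_act_eq0 hd i.
  have p0 : \sum_i c i *: 'X^i = 0 :> {poly rat}.
    apply: contrapT => /eqP p0; have := dvdp_leq p0 hd; rewrite size_PhiQ -dimE leqNgt => /negP; apply.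
    rewrite ltnS; apply: (leq_trans (size_sum _ _ _)); apply/bigmax_leqP => j _.
    by rewrite (leq_trans (size_scale_leq _ _)) // size_polyXn.
  have := congr1 (fun p : {poly rat} => p`_i) p0; rewrite coef_sum coef0 (bigD1 i) //=.
  rewrite coefZ coefXn eqxx mulr1 big1 ?addr0 // => j ji; rewrite coefZ coefXn.
  by rewrite (inj_eq val_inj) eq_sym (negbTE ji) mulr0.
- by move=> M /EP[h ->]; exact: rational_endo_tangent_act.
- by apply/EP; exists 1; rewrite tangent_act1.
- move=> M N /EP[g ->] /EP[h ->]; split; last by rewrite -[LHS]tangent_actM -[RHS]tangent_actM mulrC.
  by apply/EP; exists (g * h); rewrite tangent_actM.
- move=> M /EP[h ->]; rewrite -tangent_actM => /tangent_act_eq0 hd; apply/tangent_act_eq0; apply: (prim_root_min om_prim).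
  have := root_map_dvdp hd (prim_root_PhiQ om_prim) => /rootP /eqP.
  by rewrite rmorphM hornerM mulf_eq0 orbb => /eqP.
Qed.

End ComplexMultiplication.

(** * Simple factors of the Jacobian *)

Lemma simple_factor_CM (R : realType) g n n' (L : set 'rV[R[i]]_n) (L' : set 'rV[R[i]]_n')
    (B : 'M[R[i]]_(n.*2, n)) (B' : 'M[R[i]]_(n'.*2, n')) :
  simple_abelian_variety L -> lattice_basis B L -> lattice_basis B' L' ->
  isogenous (prod_torus L L') (jacobian_lattice R g.*2.+1) ->
  (forall q, (q %| g.*2.+1)%N -> (1 < q)%N -> half_sum_regular R q) ->
  exists q T, [/\ (q %| g.*2.+1)%N, (1 < q)%N & CM_by q T B].
Proof.
move=> [_ n0 L_simple] LB LB' iso reg.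
have [q [t [Z [qm q1 t0 tB]]]] := exists_torus_data LB LB' n0 iso (@jacobian_period_form R g).
have qo : odd q by apply: dvdn_odd qm _; rewrite /= odd_double.
have [T hT] := exists_CM_by LB.2 qo q1 (reg q qm q1) tB t0 LB.1 L_simple.
by exists q, T.
Qed.

(* n is the dimension of the simple factor X = C^n / L *)
Theorem theorem7p2p3 (R : realType) (p k n : nat) (L : set 'rV[complex R]_n) :
  prime p -> odd p -> (0 < k)%N ->
  simple_factor L (jacobian_lattice R (p ^ k)%N) ->
  nondegenerate_av L.
Proof.
move=> pp po k0 [Ls [n' [L' [[[B' LB'] _] iso]]]].
have mE : (p ^ k = (p ^ k)./2.*2.+1)%N by rewrite -[LHS]odd_double_half oddX po orbT.
have [av _ _] := Ls; have [[B LB] _] := av.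
have reg q : (q %| p ^ k)%N -> (1 < q)%N -> half_sum_regular R q.
  move=> /(dvdn_pfactor _ _ pp)[j _ ->] q1; apply: half_sum_regular_prime_power => //.
  by case: j q1.
have odd_dvd q : (q %| p ^ k)%N -> odd q.
  by move=> /dvdn_odd; apply; rewrite oddX po orbT.
have CM (B1 : 'M[complex R]_(n.*2, n)) : lattice_basis B1 L ->
    exists q T, [/\ (q %| p ^ k)%N, (1 < q)%N & CM_by q T B1].
  move=> LB1; move: iso reg; rewrite mE => iso reg.
  exact: simple_factor_CM Ls LB1 LB' iso reg.
split => //.
  by have [q [T [qm q1 hT]]] := CM B LB; apply: CM_has_CM (odd_dvd q qm) q1 hT LB.
move=> B1 LB1; have [q [T [qm q1 hT]]] := CM B1 LB1.
exact: hodge_group_rank (odd_dvd q qm) q1 hT LB1.2 (reg q qm q1).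
Qed.
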